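(* Let $d\geq 1$ and let $\mathbf W=(\mathbf W(t_1,\ldots,t_d):(t_1,\ldots,t_d)\in[0,1]^d)$ be a standard Brownian sheet on $[0,1]^d$. For $n\geq 2$ put $$G_n^{(d)}:=\int_{[1/n,1]^d}\frac{\mathbf W(t_1,\ldots,t_d)^2}{t_1^2\cdots t_d^2}\,\mathrm d(t_1,\ldots,t_d),\qquad F_n^{(d)}:=\frac{G_n^{(d)}-(\log n)^d}{\big(2\log n-2(1-1/n)\big)^{d/2}},$$ and $$\Delta_n:=\frac{1}{8\sqrt2}\Big(\frac{\log n}{120}\Big)^{d/4}.$$ Then the following hold. (a) If $(a_n:n\geq 2)$ is a real sequence with $\lim_{n\to\infty}a_n=\infty$ and $\lim_{n\to\infty}a_n/\Delta_n=0$, then $(a_n^{-1}F_n^{(d)}:n\geq 2)$ satisfies a moderate deviation principle, that is, a large deviation principle with speed $a_n^2$ and rate function $\mathcal I(z)=z^2/4$. (b) There are absolute constants $c_0,c_1,c_2>0$ such that, for $n\geq 2$ with $\Delta_n\geq c_0$ and $0\leq z\leq c_1\Delta_n$, $$\bigg|\log\frac{\mathbb P(F_n^{(d)}\geq z)}{1-\Phi_2(z)}\bigg|\leq c_2\,\frac{1+(z/\sqrt2)^3}{\Delta_n}\qquad\text{and}\qquad\bigg|\log\frac{\mathbb P(F_n^{(d)}\leq -z)}{\Phi_2(-z)}\bigg|\leq c_2\,\frac{1+(z/\sqrt2)^3}{\Delta_n}.$$ (c) For all $n\geq 2$ and $z\geq 0$, $$\mathbb P(|F_n^{(d)}|\geq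 z)\leq 2\exp\Big(-\frac14\min\Big\{\frac{z^2}{2},\,z\Delta_n\Big\}\Big).$$
   Context: A standard Brownian sheet on $[0,1]^d$ is a (continuous) centred Gaussian random field with covariance $\mathbb E[\mathbf W(t_1,\ldots,t_d)\mathbf W(s_1,\ldots,s_d)]=\prod_{i=1}^d\min(t_i,s_i)$. $\Phi_{\sigma^2}$ denotes the distribution function of a centred Gaussian random variable with variance $\sigma^2$ (so $\Phi_2$ has variance $2$). Large deviation principle: real random variables $(X_n)$ satisfy a large deviation principle with speed $s_n\to\infty$ ($s_n>0$) and rate function $\mathcal I:\mathbb R\to[0,\infty]$ (lower semi-continuous, compact level sets) if for all Borel sets $B\subset\mathbb R$ $$\liminf_{n\to\infty}s_n^{-1}\log\mathbb P(X_n\in B)\geq-\inf_{z\in\mathrm{int}(B)}\mathcal I(z),\qquad \limsup_{n\to\infty}s_n^{-1}\log\mathbb P(X_n\in B)\leq-\inf_{z\in\mathrm{cl}(B)}\mathcal I(z).$$ (Only large $n$, for which $a_n>0$, matters.) *)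

(* Defs.v *)
From HB Require Import structures.
From mathcomp Require Import all_boot all_order all_algebra.
From mathcomp Require Import all_classical all_reals all_analysis.

Set Implicit Arguments.
Unset Strict Implicit.
Unset Printing Implicit Defensive.

Import Order.TTheory GRing.Theory Num.Theory.
Import numFieldNormedType.Exports.

Local Open Scope classical_set_scope.
Local Open Scope ring_scope.

(* The n-fold product of a sigma-finite measure m, carried by n.-tuple T with its
   product sigma-algebra: a point mass on T^0, and on T^n.+1 the image of the
   product of m and of the measure on T^n under (x, u) |-> x :: u. *)
Section cons_measure.
Context d (T : measurableType d) (R : realType) (n : nat).
Variables (m : {sigma_finite_measure set T -> \bar R})
  (mu : {sigma_finite_measure set (n.-tuple T) -> \bar R}).

Let tcons (p : T * n.-tuple T) : n.+1.-tuple T := [tuple of p.1 :: p.2].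

Let measurable_tcons : measurable_fun setT tcons.
Proof. exact: measurable_cons. Qed.

Definition cons_measure : set (n.+1.-tuple T) -> \bar R :=
  pushforward (m \x mu)%E tcons.

Let cons_measure0 : cons_measure set0 = 0%E.
Proof. by rewrite /cons_measure /pushforward preimage_set0 measure0. Qed.

Let cons_measure_ge0 A : (0 <= cons_measure A)%E.
Proof. exact: measure_ge0. Qed.

Let cons_measure_sigma_additive : semi_sigma_additive cons_measure.
Proof.
move=> F mF tF mUF; rewrite /cons_measure /pushforward preimage_bigcup.
apply: measure_semi_sigma_additive.
- by move=> k; rewrite -[X in measurable X]setTI; exact: measurable_tcons.
- apply/trivIsetP => /= i j _ _ ij; rewrite -preimage_setI.
  by move/trivIsetP : tF => /(_ _ _ _ _ ij) ->//; rewrite preimage_set0.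
- by rewrite -preimage_bigcup -[X in measurable X]setTI; exact: measurable_tcons.
Qed.

HB.instance Definition _ := isMeasure.Build _ _ _ cons_measure
  cons_measure0 cons_measure_ge0 cons_measure_sigma_additive.

Let cons_measure_sigma_finite : sigma_finite setT cons_measure.
Proof.
have /sigma_finiteP[F [TF ndF Foo]] := sigma_finiteT m.
have /sigma_finiteP[G [TG ndG Goo]] := sigma_finiteT mu.
pose uncons (t : n.+1.-tuple T) := (thead t, [tuple of behead t] : n.-tuple T).
have muncons : measurable_fun setT uncons.
  apply: measurable_fun_pair; first exact: measurable_tnth.
  exact: measurable_behead.
exists (fun k => uncons @^-1` (F k `*` G k)).
  rewrite -preimage_bigcup; apply/esym/seteqP; split => // t _.
  have [i _ Fi] : (\bigcup_i F i) (thead t) by rewrite -TF.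
  have [j _ Gj] : (\bigcup_j G j) [tuple of behead t] by rewrite -TG.
  exists (maxn i j) => //; split.
    by move: Fi; exact/subsetPset/ndF/leq_maxl.
  by move: Gj; exact/subsetPset/ndG/leq_maxr.
move=> k; have [mFk Fkoo] := Foo k; have [mGk Gkoo] := Goo k; split.
  by rewrite -[X in measurable X]setTI; apply: muncons => //; exact: measurableX.
rewrite /cons_measure /pushforward -comp_preimage.
rewrite (_ : uncons \o tcons = id) ?preimage_id; last first.
  by apply/funext => -[x u]; congr pair => //; exact: val_inj.
by rewrite product_measure1E// lte_mul_pinfty// ge0_fin_numE.
Qed.

HB.instance Definition _ := Measure_isSigmaFinite.Build _ _ _ cons_measure
  cons_measure_sigma_finite.

End cons_measure.

Fixpoint power_measure d (T : measurableType d) (R : realType)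
    (m : {sigma_finite_measure set T -> \bar R}) (n : nat) :
    {sigma_finite_measure set (n.-tuple T) -> \bar R} :=
  match n with
  | 0 => dirac [tuple]
  | n'.+1 => cons_measure m (power_measure m n')
  end.

Lemma power_measure_rect d (T : measurableType d) (R : realType)
    (m : {sigma_finite_measure set T -> \bar R}) (n : nat) (A : 'I_n -> set T) :
  (forall i, measurable (A i)) ->
  power_measure m n [set t | forall i, A i (tnth t i)] =
  (\prod_(i < n) m (A i))%E.
Proof.
elim: n A => [|n IH] A mA.
  by rewrite big_ord0 /= diracE mem_set//= => -[].
rewrite big_ord_recl -(IH (A \o lift ord0)) => [|i]; last exact: mA.
rewrite -product_measure1E //; last first.
  rewrite (_ : [set t | _] = \bigcap_(i in [set: 'I_n])
      ((fun t : n.-tuple T => tnth t i) @^-1` A (lift ord0 i))).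
    apply: fin_bigcap_measurable => [|i _]; first exact: finite_finset.
    by rewrite -[X in measurable X]setTI; exact: measurable_tnth.
  by apply/seteqP; split=> [t At i _|t At i]; exact: At.
congr product_measure1; apply/seteqP; split => [[x u] /= xuA|[x u] /= [Ax Au] i].
  by split=> [|i]; [exact: (xuA ord0)|have := xuA (lift ord0 i); rewrite tnthS].
by case: (unliftP ord0 i) => [j ->|->//]; rewrite tnthS.
Qed.

Definition box (R : realType) (d : nat) (a b : R) :
  set (d.-tuple R) := [set t | forall i, a <= tnth t i <= b].

(* The Gaussian law with mean m and standard deviation s.  The case s = 0 is
   separated since normal_prob m 0 is the uniform law on [0, 1]. *)
Definition gaussian_law (R : realType) (m s : R) (A : set R) : \bar R :=
  if s == 0 then dirac m A else normal_prob m s A.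

(* The distribution function of the centred Gaussian law of variance v. *)
Definition Phi (R : realType) (v z : R) : \bar R :=
  gaussian_law 0 (Num.sqrt v) `]-oo, z].

Section processes.
Context (R : realType) (dO : measure_display) (Omega : measurableType dO).
Variable P : probability Omega R.

Definition gaussian_rv (X : Omega -> R) : Prop :=
  exists m s : R, forall A : set R, measurable A ->
    P (X @^-1` A) = gaussian_law m s A.

Definition gaussian_field (I : Type) (D : set I) (W : I -> Omega -> R) : Prop :=
  (forall t, D t -> measurable_fun setT (W t)) /\
  forall (k : nat) (t : 'I_k -> I) (c : 'I_k -> R), (forall j, D (t j)) ->
    gaussian_rv (fun w => \sum_(j < k) c j * W (t j) w).

(* Tuples carry the sigma-algebra of R^d but no topology, hence the detour
   through row vectors in the continuity of the sample paths; every path is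
   required to be continuous, so that functionals of W are measurable. *)
Definition brownian_sheet (d : nat) (W : d.-tuple R -> Omega -> R) : Prop :=
  [/\ gaussian_field (box 0 1) W,
      forall t, box 0 1 t -> ('E_P[W t] = 0)%E,
      forall t s, box 0 1 t -> box 0 1 s ->
        ('E_P[(fun w => W t w * W s w)%R] =
           (\prod_(i < d) Num.min (tnth t i) (tnth s i))%R%:E)%E
    & forall w, {within [set r : 'rV[R]_d | forall i, 0 <= r ord0 i <= 1],
        continuous (fun r : 'rV[R]_d => W [tuple r ord0 i | i < d] w)}].

Definition Gfun (d : nat) (W : d.-tuple R -> Omega -> R)
    (n : nat) (w : Omega) : R :=
  \int[power_measure (@lebesgue_measure R) d]_(t in box (n%:R^-1) 1)
    (W t w ^+ 2 / \prod_(i < d) tnth t i ^+ 2).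

Definition Ffun (d : nat) (W : d.-tuple R -> Omega -> R)
    (n : nat) (w : Omega) : R :=
  (Gfun W n w - ln n%:R ^+ d) /
  ((2 * ln n%:R - 2 * (1 - n%:R^-1)) `^ (d%:R / 2)).

(* Conventions used: lne 0 = -oo and ereal_inf set0 = +oo.  The requirements on
   X n and s n only concern large n; s n > 0 for large n follows from the limit. *)
Definition large_deviation_principle (X : nat -> Omega -> R) (s : nat -> R)
    (I : R -> \bar R) : Prop :=
  [/\ (\forall n \near \oo, measurable_fun [set: Omega] (X n)),
      s n @[n --> \oo] --> +oo,
      [/\ forall z, (0 <= I z)%E, lower_semicontinuous I
        & forall c : R, compact [set z | (I z <= c%:E)%E]]
    & forall B : set R, measurable B ->
      (- ereal_inf (I @` B°) <=
         limn_einf (fun n => ((s n)^-1)%:E * lne (P (X n @^-1` B))))%E /\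
      (limn_esup (fun n => ((s n)^-1)%:E * lne (P (X n @^-1` B))) <=
         - ereal_inf (I @` closure B))%E].

End processes.

Definition Delta (R : realType) (d n : nat) : R :=
  (8 * Num.sqrt 2)^-1 * (ln n%:R / 120) `^ (d%:R / 4).

(* Main.v *)
(** Replace the integral G_n by Riemann sums over the geometric grid q^j with
    q = n^(-1/N): each of them is the squared norm of a centred Gaussian vector.
    Diagonalising its covariance matrix, and identifying laws through Laplace
    transforms (Bernstein polynomials solve the moment problem on [0, 1]), one
    finds that F_n is a limit in law of quadratic forms sum_i a_i (xi_i^2 - 1)
    with sum_i a_i^2 = 1 and |a_i| <= min(1, 1 / (128 Delta_n^2)).  Exponential
    tilting by h = z / 2 turns the tail at z of such a form into an expectation
    of another Gaussian quadratic form, of almost the same variance and centred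
    near z, which Stein's method compares with N(0, 2).  Chernoff's bound gives
    (c), and bounding the tilted expectation below by that of a tent function
    gives lower bounds at the larger z needed for (b) and for the moderate
    deviation principle. *)

Require Import Defs.
From mathcomp Require Import all_boot all_order all_algebra.
From mathcomp Require Import all_classical all_reals all_analysis.
From mathcomp Require Import measurable_realfun.
From mathcomp Require complex.
From mathcomp Require Import ring lra.

Set Implicit Arguments.
Unset Strict Implicit.
Unset Printing Implicit Defensive.

Import Order.TTheory GRing.Theory Num.Theory.
Import numFieldNormedType.Exports.

Local Open Scope classical_set_scope.
Local Open Scope ring_scope.

(** * Gaussian integrals *)

(** Write [D] for [Delta] and [m] for the bound on the weights. A bound on the distance between laws
    has an absolute error, useless next to a tail of order [exp (- z^2 / 4)]. After the tilt Stein's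
    error [O(m (1 + z)^2)] comes multiplied by [exp (- z^2 / 4)], so it is relative to the Gaussian
    tail up to the factor [1 + z] of Mills' ratio. With [m <= 1 / (128 D^2)] this is accurate enough
    for [z^2 <= D]. For [z^2 >= D] the allowed error [(1 + z^3) / D] exceeds [z], and bounds losing
    factors [exp (O(z))] suffice; the tent bound keeps a positive constant up to [z] of order [D].
    The grid is geometric because [W t / sqrt t] is stationary in [log t]: in each coordinate the
    covariance matrix is Toeplitz with geometric entries and absolute row sums at most [4]. Hence
    eigenvalues at most [4^d], to be compared with a variance [v^d], [v > 16 log n / 120]: these are
    the constants of [Delta]. All estimates concern finite forms and continuous ramps, uniformly in
    the number of variables; then the grid is refined, and the ramp steepens last. *)

Definition gauss (R : realType) : probability (measurableTypeR R) R :=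
  normal_prob 0 1.

Section gauss1.
Context {R : realType}.
Implicit Types (f F : R -> R) (x s C : R).
Notation mu := (@lebesgue_measure R).

Let gpdf x : R := normal_pdf 0 1 x.

Let gpdfE x : gpdf x = normal_peak 1 * expR (- x ^+ 2 / 2).
Proof.
by rewrite /gpdf normal_pdfE ?oner_neq0// /normal_fun subr0 expr1n.
Qed.

Let gpdf_ge0 x : 0 <= gpdf x. Proof. exact: normal_pdf_ge0. Qed.

Let mgpdf : measurable_fun setT gpdf.
Proof. exact: measurable_normal_pdf. Qed.

(** The Radon-Nikodym derivative of [normal_prob m s] and the function [normal_pdf m s] have the
    same integral over every measurable set, so they agree almost everywhere and may be exchanged in
    the change of variables. *)
Lemma ge0_integral_normal_prob (m s : R) (f : R -> \bar R) :
  (forall x, 0 <= f x)%E -> measurable_fun setT f ->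
  (\int[normal_prob m s]_x f x = \int[mu]_x (f x * (normal_pdf m s x)%:E))%E.
Proof.
move=> f0 mf.
have mpdf : measurable_fun setT (normal_pdf m s) by exact: measurable_normal_pdf.
have dom := @normal_prob_dominates R m s.
rewrite -(Radon_Nikodym_SigmaFinite.change_of_variables dom)//=.
apply: ae_eq_integral => //.
- apply: emeasurable_funM => //; apply: (measurable_int mu).
  exact: Radon_Nikodym_SigmaFinite.f_integrable.
- by apply: emeasurable_funM => //=; exact/measurableT_comp.
- apply: ae_eqe_mul2l => /=.
  apply: integral_ae_eq => //=.
  + exact: Radon_Nikodym_SigmaFinite.f_integrable.
  + exact/measurableT_comp.
  + by move=> E _ mE; rewrite -Radon_Nikodym_SigmaFinite.f_integral.
Qed.

Lemma ge0_integral_gauss (f : R -> \bar R) :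
  (forall x, 0 <= f x)%E -> measurable_fun setT f ->
  (\int[gauss R]_x f x = \int[mu]_x (f x * (normal_pdf 0 1 x)%:E))%E.
Proof. exact: ge0_integral_normal_prob. Qed.

(** Against the density, a growth of [exp (x^2 / 4)] leaves [exp (- x^2 / 4)], a multiple of the
    density of N(0, 2). *)
Lemma gauss_integrable f C : measurable_fun setT f ->
  (forall x, `|f x| <= C * expR (x ^+ 2 / 4)) ->
  (gauss R).-integrable setT (EFin \o f).
Proof.
move=> mf fC; apply/integrableP; split; first exact/measurable_EFinP.
rewrite ge0_integral_gauss//; last first.
  by apply: measurableT_comp => //; exact/measurable_EFinP.
have s2 : Num.sqrt 2 != 0 :> R by rewrite gt_eqF// sqrtr_gt0.
pose K := C * normal_peak 1 / normal_peak (Num.sqrt 2).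
have H x : `|f x| * gpdf x <= K * normal_pdf 0 (Num.sqrt 2) x.
  have p0 := normal_peak_gt0 s2.
  rewrite (normal_pdfE _ s2) /K /normal_fun subr0 sqr_sqrtr// mulrA divfK ?gt_eqF//.
  rewrite gpdfE mulrCA mulrA (mulrC _ (normal_peak 1)) -mulrA -[leRHS]mulrA ler_wpM2l ?normal_peak_ge0//.
  apply: le_trans (ler_wpM2r (expR_ge0 _) (fC x)) _.
  rewrite -mulrA -expRD ler_wpM2l//.
    by have := le_trans (normr_ge0 _) (fC 0); rewrite pmulr_lge0 ?expR_gt0.
  by rewrite ler_expR; have := sqr_ge0 x; lra.
apply: (@le_lt_trans _ _ (\int[mu]_x (K%:E * (normal_pdf 0 (Num.sqrt 2) x)%:E))%E).
  apply: ge0_le_integral => //=.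
  - by move=> x _; rewrite mule_ge0// lee_fin.
  - apply: emeasurable_funM; last exact/measurable_EFinP.
    by apply/measurable_EFinP; exact: measurableT_comp.
  - apply: emeasurable_funM; first exact: measurable_cst.
    by apply/measurable_EFinP; exact: measurable_normal_pdf.
  - by move=> x _; rewrite -!EFinM lee_fin.
rewrite integralZl//; last exact: integrable_normal_pdf.
by rewrite integral_normal_pdf mule1 ltry.
Qed.

Lemma Rintegral_gauss f : measurable_fun setT f ->
  (gauss R).-integrable setT (EFin \o f) ->
  mu.-integrable setT (fun x => (f x * normal_pdf 0 1 x)%:E) /\
  \int[gauss R]_x f x = \int[mu]_x (f x * normal_pdf 0 1 x).
Proof.
move=> mf /integrableP[_ iof].
have mfp : measurable_fun setT (fun x => (f x * gpdf x)%:E).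
  by apply/measurable_EFinP; exact: measurable_funM.
split.
  apply/integrableP; split => //.
  move: iof; rewrite ge0_integral_gauss//; last first.
    by apply: measurableT_comp => //; exact/measurable_EFinP.
  apply: le_lt_trans; apply: ge0_le_integral => //=.
  - by apply/measurable_EFinP; apply: measurableT_comp => //; exact/measurable_EFinP.
  - apply: emeasurable_funM; last exact/measurable_EFinP.
    by apply/measurable_EFinP; exact: measurableT_comp.
  - by move=> x _; rewrite lee_fin normrM (ger0_norm (gpdf_ge0 _)).
rewrite /Rintegral; congr fine.
rewrite integralE [RHS]integralE; congr (_ - _)%E.
  rewrite ge0_integral_gauss//; last exact/measurable_funepos/measurable_EFinP.
  apply: eq_integral => x _; rewrite !funeposE /=.
  by rewrite -!EFin_max -EFinM maxr_pMl// mul0r.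
rewrite ge0_integral_gauss//; last exact/measurable_funeneg/measurable_EFinP.
apply: eq_integral => x _; rewrite !funenegE /=.
by rewrite -!EFin_max -EFinM maxr_pMl// mul0r mulNr.
Qed.

Lemma poly_expR_le k (a : R) : 0 < a -> exists2 C : R, 0 <= C &
  forall x, (1 + `|x|) ^+ k <= C * expR (a * x ^+ 2).
Proof.
move=> a0.
(* A linear bound with the exponent divided by [k + 1], raised afterwards to the power [k]; [k + 1]
   instead of [k] covers [k = 0]. *)
have e1 : exists2 C : R, 0 <= C & forall x, 1 + `|x| <= C * expR (a / k.+1%:R * x ^+ 2).
  pose b := a / k.+1%:R; have b0 : 0 < b by rewrite divr_gt0.
  exists (2 + b^-1); first by rewrite addr_ge0// invr_ge0 ltW.
  move=> x; have /= := expR_ge1Dx (b * x ^+ 2) => h.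
  have : 1 + `|x| <= (2 + b^-1) * (1 + b * x ^+ 2).
    have -> : (2 + b^-1) * (1 + b * x ^+ 2) = 2 + b^-1 + 2 * b * x ^+ 2 + x ^+ 2.
      by field; rewrite gt_eqF.
    have : 0 <= b^-1 by rewrite invr_ge0 ltW.
    have : 0 <= b * x ^+ 2 by rewrite mulr_ge0 ?sqr_ge0 ?ltW.
    have : 2 * `|x| <= 1 + `|x| ^+ 2 by have := sqr_ge0 (`|x| - 1); nra.
    rewrite real_normK ?num_real//; have := sqr_ge0 x; have := normr_ge0 x.
    rewrite -mulrA; lra.
  move/le_trans; apply; rewrite ler_wpM2l// addr_ge0// invr_ge0 ltW//.
case: e1 => C C0 HC; exists (C ^+ k); first by rewrite exprn_ge0.
move=> x; apply: (@le_trans _ _ ((C * expR (a / k.+1%:R * x ^+ 2)) ^+ k)).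
  by rewrite lerXn2r ?nnegrE ?addr_ge0// mulr_ge0 ?expR_ge0.
rewrite exprMn ler_wpM2l ?exprn_ge0// -expRM_natl ler_expR.
have x2 := sqr_ge0 x.
rewrite mulrA ler_wpM2r// mulrCA -ler_pdivlMl// mulVf ?gt_eqF//.
by rewrite ler_pdivrMr ?ltr0n// mul1r ler_nat.
Qed.

Lemma gauss_integrable_poly k f C : measurable_fun setT f ->
  (forall x, `|f x| <= C * (1 + `|x|) ^+ k) ->
  (gauss R).-integrable setT (EFin \o f).
Proof.
move=> mf fC; have [|K K0 HK] := @poly_expR_le k 4^-1; first by rewrite invr_gt0.
apply: (@gauss_integrable _ (C * K)) => // x; apply: le_trans (fC x) _.
rewrite -mulrA ler_wpM2l//; last by rewrite (mulrC (x ^+ 2)).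
by have := le_trans (normr_ge0 _) (fC 0); rewrite pmulr_lge0// normr0 addr0 expr1n.
Qed.

Lemma is_derive_gpdf x : is_derive x 1 (fun y => normal_pdf 0 1 y : R) (- x * normal_pdf 0 1 x).
Proof.
rewrite (_ : (fun y => _) = (fun y => normal_peak 1 * expR (- y ^+ 2 / 2))); last first.
  by apply/funext => y; rewrite -gpdfE.
have -> : - x * normal_pdf 0 1 x = normal_peak 1 * ((- (x *+ 2) / 2) * expR (- x ^+ 2 / 2)).
  by rewrite -/(gpdf x) gpdfE; field.
have h : is_derive x 1 (fun y : R => - y ^+ 2 / 2) (- (x *+ 2) / 2).
  apply: is_derive_eq; rewrite /GRing.scale/=; ring.
have h2 := @is_derive1_comp _ expR (fun y : R => - y ^+ 2 / 2) x _ _ (is_derive_expR _) h.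
by apply: is_derive_eq; rewrite /GRing.scale/= mulrC; ring.
Qed.

(* The boundary terms of the integration by parts over [-k, k] vanish as k grows. *)
Lemma gauss_ibp F f C k :
  (forall x, is_derive x 1 F (f x)) -> continuous f ->
  (forall x, `|F x| <= C * (1 + `|x|) ^+ k) ->
  (forall x, `|f x| <= C * (1 + `|x|) ^+ k) ->
  \int[gauss R]_x (x * F x) = \int[gauss R]_x f x.
Proof.
move=> dF cf FC fC.
have cF : continuous F.
  by move=> x; apply/differentiable_continuous/derivable1_diffP; case: (dF x).
have C0 : 0 <= C.
  by have := le_trans (normr_ge0 _) (fC 0); rewrite pmulr_lge0// normr0 addr0 expr1n.
have mF : measurable_fun setT F by exact: continuous_measurable_fun.
have mf : measurable_fun setT f by exact: continuous_measurable_fun.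
have mxF : measurable_fun setT (fun x : R => x * F x) by exact: measurable_funM.
have ixF : (gauss R).-integrable setT (EFin \o (fun x : R => x * F x)).
  apply: (@gauss_integrable_poly k.+1 _ C) => // x.
  by rewrite normrM exprS mulrCA ler_pM// lerDr.
have iF : (gauss R).-integrable setT (EFin \o f) by exact: (gauss_integrable_poly mf fC).
have [i1 e1] := Rintegral_gauss mxF ixF.
have [i2 e2] := Rintegral_gauss mf iF.
apply/eqP; rewrite -subr_eq0 e1 e2 -RintegralB//.
pose g x := x * F x * gpdf x - f x * gpdf x.
have cg : continuous g.
  move=> x; have cp : {for x, continuous gpdf} by exact: continuous_normal_pdf.
  apply: cvgB; apply: cvgM => //; last exact: cf.
  by apply: cvgM; [exact: cvg_id|exact: cF].
have ig : mu.-integrable setT (EFin \o g) := integrableB measurableT i1 i2.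
(* Since the density satisfies [p' = - x p], the function [- F p] is an antiderivative of [g]. *)
pose H x := - (F x * gpdf x).
have dH x : is_derive x 1 H (g x).
  have ? := dF x; have ? : is_derive x 1 gpdf (- x * gpdf x) := is_derive_gpdf x.
  by apply: is_derive_eq; rewrite /GRing.scale/= /g; ring.
have ftc (n : nat) : (\int[mu]_x ((g \_ `[- n.+1%:R, n.+1%:R]) x)%:E = (H n.+1%:R)%:E - (H (- n.+1%:R))%:E)%E.
  rewrite -(continuous_FTC2 (f := g)).
  - by rewrite [RHS]integral_mkcond restrict_EFin.
  - by rewrite gtrN.
  - exact: continuous_subspaceT.
  - split.
    + by move=> x _; case: (dH x).
    + apply: cvg_at_right_filter.
      by apply/differentiable_continuous/derivable1_diffP; case: (dH (- n.+1%:R)).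
    + apply: cvg_at_left_filter.
      by apply/differentiable_continuous/derivable1_diffP; case: (dH (n.+1%:R)).
  - by move=> x _; rewrite derive1E; apply: derive_val.
have cv1 : (\int[mu]_x ((g \_ `[- n.+1%:R, n.+1%:R]) x)%:E)%E @[n --> \oo] --> (\int[mu]_x (g x)%:E)%E.
  have [] := @dominated_convergence _ _ _ mu setT measurableT (fun n x => ((g \_ `[- n.+1%:R, n.+1%:R]) x)%:E) (EFin \o g) (fun x => `|(g x)%:E|%E) => //.
  - move=> n; apply/measurable_EFinP.
    apply/(measurable_restrictT _ _).1 => //.
    by apply: measurable_funTS; exact: continuous_measurable_fun.
  - exact: measurable_int ig.
  - apply/aeW => x _; apply/cvg_EFin; first by near=> n.
    apply: cvg_near_cst; near=> n.
    rewrite /= patchE mem_set//= in_itv/= -ler_norml.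
    apply: le_trans (ltW (archi_boundP (normr_ge0 x))) _.
    rewrite ler_nat; apply: leqW; near: n; exact: nbhs_infty_ge.
  - by apply/integrable_abse.
  - by apply/aeW => x n _; rewrite /= patchE; case: ifP => // _; rewrite normr0 lee_fin.
(* The polynomial is absorbed by half of the Gaussian exponent, so that [H] decays like
   [exp (- x^2 / 4)]. *)
have [|K K0 HK] := @poly_expR_le k 4^-1; first by rewrite invr_gt0.
have cv2 : ((H n.+1%:R)%:E - (H (- n.+1%:R))%:E)%E @[n --> \oo] --> 0%E.
  apply/cvg_EFin; first by near=> n.
  have Hb x : `|H x| <= C * K * normal_peak 1 * expR (- (4^-1 * x ^+ 2)).
    rewrite normrN normrM (ger0_norm (gpdf_ge0 _)).
    apply: le_trans (ler_wpM2r (gpdf_ge0 _) (FC x)) _.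
    have := ler_wpM2l C0 (HK x) => /(ler_wpM2r (gpdf_ge0 x)) /le_trans; apply.
    rewrite gpdfE.
    have -> : expR (- (4^-1 * x ^+ 2)) = expR (4^-1 * x ^+ 2) * expR (- x ^+ 2 / 2) by rewrite -expRD; congr expR; lra.
    by rewrite !mulrA (mulrAC _ (expR _) (normal_peak 1)).
  have Hc : (fun n => expR (- (4^-1 * (n.+1%:R : R) ^+ 2))) @ \oo --> (0 : R).
    apply: (@squeeze_cvgr _ _ _ _ (cst 0) (fun n => 4 * n.+1%:R^-1)).
    - near=> n; rewrite expR_ge0/= expRN -[leRHS]invrK lef_pV2 ?posrE ?expR_gt0 ?invr_gt0 ?mulr_gt0 ?invr_gt0//.
      rewrite invfM invrK; apply: le_trans (expR_ge1Dx _).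
      rewrite ler_wpDl// ler_wpM2l// expr2 ler_peMl// ler1n//.
    - exact: cvg_cst.
    - rewrite -[X in _ --> X](mulr0 4); apply: cvgMr; exact: cvg_harmonic.
  apply: norm_cvg0.
  apply: (@squeeze_cvgr _ _ _ _ (cst 0) (fun n => 2 * (C * K * normal_peak 1) * expR (- (4^-1 * (n.+1%:R : R) ^+ 2)))).
  - near=> n; rewrite normr_ge0/=; apply: le_trans (ler_normB _ _) _.
    have := Hb n.+1%:R; have := Hb (- n.+1%:R); rewrite sqrrN; lra.
  - exact: cvg_cst.
  - rewrite -[X in _ --> X](mulr0 (2 * (C * K * normal_peak 1))).
    by apply: cvgMr.
have cv3 : ((H n.+1%:R)%:E - (H (- n.+1%:R))%:E)%E @[n --> \oo] --> (\int[mu]_x (g x)%:E)%E.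
  by move: cv1; under eq_fun do rewrite ftc.
have E : (\int[mu]_x (g x)%:E)%E = 0%E by apply: (cvg_unique (@ereal_hausdorff R) cv3 cv2).
by apply/eqP; exact: (congr1 fine E).
Unshelve. all: by end_near. Qed.

End gauss1.

(** * Characteristic function, moments and quadratic tilting of the standard Gaussian law *)

Section gauss_moments.
Context {R : realType}.
Implicit Types (x s b : R).

Lemma gauss_cst (c : R) : \int[gauss R]_x c = c.
Proof.
transitivity (c * fine (gauss R setT)); first exact: Rintegral_cst.
by rewrite probability_setT mulr1.
Qed.

Lemma integral_gauss_cst (c : R) : (\int[gauss R]_x c%:E = c%:E)%E.
Proof.
transitivity (c%:E * gauss R setT)%E; first exact: integral_cst.
by rewrite probability_setT mule1.
Qed.

(** Differentiation under the integral followed by integration by parts gives [u' = - s u], so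
    [u s * exp (s^2 / 2)] is constant, equal to its value [cos theta] at [0]. *)
Lemma gauss_cos s theta :
  \int[gauss R]_x cos (s * x + theta) = expR (- (s ^+ 2 / 2)) * cos theta.
Proof.
pose u s := \int[gauss R]_x cos (s * x + theta).
have dlin r x : is_derive x 1 (fun y : R => r * y + theta) r.
  by apply: is_derive_eq; rewrite /GRing.scale/=; ring.
have dlin' y x : is_derive x 1 (fun r : R => r * y + theta) y.
  by apply: is_derive_eq; rewrite /GRing.scale/=; ring.
have dcos y x : is_derive x 1 (fun r : R => cos (r * y + theta)) (- sin (x * y + theta) * y).
  by have := @is_derive1_comp _ cos (fun r : R => r * y + theta) x _ _ (is_derive_cos _) (dlin' y x).
have mlin r : measurable_fun setT (fun x : R => r * x + theta).
  by apply: measurable_funD => //; exact: measurable_funM.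
have mcos r : measurable_fun setT (fun x : R => cos (r * x + theta)).
  by apply: measurableT_comp => //; apply: continuous_measurable_fun; exact: continuous_cos.
have icos r : (gauss R).-integrable setT (EFin \o (fun x => cos (r * x + theta))).
  apply: (@gauss_integrable_poly _ 0 _ 1) => // x.
  by rewrite expr0 mulr1 ler_norml cos_geN1 cos_le1.
have xp k x : `|x| <= (1 + `|x|) ^+ k.+1 :> R.
  apply: (@le_trans _ _ (1 + `|x|)); first by rewrite lerDr.
  by rewrite exprS ler_peMr ?addr_ge0// exprn_ege1// lerDl.
have du (r : R) : is_derive r 1 u (- r * u r).
  have H := @differentiation_under_integral R _ _ (gauss R) (fun r x => cos (r * x + theta)) setT measurableT r (r - 1) (r + 1).
  have H2 := @derivable_under_integral R _ _ (gauss R) (fun r x => cos (r * x + theta)) setT measurableT r (r - 1) (r + 1).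
  have C1 : `]r - 1, r + 1[%classic r by rewrite /= in_itv/=; lra.
  have C2 : forall x, `]r - 1, r + 1[%classic x -> (gauss R).-integrable setT (EFin \o (fun y => cos (x * y + theta))) by [].
  have C3 : forall x y, `]r - 1, r + 1[%classic x -> setT y -> derivable (fun r : R => cos (r * y + theta)) x 1.
    by move=> x y _ _; case: (dcos y x).
  have C4 : (gauss R).-integrable setT (EFin \o (fun x : R => `|x|)).
    apply: (@gauss_integrable_poly _ 1 _ 1) => // x.
    by rewrite normr_id mul1r.
  have p1E x y : partial1of2 (fun r x => cos (r * x + theta)) x y = - (y * sin (x * y + theta)) :> R.
    by rewrite partial1of2E (derive_val (is_derive := dcos y x)) mulrC mulrN.
  have C5 : forall x y, `]r - 1, r + 1[%classic x -> setT y -> `|partial1of2 (fun r x => cos (r * x + theta)) x y| <= `|y| :> R.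
    move=> x y _ _; rewrite p1E normrN normrM ler_piMr// ler_norml.
    by rewrite sin_geN1 sin_le1.
  have {}H2 := H2 C1 C2 C3 _ (fun y => normr_ge0 y) C4 C5.
  have {}H := H C1 C2 C3 _ (fun y => normr_ge0 y) C4 C5.
  apply: DeriveDef => //; rewrite -derive1E H.
  under eq_Rintegral do rewrite p1E -mulN1r.
  have ixs : (gauss R).-integrable setT (EFin \o (fun x => x * sin (r * x + theta))).
    apply: (@gauss_integrable_poly _ 1 _ 1) => [|x].
      apply: measurable_funM => //; apply: measurableT_comp => //.
      by apply: continuous_measurable_fun; exact: continuous_sin.
    rewrite mul1r normrM; apply: (@le_trans _ _ `|x|) => //.
    by rewrite ler_piMr// ler_norml sin_geN1 sin_le1.
  rewrite RintegralZl//.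
  have -> : \int[gauss R]_x (x * sin (r * x + theta)) = \int[gauss R]_x (r * cos (r * x + theta)); last first.
    by rewrite RintegralZl// mulN1r mulNr.
  apply: (@gauss_ibp _ (fun x => sin (r * x + theta)) _ (1 + `|r|) 0).
  - move=> x; have := @is_derive1_comp _ sin (fun y : R => r * y + theta) x _ _ (is_derive_sin _) (dlin r x).
    by rewrite mulrC.
  - move=> x; apply: cvgM; first exact: cvg_cst.
    apply: (@continuous_comp _ _ _ (fun x : R => r * x + theta) cos).
      by apply/differentiable_continuous/derivable1_diffP; case: (dlin r x).
    exact: continuous_cos.
  - move=> x; rewrite expr0 mulr1 (@le_trans _ _ 1) ?lerDl//.
    by rewrite ler_norml sin_geN1 sin_le1.
  - move=> x; rewrite expr0 mulr1 normrM (@le_trans _ _ `|r|) ?lerDr//.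
    by rewrite ler_piMr// ler_norml cos_geN1 cos_le1.
pose v s := u s * expR (s ^+ 2 / 2).
have dv (r : R) : is_derive r 1 v 0.
  have dq : is_derive r 1 (fun s : R => s ^+ 2 / 2) r.
    by apply: is_derive_eq; rewrite /GRing.scale/=; field.
  have de := @is_derive1_comp _ expR (fun s : R => s ^+ 2 / 2) r _ _ (is_derive_expR _) dq.
  have du' := du r.
  by apply: is_derive_eq; rewrite /GRing.scale/=; ring.
have := is_derive_0_is_cst s 0 dv.
rewrite /v expr0n/= mul0r expR0 mulr1.
have -> : u 0 = cos theta.
  by rewrite /u; under eq_Rintegral do rewrite mul0r add0r; rewrite gauss_cst.
by move=> <-; rewrite mulrC -mulrA expRN divff ?mulr1 ?gt_eqF ?expR_gt0.
Qed.

(** The integrand is [x F x - F' x + (2 b^2 + s^2)] for the cubic [F] below, and integration by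
    parts cancels the first two terms. *)
Lemma gauss_polysq b s : (\int[gauss R]_x ((b * (x ^+ 2 - 1) + s) ^+ 2)%:E = (2 * b ^+ 2 + s ^+ 2)%:E)%E.
Proof.
pose F x := b ^+ 2 * x ^+ 3 + (b ^+ 2 + 2 * b * s) * x.
pose f x := 3 * b ^+ 2 * x ^+ 2 + (b ^+ 2 + 2 * b * s).
pose C := 3 * b ^+ 2 + `|b ^+ 2 + 2 * b * s|.
have b2 := sqr_ge0 b.
have Hp k x : (k <= 4)%N -> `|x| ^+ k <= (1 + `|x|) ^+ 4 :> R.
  move=> k4; apply: (@le_trans _ _ ((1 + `|x|) ^+ k)).
    by rewrite lerXn2r ?nnegrE ?addr_ge0// lerDr.
  by rewrite ler_weXn2l// lerDl.
have HF x : `|F x| <= C * (1 + `|x|) ^+ 4.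
  rewrite /F; apply: le_trans (ler_normD _ _) _.
  rewrite (normrM (b ^+ 2)) (normrM (_ + _)) [leRHS]mulrDl lerD//.
    rewrite (ger0_norm b2) normrX; apply: ler_pM => //; [lra|exact: Hp].
  by rewrite ler_wpM2l//; have := Hp 1%N x isT; rewrite expr1.
have Hf x : `|f x| <= C * (1 + `|x|) ^+ 4.
  rewrite /f; apply: le_trans (ler_normD _ _) _; rewrite /C [leRHS]mulrDl lerD//.
    have h3 : 0 <= 3 * b ^+ 2 by rewrite mulr_ge0.
    by rewrite normrM normrX (ger0_norm h3) ler_wpM2l ?Hp.
  by rewrite ler_peMr//; exact: (Hp 0%N x isT).
have dF x : is_derive x 1 F (f x).
  by apply: is_derive_eq; rewrite /GRing.scale/= /f; ring.
have cf : continuous f.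
  move=> x; apply/differentiable_continuous/derivable1_diffP.
  by rewrite /f; exact: ex_derive.
have mF : measurable_fun setT F.
  apply: continuous_measurable_fun => x.
  by apply/differentiable_continuous/derivable1_diffP; case: (dF x).
have mf : measurable_fun setT f by exact: continuous_measurable_fun.
have iF : (gauss R).-integrable setT (EFin \o (fun x => x * F x)).
  apply: (@gauss_integrable_poly _ 5 _ C) => [|x]; first exact: measurable_funM.
  rewrite normrM exprS mulrCA ler_pM ?normr_ge0// ?lerDr//; exact: HF.
have if_ : (gauss R).-integrable setT (EFin \o f) by exact: (gauss_integrable_poly mf Hf).
have iB := integrableB measurableT iF if_.
have iC : (gauss R).-integrable setT (EFin \o (fun _ => 2 * b ^+ 2 + s ^+ 2 : R)).
  apply: (@gauss_integrable_poly _ 0 _ (2 * b ^+ 2 + s ^+ 2)) => // x.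
  by rewrite expr0 mulr1 ger0_norm// addr_ge0 ?sqr_ge0// mulr_ge0.
have E : \int[gauss R]_x ((b * (x ^+ 2 - 1) + s) ^+ 2) = 2 * b ^+ 2 + s ^+ 2.
  transitivity (\int[gauss R]_x ((x * F x - f x) + (2 * b ^+ 2 + s ^+ 2))).
    by apply: eq_Rintegral => x _; rewrite /F /f; ring.
  rewrite RintegralD// RintegralB// (gauss_ibp dF cf HF Hf) subrr add0r.
  by rewrite gauss_cst.
rewrite -E fineK//; apply: integrable_fin_num => //.
apply: eq_integrable (integrableD measurableT iB iC) => // x _ /=.
by rewrite -!EFinD; congr EFin; rewrite /F /f; ring.
Qed.

Lemma gauss_sqr : (\int[gauss R]_x (x ^+ 2)%:E = 1)%E.
Proof.
have i2 : (gauss R).-integrable setT (EFin \o (fun x : R => x ^+ 2)).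
  apply: (@gauss_integrable_poly _ 2 _ 1) => // x.
  by rewrite normrX mul1r lerXn2r ?nnegrE ?addr_ge0// lerDr.
rewrite -[LHS]fineK; last by apply: integrable_fin_num.
congr EFin; rewrite -[RHS]gauss_cst -(@gauss_ibp _ id _ 1 1)//.
- by move=> x; exact: cvg_cst.
- by move=> x; rewrite mul1r expr1 lerDr.
- by move=> x; rewrite mul1r normr1 expr1 lerDl.
Qed.

(** The factor [exp (h x^2)] turns the Gaussian exponent into [- (1 - 2 h) x^2 / 2], that is
    variance [r^2] instead of [1]; the substitution of [r x] for [x] brings the standard law
    back. *)
Lemma gauss_tilt (g : R -> R) (h r : R) :
  continuous g -> (forall x, 0 <= g x) -> 0 < r -> r ^+ 2 * (1 - 2 * h) = 1 ->
  (\int[gauss R]_x (g x * expR (h * x ^+ 2))%:E =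
   r%:E * \int[gauss R]_x (g (r * x))%:E)%E.
Proof.
move=> cg g0 r0 rh.
have cexp (a : R) : continuous (fun x : R => expR (a * x ^+ 2)).
  move=> x; apply: (@continuous_comp _ _ _ (fun x : R => a * x ^+ 2) expR); last exact: continuous_expR.
  by apply: cvgM; [exact: cvg_cst|exact: exprn_continuous].
have cgr : continuous (fun x => g (r * x)).
  move=> x; apply: (@continuous_comp _ _ _ (fun x : R => r * x) g); last exact: cg.
  by apply: cvgM; [exact: cvg_cst|exact: cvg_id].
have mgr : measurable_fun setT (fun x => g (r * x)) by exact: continuous_measurable_fun.
rewrite ge0_integral_gauss; first last.
- apply/measurable_EFinP; apply: continuous_measurable_fun => x.
  by apply: cvgM; [exact: cg|exact: cexp].
- by move=> x; rewrite lee_fin mulr_ge0 ?expR_ge0.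
rewrite ge0_integral_gauss; first last.
- exact/measurable_EFinP.
- by move=> x; rewrite lee_fin.
pose G (x : R) := g x * expR (h * x ^+ 2) * normal_pdf 0 1 x.
have cG : continuous G.
  move=> x; apply: cvgM; last exact: continuous_normal_pdf.
  by apply: cvgM; [exact: cg|exact: cexp].
have dr (x : R) : is_derive x 1 (fun y : R => r * y) r.
  by apply: is_derive_eq; rewrite /GRing.scale/= mulr1.
have dr1 : (fun y : R => r * y)^`()%classic = cst r.
  by apply/funext => x; rewrite derive1E derive_val.
have := @increasing_ge0_integration_by_substitutionT R (fun y => r * y) G.
rewrite dr1 => H; rewrite [LHS](_ : _ = (\int[lebesgue_measure]_x (G x)%:E)%E)//.
rewrite H; first last.
- by move=> x; rewrite /G mulr_ge0 ?normal_pdf_ge0// mulr_ge0// expR_ge0.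
- exact: cG.
- by apply: gt0_cvgMry => //; exact: cvg_id.
- by apply: gt0_cvgMrNy => //; exact: cvg_id.
- by move=> x; case: (dr x).
- exact: is_cvg_cst.
- exact: is_cvg_cst.
- by move=> x; exact: cvg_cst.
- by move=> x y xy; rewrite ltr_pM2l.
rewrite -ge0_integralZl//; first last.
- by rewrite lee_fin ltW.
- by move=> x _; rewrite mule_ge0// lee_fin// normal_pdf_ge0.
- apply: emeasurable_funM; first exact/measurable_EFinP.
  by apply/measurable_EFinP; exact: measurable_normal_pdf.
apply: eq_integral => x _; rewrite -!EFinM; congr EFin.
rewrite /G /= !normal_pdfE ?oner_neq0// /normal_fun !subr0 expr1n.
rewrite [LHS](_ : _ = g (r * x) * expR (h * (r * x) ^+ 2) *
  (normal_peak 1 * expR (- (r * x - 0) ^+ 2 / 2)) * r)// subr0.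
have <- : expR (h * (r * x) ^+ 2) * expR (- (r * x) ^+ 2 / 2) = expR (- x ^+ 2 / 2).
  have e : x ^+ 2 = x ^+ 2 * (r ^+ 2 * (1 - 2 * h)) by rewrite rh mulr1.
  by rewrite -expRD; congr expR; rewrite [in RHS]e; field.
by move: (g (r * x)) (expR (h * _)) (expR (- _ / _)) (normal_peak 1 : R) => A B C D; ring.
Qed.

End gauss_moments.

(** * Iterated integrals and Gaussian product measures *)

Section power_measure_integral.
Context d (T : measurableType d) (R : realType) (n : nat).
Variable m : {sigma_finite_measure set T -> \bar R}.
Implicit Types f : n.+1.-tuple T -> \bar R.

Let tcons (p : T * n.-tuple T) : n.+1.-tuple T := [tuple of p.1 :: p.2].

Let mtcons : measurable_fun setT tcons. Proof. exact: measurable_cons. Qed.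

Lemma ge0_integral_power_measureS f :
  (forall t, 0 <= f t)%E -> measurable_fun setT f ->
  (\int[power_measure m n.+1]_t f t =
     \int[m]_x \int[power_measure m n]_u f [tuple of x :: u])%E /\
  (\int[power_measure m n.+1]_t f t =
     \int[power_measure m n]_u \int[m]_x f [tuple of x :: u])%E.
Proof.
move=> f0 mf.
have mft : measurable_fun setT (f \o tcons) by exact: measurableT_comp.
have -> : (\int[power_measure m n.+1]_t f t =
    \int[m \x power_measure m n]_p (f \o tcons) p)%E.
  exact: (ge0_integral_pushforward mtcons (m \x power_measure m n)%E measurableT mf (fun y _ => f0 y)).
by split; [apply: fubini_tonelli1 => // p; exact: f0|apply: fubini_tonelli2 => // p; exact: f0].
Qed.

Lemma integral_power_measureS f :
  (power_measure m n.+1).-integrable setT f ->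
  (\int[power_measure m n.+1]_t f t =
     \int[m]_x \int[power_measure m n]_u f [tuple of x :: u])%E /\
  (\int[power_measure m n.+1]_t f t =
     \int[power_measure m n]_u \int[m]_x f [tuple of x :: u])%E.
Proof.
move=> /integrableP[mf fi].
have mft : measurable_fun setT (f \o tcons) by exact: measurableT_comp.
have ift : (m \x power_measure m n)%E.-integrable setT (f \o tcons).
  apply/integrableP; split => //; apply: le_lt_trans fi.
  have mab : measurable_fun setT (fun t => `|f t|%E) by exact: measurableT_comp.
  by rewrite le_eqVlt; apply/orP; left; apply/eqP; apply/esym; exact: (ge0_integral_pushforward mtcons (m \x power_measure m n)%E measurableT mab (fun y _ => abse_ge0 _)).
have -> : (\int[power_measure m n.+1]_t f t =
    \int[m \x power_measure m n]_p (f \o tcons) p)%E.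
  exact: (integral_pushforward mtcons mf ift measurableT).
by split; [exact/esym/integral12_prod_meas1|exact/esym/integral21_prod_meas1].
Qed.

End power_measure_integral.

Definition gaussn (R : realType) n := power_measure (gauss R) n.

Definition qform (R : realType) n (b : 'I_n -> R) (t : n.-tuple R) : R :=
  \sum_(i < n) b i * tnth t i ^+ 2.

Section gaussn.
Context {R : realType}.
Local Notation T n := (n.-tuple (measurableTypeR R)).

Lemma qform_cons n (b : 'I_n.+1 -> R) (x : R) (u : n.-tuple R) :
  qform b [tuple of x :: u] = b ord0 * x ^+ 2 + qform (b \o lift ord0) u.
Proof.
rewrite /qform big_ord_recl tnth0; congr (_ + _).
by apply: eq_bigr => i _; rewrite tnthS.
Qed.

Lemma lform_cons n (z : 'I_n.+1 -> R) (x : R) (u : n.-tuple R) :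
  \sum_(i < n.+1) z i * tnth [tuple of x :: u] i =
  z ord0 * x + \sum_(i < n) z (lift ord0 i) * tnth u i.
Proof.
rewrite big_ord_recl tnth0; congr (_ + _).
by apply: eq_bigr => i _; rewrite tnthS.
Qed.

Lemma measurable_qform n (b : 'I_n -> R) :
  measurable_fun setT (fun t : T n => qform b t).
Proof.
apply: measurable_sum => i; apply: measurable_funM => //.
by apply: measurable_funX; exact: measurable_tnth.
Qed.

Lemma qform_ge0 n (b : 'I_n -> R) t : (forall i, 0 <= b i) -> 0 <= qform b t.
Proof. by move=> b0; apply: sumr_ge0 => i _; rewrite mulr_ge0 ?sqr_ge0. Qed.

Lemma gaussn_setT n : gaussn R n setT = 1%E.
Proof.
have := @power_measure_rect _ _ R (gauss R) n (fun=> setT) (fun=> measurableT).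
rewrite (_ : [set t | _] = setT); last by apply/seteqP; split.
by move=> ->; rewrite big1// => i _; exact: probability_setT.
Qed.

Lemma gaussn_cst n (c : R) : (\int[gaussn R n]_t c%:E = c%:E)%E.
Proof.
transitivity (c%:E * gaussn R n setT)%E; first exact: integral_cst.
by rewrite gaussn_setT mule1.
Qed.

Lemma gaussn_qform n (b : 'I_n -> R) : (forall i, 0 <= b i) ->
  (\int[gaussn R n]_t (qform b t)%:E = (\sum_i b i)%:E)%E.
Proof.
elim: n b => [|n IH] b b0.
  rewrite big_ord0 -[RHS](gaussn_cst 0).
  by apply: eq_integral => t _; rewrite /qform big_ord0.
have [||-> _] := @ge0_integral_power_measureS _ _ R n (gauss R) (fun t => (qform b t)%:E).
- by move=> t; rewrite lee_fin qform_ge0.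
- by apply/measurable_EFinP; exact: measurable_qform.
- under eq_integral do under eq_integral do rewrite qform_cons.
  transitivity (\int[gauss R]_x ((b ord0 * x ^+ 2)%:E + (\sum_i b (lift ord0 i))%:E))%E.
    apply: eq_integral => x _.
    under eq_integral do rewrite EFinD.
    rewrite ge0_integralD//; first last.
    - by apply/measurable_EFinP; exact: measurable_qform.
    - by move=> t _; rewrite lee_fin qform_ge0// => i; exact: b0.
    - by move=> t _; rewrite lee_fin mulr_ge0// sqr_ge0.
    by rewrite gaussn_cst IH// => i; exact: b0.
  rewrite ge0_integralD//; first last.
  - by move=> x _; rewrite lee_fin sumr_ge0.
  - by apply/measurable_EFinP; apply: measurable_funM => //; exact: measurable_funX.
  - by move=> x _; rewrite lee_fin mulr_ge0// sqr_ge0.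
  rewrite integral_gauss_cst.
  under eq_integral do rewrite EFinM.
  rewrite ge0_integralZl//; first last.
  - by rewrite lee_fin.
  - by move=> x _; rewrite lee_fin sqr_ge0.
  - by apply/measurable_EFinP; exact: measurable_funX.
  by rewrite gauss_sqr mule1 big_ord_recl.
Qed.

(** The growth allowed is that of the squared norm, whose mean is finite by [gaussn_qform]. *)
Lemma gaussn_integrable n (f : T n -> R) (C : R) : measurable_fun setT f ->
  (forall t, `|f t| <= C * (1 + qform (fun=> 1) t)) ->
  (gaussn R n).-integrable setT (EFin \o f).
Proof.
move=> mf fC.
have C0 : 0 <= C.
  have := le_trans (normr_ge0 _) (fC [tuple 0 | i < n]).
  by rewrite pmulr_lge0// (lt_le_trans ltr01)// lerDl qform_ge0.
have iq : (gaussn R n).-integrable setT (fun t => (C * (1 + qform (fun=> 1) t))%:E).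
  have m1 : measurable_fun setT (fun t : T n => 1 + qform (fun=> 1) t).
    by apply: measurable_funD => //; exact: measurable_qform.
  apply/integrableP; split; first by apply/measurable_EFinP; exact: measurable_funM.
  rewrite [ltLHS](_ : _ = \int[gaussn R n]_t (C%:E * (1%:E + (qform (fun=> 1%R) t)%:E)))%E; last first.
    by apply: eq_integral => t _; rewrite /= ger0_norm// mulr_ge0// addr_ge0// qform_ge0.
  rewrite ge0_integralZl//; first last.
  - by move=> t _; rewrite -EFinD lee_fin addr_ge0// qform_ge0.
  - by under eq_fun do rewrite -EFinD; apply/measurable_EFinP.
  rewrite ge0_integralD//; first last.
  - by apply/measurable_EFinP; exact: measurable_qform.
  - by move=> t _; rewrite lee_fin qform_ge0.
  by rewrite gaussn_cst gaussn_qform// -EFinD -EFinM ltry.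
apply: le_integrable iq => //; first exact/measurable_EFinP.
by move=> t _ /=; rewrite lee_fin (le_trans (fC t))// ler_norm.
Qed.

Lemma gaussn_bounded_integrable n (f : T n -> R) (C : R) : measurable_fun setT f ->
  (forall t, `|f t| <= C) -> (gaussn R n).-integrable setT (EFin \o f).
Proof.
move=> mf fC; apply: (@gaussn_integrable _ _ C) => // t.
apply: le_trans (fC t) _; rewrite ler_peMr ?lerDl ?qform_ge0//.
exact: le_trans (normr_ge0 _) (fC t).
Qed.

(** The phase [theta] carries the induction: while the inner coordinates are integrated, the term of
    the outer one is just a phase. *)
Lemma gaussn_cos n (z : 'I_n -> R) theta :
  (\int[gaussn R n]_t (cos (\sum_(i < n) z i * tnth t i + theta))%:E =
   (expR (- ((\sum_(i < n) z i ^+ 2) / 2)) * cos theta)%:E)%E.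
Proof.
elim: n z theta => [|n IH] z theta.
  rewrite big_ord0 mul0r oppr0 expR0 mul1r -[RHS](gaussn_cst 0).
  by apply: eq_integral => t _; rewrite big_ord0 add0r.
have [|-> _] := @integral_power_measureS _ _ R n (gauss R) (fun t => (cos (\sum_(i < n.+1) z i * tnth t i + theta))%:E).
  apply: (@gaussn_bounded_integrable _ _ 1) => [|t]; last by rewrite ler_norml cos_geN1 cos_le1.
  apply: (@measurableT_comp _ _ _ _ _ _ (@cos R)).
    by apply: continuous_measurable_fun; exact: continuous_cos.
  apply: measurable_funD => //; apply: measurable_sum => i.
  by apply: measurable_funM => //; exact: measurable_tnth.
transitivity (\int[gauss R]_x (expR (- ((\sum_(i < n) z (lift ord0 i) ^+ 2) / 2)) * cos (z ord0 * x + theta))%:E)%E.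
  apply: eq_integral => x _; rewrite -(IH (z \o lift ord0)).
  apply: eq_integral => u _; congr (cos _)%:E.
  by rewrite lform_cons -addrA addrCA.
have icos : (gauss R).-integrable setT (EFin \o (fun x => cos (z ord0 * x + theta))).
  apply: (@gauss_integrable_poly _ 0 _ 1) => [|x].
    apply: measurableT_comp; first by apply: continuous_measurable_fun; exact: continuous_cos.
    by apply: measurable_funD => //; exact: measurable_funM.
  by rewrite expr0 mulr1 ler_norml cos_geN1 cos_le1.
under eq_integral do rewrite EFinM.
rewrite integralZl// -[X in (_ * X)%E]fineK; last exact: integrable_fin_num.
rewrite -EFinM; congr EFin.
rewrite [fine _](gauss_cos (z ord0) theta) mulrA -expRD big_ord_recl.
by congr (expR _ * _); lra.
Qed.

(** As the phase in [gaussn_cos], the shift [s] absorbs the coordinate that is integrated last. *)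
Lemma gaussn_var n (b : 'I_n -> R) (s : R) :
  (\int[gaussn R n]_t ((qform b t - \sum_i b i + s) ^+ 2)%:E =
   (2 * \sum_i b i ^+ 2 + s ^+ 2)%:E)%E.
Proof.
elim: n b s => [|n IH] b s.
  rewrite !big_ord0 mulr0 add0r -[RHS](gaussn_cst 0).
  by apply: eq_integral => t _; rewrite /qform !big_ord0 subrr add0r.
have [||-> _] := @ge0_integral_power_measureS _ _ R n (gauss R) (fun t => ((qform b t - \sum_i b i + s) ^+ 2)%:E).
- by move=> t; rewrite lee_fin sqr_ge0.
- apply/measurable_EFinP; apply: measurable_funX; apply: measurable_funD => //.
  by apply: measurable_funB => //; exact: measurable_qform.
transitivity (\int[gauss R]_x ((2 * \sum_i b (lift ord0 i) ^+ 2)%:E + ((b ord0 * (x ^+ 2 - 1) + s) ^+ 2)%:E))%E.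
  apply: eq_integral => x _; rewrite -EFinD -(IH (b \o lift ord0)).
  apply: eq_integral => u _; rewrite qform_cons big_ord_recl; congr EFin; congr (_ ^+ 2).
  by rewrite /=; ring.
rewrite ge0_integralD//; first last.
- apply/measurable_EFinP; apply: measurable_funX; apply: measurable_funD => //.
  by apply: measurable_funM => //; apply: measurable_funB => //; exact: measurable_funX.
- by move=> x _; rewrite lee_fin sqr_ge0.
- by move=> x _; rewrite lee_fin mulr_ge0// sumr_ge0// => i _; rewrite sqr_ge0.
rewrite integral_gauss_cst gauss_polysq -EFinD big_ord_recl.
by congr EFin; rewrite mulrDr; ring.
Qed.

(** One coordinate at a time: [exp (h a_i x^2)] gives the coordinate [i] the variance [r_i^2], which
    multiplies its weight. As [g] sees the whole form, the last coordinates are tilted with the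
    first one frozen in the shift, and Tonelli's theorem then makes the first one innermost. *)
Lemma gaussn_tilt n (a r : 'I_n -> R) (h s : R) (g : R -> R) :
  continuous g -> (forall x, 0 <= g x) -> (forall i, 0 < r i) ->
  (forall i, r i ^+ 2 * (1 - 2 * h * a i) = 1) ->
  (\int[gaussn R n]_t (g (qform a t + s) * expR (h * qform a t))%:E =
   (\prod_i r i)%:E * \int[gaussn R n]_t (g (qform (fun i => a i * r i ^+ 2) t + s))%:E)%E.
Proof.
move=> cg g0.
elim: n a r s => [|n IH] a r s r0 ra.
  rewrite big_ord0 mul1e; apply: eq_integral => t _.
  by rewrite /qform !big_ord0 mulr0 expR0 mulr1.
have mg : measurable_fun setT g by exact: continuous_measurable_fun.
have mexp k c : measurable_fun setT (fun t : T k => expR (h * qform c t)).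
  by apply: measurableT_comp => //; apply: measurable_funM => //; exact: measurable_qform.
have mgq k c s' : measurable_fun setT (fun t : T k => g (qform c t + s')).
  by apply: measurableT_comp => //; apply: measurable_funD => //; exact: measurable_qform.
pose a' := a \o lift ord0; pose r' := r \o lift ord0.
pose al i := a i * r i ^+ 2; pose al' i := a' i * r' i ^+ 2.
have [||-> _] := @ge0_integral_power_measureS _ _ R n (gauss R) (fun t => (g (qform a t + s) * expR (h * qform a t))%:E).
- by move=> t; rewrite lee_fin mulr_ge0// expR_ge0.
- by apply/measurable_EFinP; apply: measurable_funM; [exact: mgq|exact: mexp].
(* The form halfway: the weights of all coordinates but the first are already tilted, and [G] below
   is the integrand at that stage. *)
pose b i := if unlift ord0 i is Some j then al' j else a ord0.
have qb (x : R) (u : n.-tuple R) : qform b [tuple of x :: u] = a ord0 * x ^+ 2 + qform al' u.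
  rewrite qform_cons /b unlift_none; congr (_ + _).
  by apply: eq_bigr => i _ /=; rewrite liftK.
pose G (t : T n.+1) := ((\prod_i r' i)%:E * (expR (h * a ord0 * tnth t ord0 ^+ 2) * g (qform b t + s))%:E)%E.
transitivity (\int[gauss R]_x \int[gaussn R n]_u G [tuple of x :: u])%E.
  apply: eq_integral => x _; rewrite /G.
  have p0 : 0 <= \prod_i r' i by rewrite prodr_ge0// => i _; rewrite ltW// /r'/=.
  transitivity ((expR (h * a ord0 * x ^+ 2))%:E * \int[gaussn R n]_u (g (qform a' u + (a ord0 * x ^+ 2 + s)) * expR (h * qform a' u))%:E)%E.
    rewrite -ge0_integralZl//; first last.
    - by move=> t _; rewrite lee_fin mulr_ge0// expR_ge0.
    - by apply/measurable_EFinP; apply: measurable_funM; [exact: mgq|exact: mexp].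
    apply: eq_integral => u _; rewrite -EFinM qform_cons mulrDr expRD; congr EFin.
    rewrite (mulrA h) [in RHS]mulrCA; congr (g _ * _); ring.
  rewrite (IH a' r')//; first last.
  - by move=> i; exact: ra.
  - by move=> i; exact: r0.
  rewrite ge0_integralZl//; first last.
  - by move=> u _; rewrite lee_fin mulr_ge0// expR_ge0.
  - apply/measurable_EFinP; apply: measurable_funM.
      under eq_fun do rewrite tnth0.
      exact: measurable_cst.
    under eq_fun do rewrite qb.
    apply: measurableT_comp => //.
    by apply: measurable_funD => //; apply: measurable_funD => //; exact: measurable_qform.
  rewrite muleCA; congr (_ * _)%E.
  rewrite -ge0_integralZl//; first last.
  - by move=> u _; rewrite lee_fin.
  - by apply/measurable_EFinP; exact: mgq.
  apply: eq_integral => u _; rewrite -EFinM tnth0 qb; congr EFin; congr (_ * g _).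
  by rewrite /al' /=; ring.
have G0 t : (0 <= G t)%E.
  rewrite /G mule_ge0// lee_fin; last by rewrite mulr_ge0// expR_ge0.
  by rewrite prodr_ge0// => i _; rewrite ltW// /r'/=.
have mG : measurable_fun setT G.
  apply: emeasurable_funM => //; apply/measurable_EFinP.
  apply: measurable_funM; last exact: mgq.
  apply: measurableT_comp => //; apply: measurable_funM => //.
  by apply: measurable_funX; exact: measurable_tnth.
have [<- ->] := @ge0_integral_power_measureS _ _ R n (gauss R) G G0 mG.
have [||_ ->] := @ge0_integral_power_measureS _ _ R n (gauss R) (fun t => (g (qform al t + s))%:E).
- by move=> t; rewrite lee_fin.
- by apply/measurable_EFinP; exact: mgq.
rewrite -ge0_integralZl//; first last.
- by rewrite lee_fin prodr_ge0// => i _; rewrite ltW.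
- by move=> u _; apply: integral_ge0 => x _; rewrite lee_fin.
- rewrite [X in measurable_fun _ X](_ : _ = fubini_G (gauss R) (fun p : measurableTypeR R * T n => (g (qform al [tuple of p.1 :: p.2] + s))%:E))//.
  apply: measurable_fun_fubini_tonelli_G => /=; last by move=> p; rewrite lee_fin.
  apply/measurable_EFinP; apply: (@measurableT_comp _ _ _ _ _ _ (fun t : T n.+1 => g (qform al t + s))); first exact: mgq.
  exact: measurable_cons.
apply: eq_integral => u _; rewrite /G.
rewrite ge0_integralZl//; first last.
- by rewrite lee_fin prodr_ge0// => i _; rewrite ltW// /r'/=.
- by move=> x _; rewrite lee_fin mulr_ge0// expR_ge0.
- apply/measurable_EFinP; apply: measurable_funM.
    under eq_fun do rewrite tnth0.
    apply: measurableT_comp => //.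
    by apply: measurable_funM => //; exact: measurable_funX.
  under eq_fun do rewrite qb.
  apply: measurableT_comp => //.
  apply: measurable_funD => //; apply: measurable_funD => //.
  by apply: measurable_funM => //; exact: measurable_funX.
rewrite big_ord_recl EFinM (muleC (r ord0)%:E) -muleA; congr (_ * _)%E.
under eq_integral do rewrite tnth0 qb mulrC.
rewrite (@gauss_tilt _ (fun x => g (a ord0 * x ^+ 2 + qform al' u + s)) (h * a ord0) (r ord0))//.
- congr (_ * _)%E; apply: eq_integral => x _; rewrite qform_cons; congr (g _)%:E.
  by rewrite /al exprMn mulrA.
- move=> x; apply: (@continuous_comp _ _ _ (fun x : R => a ord0 * x ^+ 2 + qform al' u + s) g); last exact: cg.
  apply: cvgD; last exact: cvg_cst; apply: cvgD; last exact: cvg_cst.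
  by apply: cvgM; [exact: cvg_cst|exact: exprn_continuous].
- by rewrite mulrA; exact: ra.
Qed.

End gaussn.

(** * Stein's method *)

Section stein_identity.
Context {R : realType}.
Local Notation T n := (n.-tuple (measurableTypeR R)).

Lemma EFin_Rintegral d (U : measurableType d) (m : {measure set U -> \bar R})
    (f : U -> R) : m.-integrable setT (EFin \o f) ->
  ((\int[m]_x f x)%:E = \int[m]_x (f x)%:E)%E.
Proof. by move=> fi; rewrite /Rintegral fineK//; exact: integrable_fin_num. Qed.

(** Integration by parts for [F x = a x f (a x^2 + s)], whose derivative is [a f + 2 a^2 x^2 f'];
    the first term is what the centring [x^2 - 1] subtracts. *)
Lemma gauss_stein (a s K : R) (f f' : R -> R) :
  (forall x : R, is_derive x 1 f (f' x)) -> continuous f' ->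
  (forall x, `|f x| <= K) -> (forall x, `|f' x| <= K) ->
  (\int[gauss R]_x (a * (x ^+ 2 - 1) * f (a * x ^+ 2 + s))%:E =
   \int[gauss R]_x (2 * a ^+ 2 * x ^+ 2 * f' (a * x ^+ 2 + s))%:E)%E.
Proof.
move=> df cf' fK f'K.
have K0 : 0 <= K by exact: le_trans (normr_ge0 _) (fK 0).
have cf : continuous f.
  by move=> x; apply/differentiable_continuous/derivable1_diffP; case: (df x).
have cq : continuous (fun x : R => a * x ^+ 2 + s).
  move=> x; apply: cvgD; last exact: cvg_cst.
  by apply: cvgM; [exact: cvg_cst|exact: exprn_continuous].
have cfq : continuous (fun x : R => f (a * x ^+ 2 + s)).
  by move=> x; apply: (@continuous_comp _ _ _ (fun x : R => a * x ^+ 2 + s) f); [exact: cq|exact: cf].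
have cf'q : continuous (fun x : R => f' (a * x ^+ 2 + s)).
  by move=> x; apply: (@continuous_comp _ _ _ (fun x : R => a * x ^+ 2 + s) f'); [exact: cq|exact: cf'].
pose A x := a * f (a * x ^+ 2 + s); pose B x := 2 * a ^+ 2 * x ^+ 2 * f' (a * x ^+ 2 + s).
pose F x := a * x * f (a * x ^+ 2 + s); pose dF x := A x + B x.
have cA : continuous A by move=> x; apply: cvgM; [exact: cvg_cst|exact: cfq].
have cB : continuous B.
  move=> x; apply: cvgM; last exact: cf'q.
  by apply: cvgM; [exact: cvg_cst|exact: exprn_continuous].
have cF : continuous F.
  move=> x; apply: cvgM; last exact: cfq.
  by apply: cvgM; [exact: cvg_cst|exact: cvg_id].
pose C := `|a| * K + 2 * a ^+ 2 * K.
have aK : 0 <= `|a| * K by rewrite mulr_ge0.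
have a2K : 0 <= 2 * a ^+ 2 * K by rewrite mulr_ge0// mulr_ge0// sqr_ge0.
have p1 (x : R) : 1 <= 1 + `|x| by rewrite lerDl.
have p2 (x : R) : 1 <= (1 + `|x|) ^+ 2 by rewrite exprn_ege1.
have p2' (x : R) : `|x| <= (1 + `|x|) ^+ 2 by have := normr_ge0 x; nra.
have p3 (x : R) : x ^+ 2 <= (1 + `|x|) ^+ 2.
  by rewrite -real_normK ?num_real// lerXn2r ?nnegrE ?lerDr// addr_ge0.
have Ab x : `|A x| <= `|a| * K * (1 + `|x|) ^+ 2.
  rewrite normrM; apply: (@le_trans _ _ (`|a| * K)); first by rewrite ler_wpM2l.
  by rewrite ler_peMr.
have Bb x : `|B x| <= 2 * a ^+ 2 * K * (1 + `|x|) ^+ 2.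
  have -> : `|B x| = 2 * a ^+ 2 * x ^+ 2 * `|f' (a * x ^+ 2 + s)|.
    by rewrite normrM ger0_norm// mulr_ge0 ?sqr_ge0// mulr_ge0 ?sqr_ge0.
  have h := ler_pM (sqr_ge0 x) (normr_ge0 _) (p3 x) (f'K (a * x ^+ 2 + s)).
  have := ler_wpM2l (mulr_ge0 (ler0n R 2) (sqr_ge0 a)) h; lra.
have Fb x : `|F x| <= C * (1 + `|x|) ^+ 2.
  rewrite 2!normrM /C mulrDl; apply: ler_wpDr; first by rewrite mulr_ge0// exprn_ge0// addr_ge0.
  have h := ler_pM (normr_ge0 x) (normr_ge0 _) (p2' x) (fK (a * x ^+ 2 + s)).
  have := ler_wpM2l (normr_ge0 a) h; lra.
have dFb x : `|dF x| <= C * (1 + `|x|) ^+ 2.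
  by apply: le_trans (ler_normD _ _) _; rewrite /C mulrDl lerD.
have dFd (x : R) : is_derive x 1 F (dF x).
  have dq : is_derive x 1 (fun x : R => a * x ^+ 2 + s) (2 * a * x).
    by apply: is_derive_eq; rewrite /GRing.scale/=; ring.
  have dfq := @is_derive1_comp _ f (fun x : R => a * x ^+ 2 + s) x _ _ (df _) dq.
  have dax : is_derive x 1 (fun x : R => a * x) a.
    by apply: is_derive_eq; rewrite /GRing.scale/= mulr1.
  have H := @is_deriveM _ _ (fun x : R => a * x) (fun x => f (a * x ^+ 2 + s)) x 1 _ _ dax dfq.
  apply: is_derive_eq H _; rewrite /GRing.scale/= /dF /A /B; ring.
have ibp := @gauss_ibp _ F dF C 2 dFd (fun x => cvgD (cA x) (cB x)) Fb dFb.
have iA : (gauss R).-integrable setT (EFin \o A).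
  by apply: (gauss_integrable_poly _ Ab); exact: continuous_measurable_fun.
have iB : (gauss R).-integrable setT (EFin \o B).
  by apply: (gauss_integrable_poly _ Bb); exact: continuous_measurable_fun.
have ixF : (gauss R).-integrable setT (EFin \o (fun x => x * F x)).
  apply: (@gauss_integrable_poly _ 3 _ C) => [|x].
    by apply: continuous_measurable_fun => x; apply: cvgM; [exact: cvg_id|exact: cF].
  by rewrite normrM exprS mulrCA ler_pM// lerDr.
have iAB : (gauss R).-integrable setT (EFin \o dF) := integrableD measurableT iA iB.
transitivity (\int[gauss R]_x ((x * F x)%:E - (A x)%:E))%E.
  by apply: eq_integral => x _; rewrite -EFinB; congr EFin; rewrite /F /A; ring.
rewrite integralB// -!EFin_Rintegral// ibp RintegralD// -EFinB.
by rewrite addrAC subrr add0r.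
Qed.

Lemma qform_bound n (b : 'I_n -> R) (t : T n) :
  `|qform b t| <= (\sum_i `|b i|) * qform (fun=> 1) t.
Proof.
apply: le_trans (ler_norm_sum _ _ _) _; rewrite mulr_suml ler_sum// => i _.
rewrite normrM ler_wpM2l// ger0_norm ?sqr_ge0// /qform (bigD1 i)//= mul1r lerDl.
by rewrite sumr_ge0// => j _; rewrite mul1r sqr_ge0.
Qed.

(** The characterisation of N(0, 2) by the mean of [Y f Y] being that of [2 f' Y] holds for the form
    [Q] up to the random factor [sum_i a_i^2 xi_i^2]; [Q] is therefore nearly Gaussian when this
    factor is nearly constant. *)
Lemma gaussn_stein n (a : 'I_n -> R) (s K : R) (f f' : R -> R) :
  (forall x : R, is_derive x 1 f (f' x)) -> continuous f' ->
  (forall x, `|f x| <= K) -> (forall x, `|f' x| <= K) ->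
  (\int[gaussn R n]_t ((qform a t - \sum_i a i) * f (qform a t + s))%:E =
   \int[gaussn R n]_t (2 * qform (fun i => a i ^+ 2) t * f' (qform a t + s))%:E)%E.
Proof.
move=> df cf' fK f'K.
have K0 : 0 <= K by exact: le_trans (normr_ge0 _) (fK 0).
have cf : continuous f.
  by move=> x; apply/differentiable_continuous/derivable1_diffP; case: (df x).
elim: n a s => [|n IH] a s.
  apply: eq_integral => t _; rewrite /qform !big_ord0 subrr mul0r mulr0.
  by rewrite mul0r.
pose a' := a \o lift ord0.
have mq (g : R -> R) : continuous g -> measurable_fun setT (fun t : T n.+1 => g (qform a t + s)).
  move=> cg; apply: measurableT_comp; first exact: continuous_measurable_fun.
  by apply: measurable_funD => //; exact: measurable_qform.
have m0 : measurable_fun setT (fun t : T n.+1 => (tnth t ord0 : R) ^+ 2).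
  by apply: measurable_funX; exact: measurable_tnth.
(* [A] and [A'] collect the contribution of the first coordinate, integrated innermost for the
   one-dimensional identity; [B] and [B'] the others, for which it is integrated last and goes into
   the shift of the induction hypothesis. *)
pose A (t : T n.+1) := a ord0 * (tnth t ord0 ^+ 2 - 1) * f (qform a t + s).
pose B (t : T n.+1) := (qform a t - a ord0 * tnth t ord0 ^+ 2 - \sum_i a' i) * f (qform a t + s).
pose A' (t : T n.+1) := 2 * a ord0 ^+ 2 * tnth t ord0 ^+ 2 * f' (qform a t + s).
pose B' (t : T n.+1) := 2 * (qform (fun i => a i ^+ 2) t - a ord0 ^+ 2 * tnth t ord0 ^+ 2) * f' (qform a t + s).
pose M (t : T n.+1) := 1 + qform (fun=> 1) t.
have q0 (t : T n.+1) : 0 <= qform (fun=> 1) t by exact: qform_ge0.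
have M1 t : 1 <= M t by rewrite lerDl.
have M0 t : 0 <= M t by rewrite addr_ge0.
have Mt (t : T n.+1) : tnth t ord0 ^+ 2 <= M t.
  rewrite /M /qform big_ord_recl mul1r ler_wpDl// ler_wpDr//.
  by rewrite sumr_ge0// => i _; rewrite mul1r sqr_ge0.
have Mq (b : 'I_n.+1 -> R) (t : T n.+1) : `|qform b t| <= (\sum_i `|b i|) * M t.
  by apply: le_trans (qform_bound _ _) _; rewrite ler_wpM2l ?sumr_ge0// lerDr.
have lin (b : 'I_n.+1 -> R) (u v : R) (t : T n.+1) :
    `|qform b t - u * tnth t ord0 ^+ 2 - v| <= (\sum_i `|b i| + `|u| + `|v|) * M t.
  apply: le_trans (ler_normB _ _) _; rewrite [leRHS]mulrDl lerD//; last by rewrite ler_peMr.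
  apply: le_trans (ler_normB _ _) _; rewrite [leRHS]mulrDl lerD//.
  by rewrite normrM ler_wpM2l// ger0_norm// sqr_ge0.
have mlin (b : 'I_n.+1 -> R) (u v : R) :
    measurable_fun setT (fun t : T n.+1 => qform b t - u * tnth t ord0 ^+ 2 - v).
  apply: measurable_funB => //; apply: measurable_funB; first exact: measurable_qform.
  exact: measurable_funM.
have ilin (c : R) (b : 'I_n.+1 -> R) (u v : R) (g : R -> R) : continuous g -> (forall x, `|g x| <= K) ->
    (gaussn R n.+1).-integrable setT (EFin \o (fun t : T n.+1 => (c * (qform b t - u * tnth t ord0 ^+ 2 - v)) * g (qform a t + s))).
  move=> cg gK; apply: (@gaussn_integrable _ _ _ (`|c| * (\sum_i `|b i| + `|u| + `|v|) * K)).
    by apply: measurable_funM; [apply: measurable_funM => //; exact: mlin|exact: mq].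
  move=> t; have h := ler_pM (normr_ge0 _) (normr_ge0 _) (lin b u v t) (gK (qform a t + s)).
  rewrite 2!normrM -mulrA; apply: le_trans (ler_wpM2l (normr_ge0 c) h) _.
  by rewrite le_eqVlt; apply/orP; left; apply/eqP; rewrite /M; ring.
have iA : (gaussn R n.+1).-integrable setT (EFin \o A).
  apply: eq_integrable (ilin 1 (fun=> 0) (- a ord0) (a ord0) f cf fK) => // t _ /=.
  congr (_ * _)%:E; rewrite /qform big1 ?mul1r; first ring.
  by move=> i _; rewrite mul0r.
have iB : (gaussn R n.+1).-integrable setT (EFin \o B).
  by apply: eq_integrable (ilin 1 a (a ord0) (\sum_i a' i) f cf fK) => // t _ /=; rewrite mul1r.
have iA' : (gaussn R n.+1).-integrable setT (EFin \o A').
  apply: eq_integrable (ilin 2 (fun=> 0) (- a ord0 ^+ 2) 0 f' cf' f'K) => // t _ /=.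
  congr (_ * _)%:E; rewrite /qform big1 ?subr0; first ring.
  by move=> i _; rewrite mul0r.
have iB' : (gaussn R n.+1).-integrable setT (EFin \o B').
  by apply: eq_integrable (ilin 2 (fun i => a i ^+ 2) (a ord0 ^+ 2) 0 f' cf' f'K) => // t _ /=; rewrite subr0.
transitivity (\int[gaussn R n.+1]_t ((A t)%:E + (B t)%:E))%E.
  apply: eq_integral => t _; rewrite -EFinD; congr EFin.
  by rewrite /A /B big_ord_recl /a' /=; ring.
transitivity (\int[gaussn R n.+1]_t ((A' t)%:E + (B' t)%:E))%E; last first.
  by apply: eq_integral => t _; rewrite -EFinD; congr EFin; rewrite /A' /B'; ring.
rewrite integralD// [RHS]integralD//; congr (_ + _)%E.
  have [_ ->] := integral_power_measureS iA; have [_ ->] := integral_power_measureS iA'.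
  apply: eq_integral => u _; rewrite /A /A'.
  transitivity (\int[gauss R]_x (a ord0 * (x ^+ 2 - 1) * f (a ord0 * x ^+ 2 + (qform a' u + s)))%:E)%E.
    by apply: eq_integral => x _; rewrite /= tnth0 qform_cons addrA.
  rewrite (gauss_stein _ _ df cf' fK f'K).
  by apply: eq_integral => x _; rewrite /= tnth0 qform_cons addrA.
have [-> _] := integral_power_measureS iB; have [-> _] := integral_power_measureS iB'.
apply: eq_integral => x _; rewrite /B /B'.
transitivity (\int[gaussn R n]_u ((qform a' u - \sum_i a' i) * f (qform a' u + (a ord0 * x ^+ 2 + s)))%:E)%E.
  apply: eq_integral => u _; rewrite /= tnth0 qform_cons; congr (_ * f _)%:E; ring.
rewrite IH; apply: eq_integral => u _; rewrite /= tnth0 !qform_cons; congr (_ * f' _)%:E; last by ring.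
by rewrite /a'/=; congr (2 * _); rewrite addrAC subrr add0r.
Qed.

End stein_identity.

Section stein_equation.
Context {R : realType}.
Notation mu := (@lebesgue_measure R).
Let p (x : R) : R := normal_pdf 0 1 x.

Let pE x : p x = normal_peak 1 * expR (- x ^+ 2 / 2).
Proof. by rewrite /p normal_pdfE ?oner_neq0// /normal_fun subr0 expr1n. Qed.

Let p_gt0 x : 0 < p x.
Proof. by rewrite pE mulr_gt0 ?normal_peak_gt0 ?oner_neq0// expR_gt0. Qed.

Let cp : continuous p. Proof. exact: continuous_normal_pdf. Qed.

Let pN x : p (- x) = p x. Proof. by rewrite !pE sqrrN. Qed.

Let dp (x : R) : is_derive x 1 p (- x * p x). Proof. exact: is_derive_gpdf. Qed.

Let ip D : measurable D -> mu.-integrable D (EFin \o p).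
Proof. by move=> mD; apply: integrableS (integrable_normal_pdf 0 1). Qed.

Let T (y : R) := (\int[mu]_(t in `[y, +oo[) (p t)%:E)%E.

Let T_le1 y : (T y <= 1)%E.
Proof.
rewrite -(integral_normal_pdf (0 : R) 1) /T; apply: ge0_subset_integral => //.
- by apply/measurable_EFinP; exact: measurable_normal_pdf.
- by move=> x _; rewrite lee_fin normal_pdf_ge0.
Qed.

Let p_cvg0 : p x @[x --> +oo] --> (0 : R).
Proof.
apply/cvgrPdist_le => e e0; near=> x.
have x0 : 0 < x by near: x; exact: nbhs_pinfty_gt.
rewrite sub0r normrN gtr0_norm// pE.
have h : normal_peak 1 * expR (- x ^+ 2 / 2) <= normal_peak 1 / (x ^+ 2 / 2).
  rewrite ler_wpM2l ?normal_peak_ge0// mulNr expRN lef_pV2 ?posrE ?expR_gt0 ?divr_gt0 ?exprn_gt0//.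
  by apply: le_trans (expR_ge1Dx _); rewrite lerDr.
apply: le_trans h _; rewrite ler_pdivrMr ?divr_gt0 ?exprn_gt0// -ler_pdivrMl//.
have x1 : 1 <= x by near: x; apply: nbhs_pinfty_ge; exact: num_real.
apply: (@le_trans _ _ (x / 2)); last by rewrite ler_wpM2r// expr2 ler_peMl.
rewrite ler_pdivlMr//; near: x; apply: nbhs_pinfty_ge; exact: num_real.
Unshelve. all: by end_near. Qed.

(* [t p(t) = - p'(t)], so the tail integral of [t p(t)] is [p y]. *)
Let T_mill y : 0 <= y -> (y%:E * T y <= (p y)%:E)%E.
Proof.
move=> y0; rewrite /T -ge0_integralZl//; first last.
- by move=> x _; rewrite lee_fin ltW.
- by apply/measurable_EFinP/measurable_funTS; exact: measurable_normal_pdf.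
have dnp (x : R) : is_derive x 1 (fun x => - p x) (x * p x).
  by have ? := dp x; apply: is_derive_eq; rewrite mulNr opprK.
have cnp : continuous (fun x => - p x).
  by move=> x; apply: cvgN; exact: cp.
have E : (\int[mu]_(t in `[y, +oo[) (t * p t)%:E = 0%:E - (- p y)%:E)%E.
  apply: (@ge0_continuous_FTC2y R (fun t => t * p t) (fun t => - p t) y 0).
  - by move=> x yx; rewrite mulr_ge0 ?(le_trans y0 yx)// ltW.
  - apply: continuous_subspaceT => x; apply: cvgM; [exact: cvg_id|exact: cp].
  - by rewrite -oppr0; apply: cvgN; exact: p_cvg0.
  - by move=> x _; case: (dnp x).
  - by apply: cvg_at_right_filter; exact: cnp.
  - by move=> x _; rewrite derive1E; apply: derive_val.
rewrite (_ : (p y)%:E = \int[mu]_(t in `[y, +oo[) (t * p t)%:E)%E; last first.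
  by rewrite E sub0e -EFinN opprK.
apply: ge0_le_integral => //.
- by move=> x _; rewrite mule_ge0// lee_fin ltW.
- by apply: emeasurable_funM => //; apply/measurable_EFinP/measurable_funTS; exact: measurable_normal_pdf.
- apply/measurable_EFinP/measurable_funTS; apply: measurable_funM => //.
  exact: measurable_normal_pdf.
- move=> x; rewrite /= in_itv/= andbT => yx; rewrite -EFinM lee_fin.
  by rewrite ler_wpM2r// ltW.
Qed.

(** A bound of Mills' ratio [T y / p y] over [y >= 0]: the ratio is at most [1] for [y >= 1] by
    [T_mill], and at most [1 / p 1] for [y < 1], where [T y <= 1] and [p y >= p 1]. *)
Definition stein_const : R := 1 + (normal_pdf 0 1 1)^-1.

Let T_le y : 0 <= y -> (T y <= (stein_const * p y)%:E)%E.
Proof.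
move=> y0; have [y1|y1] := leP 1 y.
  apply: (@le_trans _ _ (p y)%:E); last first.
    by rewrite lee_fin; apply: ler_peMl; [exact: ltW|rewrite /stein_const lerDl invr_ge0; exact: ltW].
  apply: le_trans (T_mill y0); rewrite -[leLHS]mul1e lee_wpmul2r ?lee_fin//.
  by apply: integral_ge0 => x _; rewrite lee_fin ltW.
apply: le_trans (T_le1 y) _; rewrite lee_fin /stein_const mulrDl mul1r.
apply: ler_wpDl; first exact: ltW.
rewrite -[leLHS](mulVf (lt0r_neq0 (p_gt0 1))) ler_wpM2l ?invr_ge0 ?(ltW (p_gt0 1))//.
rewrite !pE ler_wpM2l ?normal_peak_ge0// ler_expR.
have : y ^+ 2 <= 1 ^+ 2 by rewrite lerXn2r ?nnegrE// ltW.
rewrite expr1n; lra.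
Qed.

(** The solution is [f y = G y / p y], with [G y] the integral of [phi p] up to [y]. Its two bounds
    are those of [T y / p y] and of [y T y / p y]. *)
Lemma stein_equation (phi : R -> R) : continuous phi ->
  (forall x, `|phi x| <= 1) -> \int[gauss R]_x phi x = 0 ->
  exists f : R -> R, [/\ forall x : R, is_derive x 1 f (x * f x + phi x),
    forall x, `|f x| <= stein_const & forall x, `|x * f x| <= 1].
Proof.
move=> cphi phi1 phi0.
have mphi : measurable_fun setT phi by exact: continuous_measurable_fun.
have iphi : (gauss R).-integrable setT (EFin \o phi).
  by apply: (@gauss_integrable_poly _ 0 _ 1) => // x; rewrite expr0 mulr1.
have [igp e] := Rintegral_gauss mphi iphi.
pose g x := phi x * p x.
have cg : continuous g by move=> x; apply: cvgM; [exact: cphi|exact: cp].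
have ig D : measurable D -> mu.-integrable D (EFin \o g).
  by move=> mD; exact: integrableS igp.
pose G y := \int[mu]_(t in `]-oo, y]) g t.
have dG (x : R) : is_derive x 1 G (g x).
  have [] := @continuous_FTC1 R g -oo%O x (x + 1) _ _ _ (cg x).
  - by rewrite ltrDl.
  - exact: ig.
  - by rewrite ltNyr.
  by move=> h1 h2; apply: DeriveDef; [exact: h1|rewrite -derive1E; exact: h2].
have gp x : `|g x| <= p x by rewrite normrM (gtr0_norm (p_gt0 x)) ler_piMl// ltW.
have nG D : measurable D -> (`|\int[mu]_(t in D) g t|%:E <= \int[mu]_(t in D) (p t)%:E)%E.
  move=> mD; rewrite EFin_normr_Rintegral//; last exact: ig.
  apply: le_trans (le_abse_integral _ mD (measurable_int _ (ig D mD))) _.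
  apply: ge0_le_integral => //.
  - by apply: measurableT_comp => //; exact: measurable_int (ig D mD).
  - by apply: measurable_int (ip mD).
  - by move=> x _; rewrite lee_fin.
(* For [y >= 0] the vanishing mean of [phi] turns the integral up to [y] into minus the integral
   beyond [y], so in both cases only a tail has to be bounded. *)
have GT y : (`|G y|%:E <= T `|y|)%E.
  have [y0|y0] := leP 0 y.
    have -> : `|G y| = `|\int[mu]_(t in `]y, +oo[) g t|.
      have := Rintegral_itvB; move=> _.
      have : \int[mu]_t g t = 0 by rewrite -e.
      have -> : [set: R] = `]-oo, y] `|` `]y, +oo[.
        apply/seteqP; split=> // x _ /=; rewrite !in_itv/= andbT.
        by case: (leP x y); [left|right].
      rewrite Rintegral_setU//.
      - by move=> /eqP; rewrite addrC addr_eq0 => /eqP ->; rewrite normrN.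
      - by apply: ig; exact: measurableU.
      - apply/disj_setPS => t [/=]; rewrite !in_itv/= andbT => ty yt.
        by move: (lt_le_trans yt ty); rewrite ltxx.
    apply: le_trans (nG _ _) _ => //; rewrite ger0_norm//.
    apply: ge0_subset_integral => //.
    + by apply: measurable_int (ip _).
    + by move=> x _; rewrite lee_fin ltW.
    + by move=> x /=; rewrite !in_itv/= !andbT; exact: ltW.
  apply: le_trans (nG _ _) _ => //; rewrite ltr0_norm//.
  rewrite -{1}(opprK y) ge0_integration_by_substitutionNy.
  - rewrite le_eqVlt; apply/orP; left; apply/eqP.
    by apply: eq_integral => x _; rewrite /= pN.
  - exact: continuous_subspaceT.
  - by move=> x _; rewrite ltW.
have np y : p `|y| = p y by rewrite !pE real_normK// num_real.
exists (fun y => G y / p y); split.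
- move=> x; have dp' := dp x; have dG' := dG x.
  have dV := is_deriveV (lt0r_neq0 (p_gt0 x)) dp'.
  have H := is_deriveM dG' dV.
  apply: is_derive_eq H _; rewrite /GRing.scale/= /g.
  by field; rewrite gt_eqF.
- move=> y; rewrite normrM normfV (gtr0_norm (p_gt0 y)) ler_pdivrMr// -np.
  by rewrite -lee_fin (le_trans (GT y))// T_le.
- move=> y; rewrite mulrA normrM normfV (gtr0_norm (p_gt0 y)) ler_pdivrMr// mul1r -np.
  rewrite -lee_fin normrM EFinM; apply: le_trans (T_mill (normr_ge0 y)).
  by rewrite lee_wpmul2l// ?lee_fin.
Qed.

End stein_equation.

Section stein_bound.
Context {R : realType}.
Local Notation T n := (n.-tuple (measurableTypeR R)).

Let C0 := @stein_const R.

Lemma stein_const_ge1 : 1 <= stein_const :> R.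
Proof. by rewrite lerDl invr_ge0 normal_pdf_ge0. Qed.

(** Two defects separate the shifted form from N(0, 2): its mean, [sum_i al_i - k], and the
    deviation from [1] of the random factor in [gaussn_stein]. The left side of the last hypothesis
    is the second moment of twice that deviation. *)
Lemma stein_bound n (al : 'I_n -> R) (k delta : R) (g : R -> R) :
  continuous g -> (forall x, 0 <= g x <= 1) -> 0 < delta ->
  4 * (2 * \sum_i al i ^+ 4 + (\sum_i al i ^+ 2 - 1) ^+ 2) <= delta ^+ 2 ->
  `|\int[gaussn R n]_t g (qform al t - k) - \int[gauss R]_x g (Num.sqrt 2 * x)|
     <= C0 * `|\sum_i al i - k| + delta.
Proof.
move=> cg g01 d0 hd.
pose c : R := Num.sqrt 2.
have c0 : 0 < c by rewrite sqrtr_gt0.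
have c2 : c ^+ 2 = 2 by rewrite sqr_sqrtr.
have c1 : 1 <= c by rewrite -sqrtr1 ler_wsqrtr// ler1n.
have cgc : continuous (fun x : R => g (c * x)).
  move=> x; apply: (@continuous_comp _ _ _ (fun x : R => c * x) g); last exact: cg.
  by apply: cvgM; [exact: cvg_cst|exact: cvg_id].
have gab (x : R) : `|g x| <= 1 by rewrite ger0_norm; case/andP: (g01 x).
have igc : (gauss R).-integrable setT (EFin \o (fun x : R => g (c * x))).
  apply: (@gauss_integrable_poly _ 0 _ 1) => [|x]; first exact: continuous_measurable_fun.
  by rewrite expr0 mulr1.
have icst : (gauss R).-integrable setT (EFin \o (fun _ : R => 1 : R)).
  apply: (@gauss_integrable_poly _ 0 _ 1) => [|x]; first exact: measurable_cst.
  by rewrite expr0 mulr1 normr1.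
pose N := \int[gauss R]_x g (c * x).
have N0 : 0 <= N by apply: Rintegral_ge0 => x _; case/andP: (g01 (c * x)).
have N1 : N <= 1.
  rewrite -[leRHS](gauss_cst 1); apply: le_Rintegral => // x _.
  by case/andP: (g01 (c * x)).
pose phi y := g (c * y) - N.
have cphi : continuous phi by move=> x; apply: cvgB; [exact: cgc|exact: cvg_cst].
have phi1 x : `|phi x| <= 1.
  by rewrite ler_norml /phi; case/andP: (g01 (c * x)) => h1 h2; apply/andP; split; lra.
have phi0 : \int[gauss R]_x phi x = 0.
  rewrite RintegralB//; first by rewrite gauss_cst subrr.
  apply: (@gauss_integrable_poly _ 0 _ 1) => [|x]; first exact: measurable_cst.
  by rewrite expr0 mulr1 ger0_norm.
have [f [df f1 f2]] := stein_equation cphi phi1 phi0.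
have cf : continuous f.
  by move=> x; apply/differentiable_continuous/derivable1_diffP; case: (df x).
(* Rescaling from variance [1] to variance [2]: [F] solves [2 F' - x F = g - N], which is [SE]
   below. *)
pose F x := c^-1 * f (c^-1 * x).
pose F' x := 2^-1 * (c^-1 * x * f (c^-1 * x) + phi (c^-1 * x)).
have dlin (x : R) : is_derive x 1 (fun x : R => c^-1 * x) c^-1.
  by apply: is_derive_eq; rewrite /GRing.scale/= mulr1.
have dF (x : R) : is_derive x 1 F (F' x).
  have H := @is_derive1_comp _ f (fun x : R => c^-1 * x) x _ _ (df _) (dlin x).
  have hc : is_derive x 1 (fun _ : R => c^-1) 0 by exact: is_derive_cst.
  have H2 := is_deriveM hc H.
  apply: is_derive_eq H2 _; rewrite /GRing.scale/= /F' -c2.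
  by move: (phi _) (f _) => A B; field; rewrite gt_eqF.
have clin : continuous (fun x : R => c^-1 * x).
  by move=> x; apply: cvgM; [exact: cvg_cst|exact: cvg_id].
have cfl : continuous (fun x : R => f (c^-1 * x)).
  by move=> x; apply: (@continuous_comp _ _ _ (fun x : R => c^-1 * x) f); [exact: clin|exact: cf].
have cpl : continuous (fun x : R => phi (c^-1 * x)).
  by move=> x; apply: (@continuous_comp _ _ _ (fun x : R => c^-1 * x) phi); [exact: clin|exact: cphi].
have cF' : continuous F'.
  move=> x; apply: cvgM; first exact: cvg_cst.
  by apply: cvgD; [apply: cvgM; [exact: clin|exact: cfl]|exact: cpl].
have cF : continuous F by move=> x; apply: cvgM; [exact: cvg_cst|exact: cfl].
have Fb x : `|F x| <= C0.
  rewrite normrM ger0_norm ?invr_ge0 ?(ltW c0)//; apply: le_trans (f1 (c^-1 * x)).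
  by rewrite ler_piMl// invf_le1.
have F'b1 x : `|F' x| <= 1.
  rewrite normrM ger0_norm ?invr_ge0// ler_pdivrMl// mulr1.
  by apply: le_trans (ler_normD _ _) _; have := f2 (c^-1 * x); have := phi1 (c^-1 * x); lra.
have F'b x : `|F' x| <= C0 by apply: le_trans (F'b1 x) _; exact: stein_const_ge1.
have SE x : g x = 2 * F' x - x * F x + N.
  rewrite /F' /F /phi mulrA divff ?gt_eqF// mul1r.
  have -> : c * (c^-1 * x) = x by rewrite mulrA divff ?gt_eqF// mul1r.
  by move: (f _) => A; ring.
have mQ (u : R -> R) : continuous u -> measurable_fun setT (fun t : T n => u (qform al t - k)).
  move=> cu; apply: measurableT_comp; first exact: continuous_measurable_fun.
  by apply: measurable_funB => //; exact: measurable_qform.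
have mq b : measurable_fun setT (fun t : T n => qform b t : R) by exact: measurable_qform.
pose I (u : T n -> R) := \int[gaussn R n]_t u t.
pose al2 i := al i ^+ 2.
have C0_ge0 : 0 <= C0 by apply: le_trans stein_const_ge1.
have q1 (t : T n) : 0 <= qform (fun=> 1) t by exact: qform_ge0.
have il (b : 'I_n -> R) (v : R) (u : R -> R) : continuous u -> (forall x, `|u x| <= C0) ->
    (gaussn R n).-integrable setT (EFin \o (fun t => (qform b t + v) * u (qform al t - k))).
  move=> cu ub; apply: (@gaussn_integrable _ _ _ ((\sum_i `|b i| + `|v|) * C0)).
    by apply: measurable_funM; [apply: measurable_funD|exact: mQ].
  move=> t; rewrite normrM mulrAC; apply: ler_pM => //.
  apply: le_trans (ler_normD _ _) _; rewrite mulrDl.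
  have hs : 0 <= \sum_i `|b i| by rewrite sumr_ge0.
  have := qform_bound b t; have := mulr_ge0 (normr_ge0 v) (q1 t); nra.
have ib (u : R -> R) (C : R) : continuous u -> (forall x, `|u x| <= C) ->
    (gaussn R n).-integrable setT (EFin \o (fun t => u (qform al t - k))).
  by move=> cu ub; apply: (gaussn_bounded_integrable (mQ u cu)) => t; exact: ub.
have icn (v : R) : (gaussn R n).-integrable setT (EFin \o (fun _ => v)).
  by apply: (@gaussn_bounded_integrable _ _ _ `|v|) => //; exact: measurable_cst.
have Icst v : I (fun=> v) = v.
  by apply: EFin_inj; rewrite EFin_Rintegral// gaussn_cst.
have iF := ib F C0 cF Fb; have iF' := ib F' C0 cF' F'b.
have iqF := il al (- \sum_i al i) F cF Fb.
have iqF' := il al2 0 F' cF' F'b.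
have i2q : (gaussn R n).-integrable setT (EFin \o (fun t => 2 * ((qform al2 t + 0) * F' (qform al t - k)))).
  apply: eq_integrable (il (fun i => 2 * al2 i) 0 F' cF' F'b) => // t _ /=.
  congr EFin; rewrite !addr0 mulrA /qform mulr_sumr; congr (_ * _).
  by apply: eq_bigr => i _; rewrite mulrA.
have stein : I (fun t => (qform al t - \sum_i al i) * F (qform al t - k)) =
    I (fun t => 2 * ((qform al2 t + 0) * F' (qform al t - k))).
  apply: EFin_inj; rewrite [LHS]EFin_Rintegral// [RHS]EFin_Rintegral//.
    rewrite (@gaussn_stein _ _ al (- k) C0 F F' dF cF' Fb F'b).
    by apply: eq_integral => t _; rewrite addr0 mulrA.
set m := \sum_i al i - k.
have ig := ib g 1 cg gab.
pose Y t := 2 - 2 * qform al2 t.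
have iYF : (gaussn R n).-integrable setT (EFin \o (fun t => Y t * F' (qform al t - k))).
  apply: eq_integrable (il (fun i => - 2 * al2 i) 2 F' cF' F'b) => // t _ /=.
  congr (_ * _)%:E; rewrite /Y addrC /qform mulr_sumr -sumrN; congr (_ + _).
  by apply: eq_bigr => i _; ring.
have imF : (gaussn R n).-integrable setT (EFin \o (fun t => m * F (qform al t - k))).
  by apply: eq_integrable (il (fun=> 0) m F cF Fb) => // t _ /=; rewrite /qform big1 ?add0r// => i _; rewrite mul0r.
(* In Stein's equation at [Q - k], the identity [stein] trades [(Q - sum_i al_i) F] for [2 Q2 F'],
   where [Q2] has the squared weights; what remains is [(2 - 2 Q2) F'] and the mean defect times
   [F]. *)
have E : I (fun t => g (qform al t - k)) - N =
    I (fun t => Y t * F' (qform al t - k)) - I (fun t => m * F (qform al t - k)).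
  have i2F : (gaussn R n).-integrable setT (EFin \o (fun t => 2 * F' (qform al t - k))).
    by apply: (ib (fun x => 2 * F' x) 2) => [x|x]; [apply: cvgM; [exact: cvg_cst|exact: cF']|rewrite normrM ger0_norm// ler_piMr].
  have -> : I (fun t => Y t * F' (qform al t - k)) =
      I (fun t => 2 * F' (qform al t - k)) - I (fun t => (qform al t - \sum_i al i) * F (qform al t - k)).
    rewrite stein -RintegralB//; apply: eq_Rintegral => t _; rewrite /Y; ring.
  have i2B := integrableB measurableT i2F iqF.
  rewrite -RintegralB// -RintegralB// -[X in _ - X]Icst -RintegralB//.
  apply: eq_Rintegral => t _; rewrite SE /m.
  by move: (F' _) (F _) => A B; ring.
rewrite -/N -/(I _) E; apply: le_trans (ler_normB _ _) _; rewrite addrC lerD//.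
  apply: le_trans (le_normr_Rintegral measurableT imF) _.
  rewrite -[leRHS]Icst; apply: le_Rintegral => //.
  - by apply: eq_integrable (integrable_abse imF) => // t _ /=.
  - by move=> t _; rewrite normrM mulrC ler_wpM2r.
apply: le_trans (le_normr_Rintegral measurableT iYF) _.
have var : (\int[gaussn R n]_t ((qform al2 t - 1) ^+ 2)%:E =
    (2 * \sum_i al i ^+ 4 + (\sum_i al i ^+ 2 - 1) ^+ 2)%:E)%E.
  transitivity (\int[gaussn R n]_t ((qform al2 t - \sum_i al2 i + (\sum_i al i ^+ 2 - 1)) ^+ 2)%:E)%E.
    by apply: eq_integral => t _; congr (_ ^+ 2)%:E; rewrite /al2; ring.
  rewrite gaussn_var; congr (2 * _ + _)%:E.
  by apply: eq_bigr => i _; rewrite /al2 -exprM.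
set V := 2 * _ + _ in var hd.
rewrite -lee_fin EFin_Rintegral; last by apply: eq_integrable (integrable_abse iYF) => // t _ /=.
have mY : measurable_fun setT (fun t : T n => (qform al2 t - 1) ^+ 2 : R).
  by apply: measurable_funX; apply: measurable_funB.
(* [|Y| <= Y^2 / (2 delta) + delta / 2] for [Y = 2 - 2 Q2] replaces the Cauchy-Schwarz inequality,
   as the mean of [Y^2] is at most [delta^2]. *)
apply: (@le_trans _ _ (\int[gaussn R n]_t ((2 / delta)%:E * ((qform al2 t - 1) ^+ 2)%:E + (delta / 2)%:E))%E).
  apply: ge0_le_integral => //.
  - by apply: measurable_int; apply: eq_integrable (integrable_abse iYF) => // t _ /=.
  - under eq_fun do rewrite -EFinM -EFinD.
    by apply/measurable_EFinP; apply: measurable_funD => //; exact: measurable_funM.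
  - move=> t _; rewrite -EFinM -EFinD lee_fin normrM.
    apply: (@le_trans _ _ `|Y t|); first by rewrite ler_piMr.
    have := sqr_ge0 (`|Y t| - delta); rewrite sqrrB real_normK ?num_real// => h.
    rewrite -(ler_pM2r d0) mulrDl mulrAC divfK ?gt_eqF//.
    have -> : Y t = - 2 * (qform al2 t - 1) by rewrite /Y; ring.
    move: h; rewrite /Y; set q := qform al2 t; set w := `|_|; move=> h.
    have -> : `|- 2 * (q - 1)| = w by rewrite /w; congr `|_|; ring.
    by move: h; rewrite -mulr_natr; nra.
rewrite ge0_integralD//; first last.
- by move=> t _; rewrite lee_fin divr_ge0// ltW.
- by under eq_fun do rewrite -EFinM; apply/measurable_EFinP; exact: measurable_funM.
- by move=> t _; rewrite -EFinM lee_fin mulr_ge0 ?sqr_ge0// divr_ge0// ltW.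
rewrite ge0_integralZl//; first last.
- by rewrite lee_fin divr_ge0// ltW.
- by move=> t _; rewrite lee_fin sqr_ge0.
- exact/measurable_EFinP.
rewrite gaussn_cst var -EFinM -EFinD lee_fin -(ler_pM2r d0) mulrDl mulrAC divfK ?gt_eqF//.
nra.
Qed.

End stein_bound.

(** * Exponential tilting of quadratic forms *)

Section gauss_change_of_variables.
Context {R : realType}.
Notation mu := (@lebesgue_measure R).

Lemma lebesgue_affine (G : R -> R) (m s : R) : 0 < s -> continuous G ->
  (forall x, 0 <= G x) ->
  (\int[mu]_x (G x)%:E = \int[mu]_x (G (m + s * x) * s)%:E)%E.
Proof.
move=> s0 cG G0.
have dr (x : R) : is_derive x 1 (fun y : R => m + s * y) s.
  by apply: is_derive_eq; rewrite /GRing.scale/=; ring.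
have dr1 : (fun y : R => m + s * y)^`()%classic = cst s.
  by apply/funext => x; rewrite derive1E derive_val.
have := @increasing_ge0_integration_by_substitutionT R (fun y => m + s * y) G.
rewrite dr1; apply => //.
- by move=> x y xy; rewrite ltrD2l ltr_pM2l.
- by move=> x; exact: cvg_cst.
- exact: is_cvg_cst.
- exact: is_cvg_cst.
- rewrite (_ : (fun x => m + s * x) = (fun x => s * (x + m / s))); last first.
    by apply/funext => x; rewrite mulrDr (mulrC s (m / s)) divfK ?gt_eqF// addrC.
  by apply: gt0_cvgMrNy => //; exact: cvg_addrr_Ny.
- rewrite (_ : (fun x => m + s * x) = (fun x => s * (x + m / s))); last first.
    by apply/funext => x; rewrite mulrDr (mulrC s (m / s)) divfK ?gt_eqF// addrC.
  by apply: gt0_cvgMry => //; exact: cvg_addrr.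
Qed.

(** The law depends on [s] through [s^2] only; taking [|s|] makes the substitution increasing. *)
Lemma ge0_integral_normal_gauss (g : R -> R) (m s : R) : s != 0 ->
  continuous g -> (forall x, 0 <= g x) ->
  (\int[normal_prob m s]_x (g x)%:E = \int[gauss R]_x (g (m + `|s| * x))%:E)%E.
Proof.
move=> s0 cg g0.
have s0' : 0 < `|s| by rewrite normr_gt0.
have cgm : continuous (fun x : R => g (m + `|s| * x)).
  move=> x; apply: (@continuous_comp _ _ _ (fun x : R => m + `|s| * x) g); last exact: cg.
  by apply: cvgD; [exact: cvg_cst|apply: cvgM; [exact: cvg_cst|exact: cvg_id]].
rewrite ge0_integral_normal_prob; first last.
- by apply/measurable_EFinP; exact: continuous_measurable_fun.
- by move=> x; rewrite lee_fin.
rewrite ge0_integral_gauss; first last.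
- by apply/measurable_EFinP; exact: continuous_measurable_fun.
- by move=> x; rewrite lee_fin.
have cG : continuous (fun x => g x * normal_pdf m s x).
  by move=> x; apply: cvgM; [exact: cg|exact: continuous_normal_pdf].
transitivity (\int[mu]_x (g x * normal_pdf m s x)%:E)%E.
  by apply: eq_integral => x _; rewrite EFinM.
rewrite (lebesgue_affine m s0' cG) => [|x]; last by rewrite mulr_ge0// normal_pdf_ge0.
apply: eq_integral => x _; rewrite -EFinM; congr EFin.
rewrite -mulrA; congr (_ * _); rewrite !normal_pdfE ?oner_neq0// /normal_fun.
rewrite subr0 [m + _]addrC addrK exprMn real_normK ?num_real// mulrAC.
congr (_ * expR _); last first.
  rewrite expr1n -mulr_natr -[in RHS]mulr_natr mul1r -mulrN invfM mulrACA divff ?mul1r//.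
  by rewrite sqrf_eq0.
rewrite /normal_peak expr1n -mulrnAr sqrtrM ?sqr_ge0// sqrtr_sqr invfM mulrAC.
by rewrite mulVf ?mul1r ?normr_eq0// mul1r.
Qed.

(* Tilting the law N(0, 2) by [exp (z x / 2)] translates it by [z]. *)
Lemma gauss2_tilt (g : R -> R) (z : R) : continuous g -> (forall x, 0 <= g x) ->
  (\int[gauss R]_x (g (Num.sqrt 2 * x - z) * expR (z / 2 * (Num.sqrt 2 * x - z)))%:E =
   (expR (- (z ^+ 2 / 4)))%:E * \int[gauss R]_x (g (Num.sqrt 2 * x))%:E)%E.
Proof.
move=> cg g0; set s : R := Num.sqrt 2.
have s0 : 0 < s by rewrite sqrtr_gt0.
have s2 : s ^+ 2 = 2 by rewrite sqr_sqrtr.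
have caff (c b : R) : continuous (fun x : R => c * x - b).
  by move=> x; apply: cvgB; [apply: cvgM; [exact: cvg_cst|exact: cvg_id]|exact: cvg_cst].
have cgs b : continuous (fun x : R => g (s * x - b)).
  by move=> x; apply: (@continuous_comp _ _ _ (fun x : R => s * x - b) g); [exact: caff|exact: cg].
have cE : continuous (fun x : R => expR (z / 2 * (s * x - z))).
  move=> x; apply: (@continuous_comp _ _ _ (fun x : R => z / 2 * (s * x - z)) expR); last exact: continuous_expR.
  by apply: cvgM; [exact: cvg_cst|exact: caff].
have cgs0 : continuous (fun x : R => g (s * x)).
  by have := cgs 0; under eq_fun do rewrite subr0.
have cm : continuous (fun x : R => g (s * x - z) * expR (z / 2 * (s * x - z))).
  by move=> x; apply: cvgM; [exact: cgs|exact: cE].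
rewrite ge0_integral_gauss; first last.
- by apply/measurable_EFinP; exact: continuous_measurable_fun.
- by move=> x; rewrite lee_fin mulr_ge0// expR_ge0.
rewrite ge0_integral_gauss; first last.
- by apply/measurable_EFinP; exact: continuous_measurable_fun.
- by move=> x; rewrite lee_fin.
have mgp : measurable_fun setT (fun x : R => ((g (s * x))%:E * (normal_pdf 0 1 x)%:E)%E).
  apply: emeasurable_funM; first by apply/measurable_EFinP; exact: continuous_measurable_fun.
  by apply/measurable_EFinP; exact: measurable_normal_pdf.
rewrite -ge0_integralZl//; first last.
- by move=> x _; rewrite mule_ge0// lee_fin// normal_pdf_ge0.
have cG : continuous (fun x => g (s * x - z) * expR (z / 2 * (s * x - z)) * normal_pdf 0 1 x).
  by move=> x; apply: cvgM; [exact: cm|exact: continuous_normal_pdf].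
transitivity (\int[mu]_x (g (s * x - z) * expR (z / 2 * (s * x - z)) * normal_pdf 0 1 x)%:E)%E.
  by apply: eq_integral => x _; rewrite -EFinM.
rewrite (lebesgue_affine (z / s) ltr01 cG) => [|x]; last by rewrite mulr_ge0 ?normal_pdf_ge0// mulr_ge0// expR_ge0.
apply: eq_integral => x _; rewrite -!EFinM; congr EFin.
have -> : s * (z / s + 1 * x) - z = s * x by field; rewrite gt_eqF.
rewrite mulr1 mul1r !normal_pdfE ?oner_neq0// /normal_fun !subr0 expr1n.
set A := g _; set p := normal_peak _.
have E : expR (z / 2 * (s * x)) * expR (- (z / s + x) ^+ 2 / 2) =
    expR (- (z ^+ 2 / 4)) * expR (- x ^+ 2 / 2).
  rewrite -!expRD; congr expR.
  have -> : (z / s + x) ^+ 2 = z ^+ 2 / 2 + z * s * x + x ^+ 2.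
    have e : z / s = z * s / 2 by rewrite -s2; field; rewrite gt_eqF.
    have e' : (z / s) ^+ 2 = z ^+ 2 / 2 by rewrite exprMn exprVn s2.
    by rewrite sqrrD e' e; field.
  by field.
by rewrite mulrACA E mulrCA -(mulrA A).
Qed.

End gauss_change_of_variables.

Section log_laplace.
Context {R : realType}.
Implicit Types x h mu : R.

Let itv_lt (u v y : R) : y \in `]u, v[ -> y < v.
Proof. by rewrite in_itv/= => /andP[]. Qed.

Let dphi x : x < 1 ->
  is_derive x 1 (fun x => - ln (1 - x) - x - x ^+ 2 / 2) (x ^+ 2 / (1 - x)).
Proof.
move=> x1; have x1' : 0 < 1 - x by rewrite subr_gt0.
have d1 : is_derive x 1 (fun x : R => 1 - x) (- 1).
  by apply: is_derive_eq; ring.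
have d2 := @is_derive1_comp _ (@ln R) (fun x : R => 1 - x) x _ _ (is_derive1_ln x1') d1.
have d2' : is_derive x 1 (fun x : R => ln (1 - x)) (- (1 - x)^-1).
  by apply: is_derive_eq d2 _; rewrite mulrN1.
have d3 : is_derive x 1 (fun x : R => x ^+ 2 / 2) x.
  by apply: is_derive_eq; rewrite /GRing.scale/=; field.
by apply: is_derive_eq; field; rewrite gt_eqF.
Qed.

(** The remainder vanishes at [0] and has derivative [y^2 / (1 - y)], at most [2 y^2] on
    [[- 1/2, 1/2]]; the mean value theorem concludes. *)
Lemma ln_taylor3 x : `|x| <= 2^-1 -> `|- ln (1 - x) - x - x ^+ 2 / 2| <= 2 * `|x| ^+ 3.
Proof.
move=> hx; pose f x := - ln (1 - x) - x - x ^+ 2 / 2 : R.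
have f0 : f 0 = 0 by rewrite /f expr0n/= mul0r !subr0 ln1 ?subrr oppr0 ?subrr.
have cf (u v : R) : v < 1 -> {within `[u, v], continuous f}.
  move=> v1; apply: derivable_within_continuous => y; rewrite in_itv/= => /andP[_ yv].
  by case: (dphi (le_lt_trans yv v1)).
have bnd y : `|y| <= `|x| -> `|y ^+ 2 / (1 - y)| <= 2 * `|x| ^+ 2.
  move=> yx; have y2 : `|y| <= 2^-1 by exact: le_trans hx.
  have y1 : 2^-1 <= 1 - y by move: y2; rewrite ler_norml; lra.
  rewrite normrM normrX normfV (ger0_norm (_ : 0 <= 1 - y)); last by lra.
  rewrite ler_pdivrMr; last by lra.
  have : `|y| ^+ 2 <= `|x| ^+ 2 by rewrite lerXn2r ?nnegrE.
  have := sqr_ge0 `|x|; nra.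
have x12 : x < 1 by move: hx; rewrite ler_norml; lra.
rewrite -/(f x) exprS mulrCA.
have [x0|x0|->] := ltgtP x 0.
- have [c] := @MVT _ f (fun y => y ^+ 2 / (1 - y)) x 0 x0 (fun y yi => dphi (lt_trans (itv_lt yi) ltr01)) (cf _ _ ltr01).
  rewrite in_itv/= => /andP[xc c0]; rewrite f0 !sub0r => /(congr1 (@Num.norm _ _)).
  rewrite normrN normrM normrN mulrC => ->; rewrite ler_wpM2l//; apply: bnd.
  by rewrite !ltr0_norm// lerN2 ltW.
- have [c] := @MVT _ f (fun y => y ^+ 2 / (1 - y)) 0 x x0 (fun y yi => dphi (lt_trans (itv_lt yi) x12)) (cf _ _ x12).
  rewrite in_itv/= => /andP[c0 cx]; rewrite f0 !subr0 => ->.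
  rewrite normrM mulrC ler_wpM2l//; apply: bnd.
  by rewrite !gtr0_norm// ltW.
- by rewrite f0 normr0 mul0r.
Qed.

(** For [x <= 0] the left side is at most [x^2 / 2], the remainder of [ln_taylor3] being
    nondecreasing. For [x > 0] it is at most [x^2 / (2 (1 - x))], since the difference has
    derivative [u^2 / (2 (1 - u)^2)]. *)
Lemma ln_le (x y : R) : `|x| <= y -> y < 1 -> - ln (1 - x) - x <= x ^+ 2 / (2 * (1 - y)).
Proof.
move=> xy y1.
have y0 : 0 <= y := le_trans (normr_ge0 _) xy.
have y1' : 0 < 1 - y by rewrite subr_gt0.
have [x0|x0] := leP x 0.
  pose f x := - ln (1 - x) - x - x ^+ 2 / 2 : R.
  have f0 : f 0 = 0 by rewrite /f expr0n/= mul0r !subr0 ln1 ?subrr oppr0 ?subrr.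
  have : f x <= 0.
    move: x0; rewrite le_eqVlt => /predU1P[->|x0]; first by rewrite f0.
    have cf : {within `[x, 0], continuous f}.
      apply: derivable_within_continuous => u; rewrite in_itv/= => /andP[_ yv].
      by case: (dphi (le_lt_trans yv ltr01)).
    have [c] := @MVT _ f (fun y => y ^+ 2 / (1 - y)) x 0 x0 (fun y yi => dphi (lt_trans (itv_lt yi) ltr01)) cf.
    rewrite in_itv/= => /andP[xc c0]; rewrite f0 !sub0r => e.
    rewrite -oppr_ge0 e mulr_ge0 ?oppr_ge0 ?(ltW x0)// divr_ge0 ?sqr_ge0//.
    by rewrite subr_ge0 (le_trans (ltW c0)).
  rewrite /f subr_le0 => /le_trans; apply.
  by rewrite ler_wpM2l ?sqr_ge0// lef_pV2 ?posrE ?mulr_gt0//; lra.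
have x1 : x < 1 by apply: le_lt_trans y1; rewrite (le_trans (ler_norm _)).
have xy' : x <= y by rewrite (le_trans (ler_norm _)).
apply: (@le_trans _ _ (x ^+ 2 / (2 * (1 - x)))); last first.
  by rewrite ler_wpM2l ?sqr_ge0// lef_pV2 ?posrE ?mulr_gt0//; lra.
pose f x := x ^+ 2 / (2 * (1 - x)) - (- ln (1 - x) - x) : R.
have df (u : R) : u < 1 -> is_derive u 1 f (u ^+ 2 / (2 * (1 - u) ^+ 2)).
  move=> u1; have u1' : 0 < 1 - u by rewrite subr_gt0.
  have d1 : is_derive u 1 (fun x : R => 1 - x) (- 1).
    by apply: is_derive_eq; ring.
  have d2 := @is_derive1_comp _ (@ln R) (fun x : R => 1 - x) u _ _ (is_derive1_ln u1') d1.
  have d2' : is_derive u 1 (fun x : R => ln (1 - x)) (- (1 - u)^-1).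
    by apply: is_derive_eq d2 _; rewrite mulrN1.
  have d3 : is_derive u 1 (fun x : R => 2 * (1 - x)) (- 2).
    by apply: is_derive_eq; rewrite /GRing.scale/=; ring.
  have nz : 2 * (1 - u) != 0 by rewrite gt_eqF// mulr_gt0.
  have d4 := @is_deriveV R (fun x : R => 2 * (1 - x)) u (- 2) 1 nz d3.
  have d5 : is_derive u 1 (fun x : R => x ^+ 2) (2 * u).
    by apply: is_derive_eq; rewrite /GRing.scale/=; ring.
  have d6 := is_deriveM d5 d4.
  have d7 : is_derive u 1 (fun x : R => - ln (1 - x) - x) ((1 - u)^-1 - 1).
    by apply: is_derive_eq; rewrite opprK.
  have d8 := is_deriveB d6 d7.
  by apply: is_derive_eq d8 _; rewrite /GRing.scale/=; field; rewrite gt_eqF.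
have f0 : f 0 = 0 by rewrite /f expr0n/= mul0r !subr0 ln1 ?subrr oppr0 ?subrr.
have cf : {within `[0, x], continuous f}.
  apply: derivable_within_continuous => u; rewrite in_itv/= => /andP[_ yv].
  by case: (df _ (le_lt_trans yv x1)).
have [c] := @MVT _ f (fun y => y ^+ 2 / (2 * (1 - y) ^+ 2)) 0 x x0 (fun y yi => df _ (lt_trans (itv_lt yi) x1)) cf.
rewrite in_itv/= => /andP[c0 cx]; rewrite f0 !subr0 => e.
rewrite -subr_ge0 -/(f x) e mulr_ge0 ?(ltW x0)// divr_ge0 ?sqr_ge0//.
by rewrite mulr_ge0// sqr_ge0.
Qed.

End log_laplace.

Section tilted_chaos.
Context {R : realType}.
Local Notation T n := (n.-tuple (measurableTypeR R)).

(** The logarithm of the mean of [exp (h sum_i a_i (xi_i^2 - 1))] for independent standard Gaussian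
    [xi_i], as long as all [2 h a_i < 1]. *)
Definition log_laplace n (a : 'I_n -> R) (h : R) : R :=
  \sum_i (- ln (1 - 2 * h * a i) / 2 - h * a i).

(** The tilted law is again that of a quadratic form, with weights [a_i / (1 - 2 h a_i)]. The
    centring stays that of the original form, so the new one is off centre: this is the purpose of
    the tilt. *)
Lemma tilt_identity n (a : 'I_n -> R) (h : R) (g : R -> R) :
  continuous g -> (forall x, 0 <= g x) -> (forall i, 2 * h * a i < 1) ->
  (\int[gaussn R n]_t (g (qform a t - \sum_i a i) * expR (h * (qform a t - \sum_i a i)))%:E =
   (expR (log_laplace a h))%:E *
   \int[gaussn R n]_t (g (qform (fun i => a i / (1 - 2 * h * a i)) t - \sum_i a i))%:E)%E.
Proof.
move=> cg g0 ha; set A := \sum_i a i.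
have ha' i : 0 < 1 - 2 * h * a i by rewrite subr_gt0.
pose r i := expR (- ln (1 - 2 * h * a i) / 2).
have r2 i : r i ^+ 2 = (1 - 2 * h * a i)^-1.
  by rewrite /r -expRM_natl mulrC divfK// expRN lnK// posrE.
have cg' : continuous (fun y => g y * expR (- (h * A))).
  by move=> y; apply: cvgM; [exact: cg|exact: cvg_cst].
have H := @gaussn_tilt R n a r h (- A) (fun y => g y * expR (- (h * A))) cg' _ _ _.
rewrite (_ : (\int[_]_t _)%E = \int[gaussn R n]_t (g (qform a t - A) * expR (- (h * A)) * expR (h * qform a t))%:E)%E; last first.
  apply: eq_integral => t _; congr EFin; rewrite -mulrA -expRD; congr (_ * expR _); ring.
rewrite {}H; first last.
- by move=> i; rewrite r2 mulVf// gt_eqF.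
- by move=> i; exact: expR_gt0.
- by move=> x; rewrite mulr_ge0// expR_ge0.
under eq_integral do rewrite EFinM.
rewrite ge0_integralZr//; first last.
- by move=> t _; rewrite lee_fin.
- apply/measurable_EFinP; apply: measurableT_comp; first exact: continuous_measurable_fun.
  by apply: measurable_funB => //; exact: measurable_qform.
rewrite (muleC _ (expR _)%:E) muleA -EFinM; congr (_%:E * _)%E.
  rewrite /r -expR_sum -expRD /log_laplace sumrB; congr expR.
  by rewrite -mulr_sumr.
by apply: eq_integral => t _; congr (g (qform _ _ - _))%:E; apply/funext => i; rewrite r2.
Qed.

Lemma chaos_weight_ge0 n (a : 'I_n -> R) (m : R) :
  \sum_i a i ^+ 2 = 1 -> (forall i, `|a i| <= m) -> 0 <= m.
Proof.
case: n a => [|n] a; first by rewrite big_ord0 => /eqP; rewrite eq_sym oner_eq0.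
by move=> _ am; exact: le_trans (normr_ge0 _) (am ord0).
Qed.

(** Termwise from [ln_le] with [x = 2 h a_i] and [y = 2 h m]; the weights [a_i^2] add up to one,
    which is how the right side becomes a sum. *)
Lemma log_laplace_le n (a : 'I_n -> R) (m h : R) :
  \sum_i a i ^+ 2 = 1 -> (forall i, `|a i| <= m) -> 0 <= h -> 2 * h * m < 1 ->
  log_laplace a h <= h ^+ 2 / (1 - 2 * h * m).
Proof.
move=> a2 am h0 hm.
have one (u : R) : u = (\sum_i a i ^+ 2) * u by rewrite a2 mul1r.
rewrite [leRHS]one mulr_suml /log_laplace ler_sum// => i _.
have hx : `|2 * h * a i| <= 2 * h * m.
  by rewrite normrM ger0_norm ?mulr_ge0// ler_wpM2l// mulr_ge0.
have := ln_le hx hm.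
have -> : (2 * h * a i) ^+ 2 / (2 * (1 - 2 * h * m)) = 2 * (a i ^+ 2 * (h ^+ 2 / (1 - 2 * h * m))).
  by field; rewrite gt_eqF// subr_gt0.
lra.
Qed.

Lemma log_laplace_taylor n (a : 'I_n -> R) (m h : R) :
  \sum_i a i ^+ 2 = 1 -> (forall i, `|a i| <= m) -> 0 <= h -> 4 * h * m <= 1 ->
  `|log_laplace a h - h ^+ 2| <= 8 * h ^+ 3 * m.
Proof.
move=> a2 am h0 hm.
have -> : h ^+ 2 = \sum_i h ^+ 2 * a i ^+ 2 by rewrite -mulr_sumr a2 mulr1.
rewrite /log_laplace -sumrB; apply: le_trans (ler_norm_sum _ _ _) _.
have one (u : R) : u = (\sum_i a i ^+ 2) * u by rewrite a2 mul1r.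
rewrite [leRHS]one mulr_suml ler_sum// => i _.
have hx : `|2 * h * a i| <= 2^-1.
  rewrite normrM ger0_norm ?mulr_ge0//.
  have := ler_wpM2l (mulr_ge0 (ler0n R 2) h0) (am i); lra.
have := ln_taylor3 hx.
have -> : `|2 * h * a i| ^+ 3 = 8 * h ^+ 3 * (`|a i| * a i ^+ 2).
  rewrite normrM ger0_norm ?mulr_ge0// -[a i ^+ 2]real_normK ?num_real//; ring.
set L := ln _ => H.
have -> : - L / 2 - h * a i - h ^+ 2 * a i ^+ 2 = (- L - 2 * h * a i - (2 * h * a i) ^+ 2 / 2) / 2.
  by field.
rewrite normrM (ger0_norm (_ : 0 <= 2^-1)) ?invr_ge0//.
have h3 : 0 <= 8 * h ^+ 3 by rewrite mulr_ge0// exprn_ge0.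
have := ler_wpM2l h3 (ler_wpM2r (sqr_ge0 (a i)) (am i)).
set W := `|_| in H *; lra.
Qed.

(** The tilt [h = z / 2] has normalisation [exp (z^2 / 4 + l)], and the recentring at [z]
    contributes [exp (- z^2 / 2)]. Under the tilted law the form minus [z] has mean, variance defect
    and fourth powers controlled by [m], so [stein_bound] applies. The error [r] ends up inside the
    product with [exp (- z^2 / 4)]. *)
Lemma tilted_stein n (a : 'I_n -> R) (m z : R) (g : R -> R) :
  \sum_i a i ^+ 2 = 1 -> (forall i, `|a i| <= m) -> 0 < m -> 0 <= z ->
  2 * z * m <= 1 -> continuous g -> (forall x, 0 <= g x <= 1) ->
  exists l r, [/\ `|l| <= z ^+ 3 * m,
    `|r| <= (12 + 2 * stein_const) * m * (1 + z) ^+ 2 &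
    (\int[gaussn R n]_t (g (qform a t - \sum_i a i - z) *
        expR (z / 2 * (qform a t - \sum_i a i - z)))%:E =
     (expR (- (z ^+ 2 / 4) + l) * (\int[gauss R]_x g (Num.sqrt 2 * x) + r))%:E)%E].
Proof.
move=> a2 am m0 z0 zm cg g01.
set A := \sum_i a i.
have hx i : `|z * a i| <= 2^-1.
  rewrite normrM ger0_norm//; have := ler_wpM2l z0 (am i); lra.
have zai i : z * a i <= 2^-1 by apply: le_trans (hx i); exact: ler_norm.
have h2 : 2 * (z / 2) = z by field.
pose c i := (1 - z * a i)^-1.
have d0 i : 2^-1 <= 1 - z * a i by have := zai i; lra.
have d0' i : 0 < 1 - z * a i by have := d0 i; lra.
have c0 i : 0 < c i by rewrite invr_gt0.
have c2 i : c i <= 2.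
  by rewrite /c -[leRHS]invrK lef_pV2 ?posrE ?invr_gt0// d0.
have cE i : c i - 1 = z * a i * c i by rewrite /c; field; rewrite gt_eqF.
have c1 i : `|c i - 1| <= 2 * z * m.
  rewrite cE normrM (gtr0_norm (c0 i)) normrM (ger0_norm z0).
  have := ler_pM (mulr_ge0 z0 (normr_ge0 (a i))) (ltW (c0 i)) (ler_wpM2l z0 (am i)) (c2 i); lra.
pose al i := a i * c i.
pose G y := g (y - z) * expR (- (z / 2 * z)).
have cgz : continuous (fun y => g (y - z)).
  move=> y; apply: (@continuous_comp _ _ _ (fun y : R => y - z) g); last exact: cg.
  by apply: cvgB; [exact: cvg_id|exact: cvg_cst].
have cG : continuous G by move=> y; apply: cvgM; [exact: cgz|exact: cvg_cst].
have g0 x : 0 <= g x by case/andP: (g01 x).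
have G0 y : 0 <= G y by rewrite mulr_ge0// expR_ge0.
have hti i : 2 * (z / 2) * a i < 1 by rewrite h2; have := d0 i; lra.
have TI := tilt_identity cG G0 hti.
exists (log_laplace a (z / 2) - (z / 2) ^+ 2).
exists (\int[gaussn R n]_t g (qform al t - (A + z)) - \int[gauss R]_x g (Num.sqrt 2 * x)).
have hz : 0 <= z / 2 by rewrite divr_ge0.
split.
- have := @log_laplace_taylor n a m (z / 2) a2 am hz; rewrite (_ : 4 * (z / 2) * m = 2 * z * m); last by field.
  by move=> /(_ zm) /le_trans; apply; rewrite le_eqVlt; apply/orP; left; apply/eqP; field.
- have a2i i : 0 <= a i ^+ 2 by exact: sqr_ge0.
  have wsum (u : 'I_n -> R) (B : R) : (forall i, `|u i| <= B) -> `|\sum_i a i ^+ 2 * u i| <= B.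
    move=> uB; apply: le_trans (ler_norm_sum _ _ _) _.
    have one (v : R) : v = (\sum_i a i ^+ 2) * v by rewrite a2 mul1r.
    rewrite [leRHS]one mulr_suml ler_sum// => i _.
    by rewrite normrM ger0_norm// ler_wpM2l.
  (* The tilt moves the mean by [sum_i a_i (c_i - 1) = z sum_i a_i^2 c_i], which is [z] to first
     order because [sum_i a_i^2 = 1]: hence the choice [h = z / 2]. *)
  have e1 : \sum_i al i - (A + z) = z * \sum_i a i ^+ 2 * (c i - 1).
    have ez : z = \sum_i z * a i ^+ 2 by rewrite -mulr_sumr a2 mulr1.
    rewrite opprD addrA -sumrB [X in _ - X]ez mulr_sumr -sumrB.
    apply: eq_bigr => i _; rewrite /al; have := cE i; move: (c i) => ci e.
    have e' : a i * (ci - 1) = z * a i ^+ 2 * ci by rewrite e; ring.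
    have -> : a i * ci - a i = a i * (ci - 1) by ring.
    by rewrite e'; ring.
  have e2 : \sum_i al i ^+ 2 - 1 = \sum_i a i ^+ 2 * (c i ^+ 2 - 1).
    have -> : \sum_i al i ^+ 2 - 1 = \sum_i al i ^+ 2 - \sum_i a i ^+ 2 by rewrite a2.
    by rewrite -sumrB; apply: eq_bigr => i _; rewrite /al; ring.
  have zm0 : 0 <= z * m by rewrite mulr_ge0// ltW.
  have b1 : `|\sum_i al i - (A + z)| <= 2 * z ^+ 2 * m.
    rewrite e1 normrM (ger0_norm z0).
    have := ler_wpM2l z0 (wsum _ _ c1); lra.
  have b2 : `|\sum_i al i ^+ 2 - 1| <= 6 * z * m.
    rewrite e2; apply: wsum => i.
    have -> : c i ^+ 2 - 1 = (c i - 1) * (c i + 1) by ring.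
    rewrite normrM (ger0_norm (_ : 0 <= c i + 1)); last by have := c0 i; lra.
    have h3 : c i + 1 <= 3 by have := c2 i; lra.
    have h4 : 0 <= c i + 1 by have := c0 i; lra.
    have := ler_pM (normr_ge0 _) h4 (c1 i) h3; lra.
  have b3 : \sum_i al i ^+ 4 <= 16 * m ^+ 2.
    have -> : \sum_i al i ^+ 4 = \sum_i a i ^+ 2 * (a i ^+ 2 * c i ^+ 4).
      by apply: eq_bigr => i _; rewrite /al; ring.
    apply: le_trans (ler_norm _) _; apply: wsum => i.
    rewrite ger0_norm; last by rewrite mulr_ge0// exprn_ge0// ltW.
    rewrite mulrC; apply: ler_pM => //; first by rewrite exprn_ge0// ltW.
      have -> : 16 = 2 ^+ 4 :> R by ring.
      by rewrite lerXn2r ?nnegrE// ltW.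
    apply: (@le_trans _ _ (`|a i| ^+ 2)); first by rewrite real_normK ?num_real.
    by rewrite lerXn2r ?nnegrE// ltW.
  (* By [b2] and [b3] the quantity to dominate is at most [128 m^2 + 144 z^2 m^2], and [12^2 = 144]
     covers both terms. *)
  pose delta := 12 * m * (1 + z).
  have d1 : 0 < delta by rewrite !mulr_gt0// ltr_wpDr.
  have hd : 4 * (2 * \sum_i al i ^+ 4 + (\sum_i al i ^+ 2 - 1) ^+ 2) <= delta ^+ 2.
    have b2' : (\sum_i al i ^+ 2 - 1) ^+ 2 <= (6 * z * m) ^+ 2.
      by rewrite -[leLHS]real_normK ?num_real// lerXn2r ?nnegrE// -mulrA mulr_ge0.
    have -> : delta ^+ 2 = 144 * m ^+ 2 + 288 * (m * (z * m)) + 4 * (6 * z * m) ^+ 2.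
      by rewrite /delta; ring.
    have := sqr_ge0 m; have := mulr_ge0 (ltW m0) zm0; lra.
  apply: le_trans (stein_bound (A + z) cg g01 d1 hd) _.
  have C1 : 1 <= stein_const :> R := stein_const_ge1.
  have := ler_wpM2l (le_trans ler01 C1) b1.
  have mC : 0 <= m * (stein_const - 1) by rewrite mulr_ge0 ?subr_ge0// ltW.
  rewrite /delta; set S := `|_| => hS.
  have -> : (12 + 2 * stein_const) * m * (1 + z) ^+ 2 =
    stein_const * (2 * z ^+ 2 * m) + 12 * m * (1 + z) + 12 * (z * m) + 12 * (z ^+ 2 * m) +
    2 * stein_const * m + 4 * stein_const * (z * m) by ring.
  have h5 : 0 <= z ^+ 2 * m by rewrite mulr_ge0 ?sqr_ge0// ltW.
  have h6 : 0 <= stein_const * m by rewrite mulr_ge0 ?(le_trans ler01 C1)// ltW.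
  have h7 : 0 <= stein_const * (z * m) by rewrite mulr_ge0 ?(le_trans ler01 C1).
  lra.
rewrite [LHS](_ : _ = \int[gaussn R n]_t (G (qform a t - A) * expR (z / 2 * (qform a t - A)))%:E)%E; last first.
  apply: eq_integral => t _; congr EFin; rewrite /G -[RHS]mulrA -expRD; congr (_ * expR _); ring.
rewrite TI /G.
under eq_integral do rewrite h2 EFinM.
have mgq : measurable_fun setT (fun t : T n => g (qform al t - (A + z))).
  apply: measurableT_comp; first exact: continuous_measurable_fun.
  by apply: measurable_funB => //; exact: measurable_qform.
have ig : (gaussn R n).-integrable setT (EFin \o (fun t => g (qform al t - (A + z)))).
  by apply: (@gaussn_bounded_integrable _ _ _ 1) => // t; rewrite ger0_norm//; case/andP: (g01 (qform al t - (A + z))).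
rewrite (_ : (\int[_]_t _)%E = (\int[gaussn R n]_t (g (qform al t - (A + z)))%:E * (expR (- (z / 2 * z)))%:E)%E); last first.
  rewrite -ge0_integralZr//.
  - by apply: eq_integral => t _; rewrite opprD addrA.
  - exact/measurable_EFinP.
  - by move=> t _; rewrite lee_fin.
rewrite -EFin_Rintegral// -!EFinM; congr EFin.
rewrite [X in _ = _ * X]addrC subrK mulrCA -expRD mulrC; congr (expR _ * _).
by field.
Qed.

End tilted_chaos.

(** * Ramp and tent test functions *)

Section ramp.
Context {R : realType}.

(** For [k > 0] a majorant of the indicator of [y >= 0] that decreases to it as [k] grows. Being
    continuous it passes to limits in law, and being Lipschitz it can be approximated by Bernstein
    polynomials at an explicit rate. *)
Definition ramp (k y : R) : R := Num.max 0 (Num.min 1 (k * y + 1)).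

Lemma ramp_ge0 k y : 0 <= ramp k y. Proof. by rewrite le_max lexx. Qed.

Lemma ramp_le1 k y : ramp k y <= 1.
Proof. by rewrite ge_max ler01 ge_min lexx. Qed.

Lemma ramp_itv k y : 0 <= ramp k y <= 1.
Proof. by rewrite ramp_ge0 ramp_le1. Qed.

Lemma ramp1 k y : 0 <= k * y -> ramp k y = 1.
Proof.
move=> h; have h' : 1 <= k * y + 1 by lra.
by rewrite /ramp (min_idPl h') (max_idPr ler01).
Qed.

Lemma ramp0 k y : k * y <= -1 -> ramp k y = 0.
Proof.
move=> h; have h' : k * y + 1 <= 1 by lra.
have h2 : k * y + 1 <= 0 by lra.
by rewrite /ramp (min_idPr h') (max_idPl h2).
Qed.

(** This symmetry carries statements tested on ramps from a variable to its opposite, hence from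
    right tails to left tails. *)
Lemma rampN k y : k != 0 -> ramp k (- y - k^-1) = 1 - ramp k y.
Proof.
move=> k0; rewrite /ramp mulrBr divff// subrK mulrN.
case: (leP 1 (k * y + 1)) => h1.
  rewrite (max_idPr ler01) subrr.
  have h2 : - (k * y) <= 0 by lra.
  have h3 : - (k * y) <= 1 by lra.
  by rewrite (min_idPr h3) (max_idPl h2).
case: (leP (k * y + 1) 0) => h2; first by rewrite subr0 min_l ?(max_idPr ler01)//; lra.
rewrite min_r; last by lra.
by rewrite max_r; lra.
Qed.

Lemma continuous_ramp k : continuous (ramp k).
Proof.
move=> y; apply: (@continuous_max _ _ (fun=> 0) (fun y => Num.min 1 (k * y + 1))); first exact: cvg_cst.
apply: (@continuous_min _ _ (fun=> 1) (fun y => k * y + 1)); first exact: cvg_cst.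
by apply: cvgD; [apply: cvgM; [exact: cvg_cst|exact: cvg_id]|exact: cvg_cst].
Qed.

Lemma measurable_ramp k : measurable_fun setT (ramp k).
Proof. by apply: continuous_measurable_fun; exact: continuous_ramp. Qed.

Lemma ramp_integrable d (U : measurableType d) (P : probability U R) (F : U -> R) k z :
  measurable_fun setT F -> P.-integrable setT (EFin \o (fun w => ramp k (F w - z))).
Proof.
move=> mF; apply: (@le_integrable _ _ _ P setT measurableT _ (cst 1%E)).
- apply/measurable_EFinP; apply: measurableT_comp; first exact: measurable_ramp.
  exact: measurable_funB.
- by move=> w _ /=; rewrite lee_fin ger0_norm ?ramp_ge0// normr1 ramp_le1.
- exact: finite_measure_integrable_cst.
Qed.

Lemma ramp_cvg d (U : measurableType d) (P : probability U R) (F : U -> R) z :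
  measurable_fun setT F ->
  \int[P]_w ramp n.+1%:R (F w - z) @[n --> \oo] --> fine (P [set w | z <= F w]).
Proof.
move=> mF.
have mA : measurable [set w | z <= F w].
  rewrite (_ : [set _ | _] = F @^-1` `[z, +oo[); last first.
    by apply/seteqP; split => w /=; rewrite in_itv/= andbT.
  by rewrite -[X in measurable X]setTI; exact: mF.
have -> : P [set w | z <= F w] = (\int[P]_w (\1_[set w | z <= F w] w)%:E)%E.
  by rewrite integral_indic// setIT.
apply: fine_cvg.
have iA : P.-integrable setT (EFin \o (\1_[set w | z <= F w] : U -> R)).
  apply: (@le_integrable _ _ _ P setT measurableT _ (cst 1%E)) => //.
  - by apply/measurable_EFinP; exact: measurable_indic.
  - by move=> w _ /=; rewrite lee_fin normr1 indicE; case: (_ \in _); rewrite ?normr1 ?normr0.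
  - exact: finite_measure_integrable_cst.
rewrite fineK; last exact: integrable_fin_num.
have [] := @dominated_convergence _ _ _ P setT measurableT (fun n w => (ramp n.+1%:R (F w - z))%:E) (EFin \o (\1_[set w | z <= F w] : U -> R)) (cst 1%E) => //.
- by move=> n; case/integrableP: (ramp_integrable P n.+1%:R z mF).
- by apply/measurable_EFinP; exact: measurable_indic.
- apply/aeW => w _; apply/cvg_EFin; first by near=> n.
  apply: cvg_near_cst; have [zF|Fz] := leP z (F w).
    near=> n; rewrite /= ramp1 ?mulr_ge0 ?subr_ge0// indicE mem_set//.
  near=> n; rewrite /= ramp0; last first.
    have e0 : 0 < z - F w by rewrite subr_gt0.
    have : (z - F w)^-1 <= n.+1%:R.
      apply: le_trans (ltW (archi_boundP _)) _; first by rewrite invr_ge0 ltW.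
      by rewrite ler_nat; apply: leqW; near: n; exact: nbhs_infty_ge.
    move=> h; have : 1 <= n.+1%:R * (z - F w) by rewrite -ler_pdivrMr// div1r.
    lra.
  by rewrite indicE memNset//= => /(lt_le_trans Fz); rewrite ltxx.
- exact: finite_measure_integrable_cst.
- by apply/aeW => w n _ /=; rewrite lee_fin ger0_norm ?ramp_ge0// ramp_le1.
Unshelve. all: by end_near. Qed.

End ramp.

Section gauss_lower.
Context {R : realType}.

Lemma gauss_lower (g : R -> R) (c u v : R) : continuous g -> (forall x, 0 <= g x) ->
  0 <= c -> 0 <= u -> u <= v -> v <= 1 -> (forall x, u <= x <= v -> c <= g x) ->
  ((c * normal_pdf 0 1 1 * (v - u))%:E <= \int[gauss R]_x (g x)%:E)%E.
Proof.
move=> cg g0 c0 u0 uv v1 gc.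
have pd (x : R) : 0 <= x -> x <= 1 -> normal_pdf 0 1 1 <= normal_pdf 0 1 x.
  move=> x0 x1; rewrite !normal_pdfE ?oner_neq0// /normal_fun !subr0 expr1n.
  rewrite ler_wpM2l ?normal_peak_ge0// ler_expR.
  have : x ^+ 2 <= 1 ^+ 2 by rewrite lerXn2r ?nnegrE.
  rewrite expr1n; lra.
have mg : measurable_fun setT (fun x : R => ((g x)%:E * (normal_pdf 0 1 x)%:E)%E).
  apply: emeasurable_funM; first by apply/measurable_EFinP; exact: continuous_measurable_fun.
  by apply/measurable_EFinP; exact: measurable_normal_pdf.
rewrite ge0_integral_gauss; first last.
- by apply/measurable_EFinP; exact: continuous_measurable_fun.
- by move=> x; rewrite lee_fin.
apply: (@le_trans _ _ (\int[lebesgue_measure]_(x in `[u, v]) ((g x)%:E * (normal_pdf 0 1 x)%:E))%E); last first.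
  apply: ge0_subset_integral => // x _.
  by rewrite mule_ge0// lee_fin// normal_pdf_ge0.
apply: (@le_trans _ _ (\int[lebesgue_measure]_(x in `[u, v]) (c * normal_pdf 0 1 1)%:E)%E).
  rewrite integral_cst//= lebesgue_measure_itv/= lte_fin.
  by case: ltP uv => [_ _|vu uv]; rewrite -?EFinD -?EFinM ?mule0 lee_fin//; rewrite (_ : v = u) ?subrr ?mulr0//; apply/eqP; rewrite eq_le uv vu.
apply: ge0_le_integral => //.
- by move=> x _; rewrite lee_fin mulr_ge0// normal_pdf_ge0.
- exact: measurable_funTS.
- move=> x /=; rewrite in_itv/= => /andP[ux xv]; rewrite -EFinM lee_fin.
  apply: ler_pM => //; first exact: normal_pdf_ge0; first by apply: gc; rewrite ux.
  exact: (pd x (le_trans u0 ux) (le_trans xv v1)).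
Qed.

(** A minorant of the indicator of [y >= 0] with support [[0, 2]]: on so short a support the tilting
    factor [exp (z y / 2)] is at most [exp z]. *)
Definition tent (y : R) : R := Num.max 0 (1 - `|y - 1|).

Lemma tent_itv y : 0 <= tent y <= 1.
Proof. by rewrite le_max lexx /= ge_max ler01 lerBlDr lerDl /=. Qed.

Lemma continuous_tent : continuous tent.
Proof.
move=> y; apply: (@continuous_max _ _ (fun=> 0) (fun y : R => 1 - `|y - 1|)); first exact: cvg_cst.
apply: cvgB; first exact: cvg_cst.
by apply: cvg_norm; apply: cvgB; [exact: cvg_id|exact: cvg_cst].
Qed.

Definition gauss_tent : R := \int[gauss R]_x tent (Num.sqrt 2 * x).

Lemma gauss_tent_gt0 : 0 < gauss_tent.
Proof.
have p1 : 0 < normal_pdf 0 1 1 :> R.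
  by rewrite normal_pdfE ?oner_neq0// mulr_gt0 ?normal_peak_gt0 ?oner_neq0// expR_gt0.
have s2 : 0 <= Num.sqrt 2 :> R by rewrite sqrtr_ge0.
have s22 : (Num.sqrt 2 : R) ^+ 2 = 2 by rewrite sqr_sqrtr.
have ct : continuous (fun x : R => tent (Num.sqrt 2 * x)).
  move=> x; apply: (@continuous_comp _ _ _ (fun x : R => Num.sqrt 2 * x) tent); last exact: continuous_tent.
  by apply: cvgM; [exact: cvg_cst|exact: cvg_id].
(* For [x] in [[1/2, 1]] the point [sqrt 2 x] is within [1/2] of the peak of the tent, whose value
   is then at least [1/2]. *)
apply: (@lt_le_trans _ _ (2^-1 * normal_pdf 0 1 1 * (1 - 2^-1))).
  by rewrite !mulr_gt0// subr_gt0 invf_lt1// ltr1n.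
rewrite -lee_fin /gauss_tent EFin_Rintegral; last first.
  apply: (@gauss_integrable_poly _ 0 _ 1) => [|x]; first exact: continuous_measurable_fun.
  by rewrite expr0 mulr1; case/andP: (tent_itv (Num.sqrt 2 * x)) => h1 h2; rewrite ger0_norm.
apply: gauss_lower => //.
- by move=> x; case/andP: (tent_itv (Num.sqrt 2 * x)).
- by rewrite invf_le1// ler1n.
- move=> x /andP[x1 x2]; rewrite le_max; apply/orP; right.
  have s1 : 1 <= Num.sqrt 2 :> R by rewrite -[leLHS]sqrtr1 ler_wsqrtr// ler1n.
  have s3 : Num.sqrt 2 <= 3 / 2 :> R by move: s2 s22; nra.
  have : `|Num.sqrt 2 * x - 1| <= 2^-1.
    rewrite ler_norml; apply/andP; split; nra.
  lra.
Qed.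

End gauss_lower.

Lemma integrableZ_EFin d (U : measurableType d) (R : realType)
    (m : {measure set U -> \bar R}) (f : U -> R) (c : R) :
  m.-integrable setT (EFin \o f) -> m.-integrable setT (EFin \o (fun x => c * f x)).
Proof. by move=> fi; apply: eq_integrable (integrableZl measurableT c fi). Qed.

(** * Tail bounds for a single quadratic form *)

Section chaos_ramp.
Context {R : realType}.
Variables (n : nat) (a : 'I_n -> R) (m z : R).
Hypotheses (a2 : \sum_i a i ^+ 2 = 1) (am : forall i, `|a i| <= m) (z0 : 0 <= z).
Local Notation T := (n.-tuple (measurableTypeR R)).
Local Notation Q t := (qform a t - \sum_i a i).

Let mQ : measurable_fun setT (fun t : T => Q t).
Proof. by apply: measurable_funB => //; exact: measurable_qform. Qed.

Let iramp k : (gaussn R n).-integrable setT (EFin \o (fun t : T => ramp k (Q t - z))).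
Proof.
apply: (@gaussn_bounded_integrable _ _ _ 1) => [|t]; last by rewrite ger0_norm ?ramp_ge0// ramp_le1.
apply: measurableT_comp; first exact: measurable_ramp.
exact: measurable_funB.
Qed.

Let rampexp k (y h : R) : 0 < k -> 0 <= h -> ramp k y <= expR (h * y + h / k).
Proof.
move=> k0 h0; have [ky|ky] := leP (k * y) (-1); first by rewrite ramp0// expR_ge0.
apply: le_trans (ramp_le1 _ _) _; rewrite -expR0 ler_expR.
have -> : h * y + h / k = h / k * (k * y + 1) by field; rewrite gt_eqF.
by rewrite mulr_ge0 ?divr_ge0// ?(ltW k0)//; lra.
Qed.

(** Chernoff's bound at [h = z / (2 (1 + m z))]. For this [h] one has [1 - 2 h m = 1 / (1 + m z)],
    so the exponent [- h z + h^2 / (1 - 2 h m)] equals [- z^2 / (4 (1 + m z))]. The first factor is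
    the price of the ramp and tends to [1] as [k] grows. *)
Lemma chaos_ramp_chernoff k : 0 < k ->
  \int[gaussn R n]_t ramp k (Q t - z) <=
  expR (z / (2 * (1 + m * z)) / k) * expR (- (z ^+ 2 / (4 * (1 + m * z)))).
Proof.
move=> k0; have m0 := chaos_weight_ge0 a2 am.
have D0 : 0 < 1 + m * z by rewrite ltr_wpDr// mulr_ge0.
set h := z / (2 * (1 + m * z)).
have h0 : 0 <= h by rewrite divr_ge0// mulr_ge0// ltW.
have hm : 2 * h * m < 1.
  have -> : 2 * h * m = m * z / (1 + m * z) by rewrite /h; field; rewrite gt_eqF.
  by rewrite ltr_pdivrMr// mul1r; lra.
have hmE : 1 - 2 * h * m = (1 + m * z)^-1 by rewrite /h; field; rewrite gt_eqF.
have hai i : 2 * h * a i < 1.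
  apply: le_lt_trans hm; have h20 : 0 <= 2 * h by rewrite mulr_ge0.
  exact: (ler_wpM2l h20 (le_trans (ler_norm _) (am i))).
have c1 : continuous (fun _ : R => 1 : R) by move=> x; exact: cvg_cst.
have TI := tilt_identity c1 (fun=> ler01) hai.
rewrite -lee_fin EFin_Rintegral; last exact: iramp.
apply: (@le_trans _ _ (\int[gaussn R n]_t ((expR (h / k - h * z))%:E * (1 * expR (h * Q t))%:E))%E).
  apply: ge0_le_integral => //.
  - by move=> t _; rewrite lee_fin ramp_ge0.
  - exact: measurable_int (iramp k).
  - under eq_fun do rewrite -EFinM; apply/measurable_EFinP; apply: measurable_funM => //.
    apply: measurable_funM => //; apply: measurableT_comp => //.
    exact: measurable_funM.
  - move=> t _; rewrite -EFinM lee_fin mul1r -expRD.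
    apply: le_trans (rampexp _ k0 h0) _; rewrite ler_expR; lra.
rewrite ge0_integralZl//; first last.
- apply/measurable_EFinP; apply: measurable_funM => //.
  by apply: measurableT_comp => //; exact: measurable_funM.
rewrite TI gaussn_cst -!EFinM lee_fin mulr1 -!expRD ler_expR.
have := log_laplace_le a2 am h0 hm; rewrite hmE invrK.
have -> : h ^+ 2 * (1 + m * z) = h * z - z ^+ 2 / (4 * (1 + m * z)).
  by rewrite /h; field; rewrite gt_eqF.
lra.
Qed.

Hypotheses (m0 : 0 < m) (zm : 2 * z * m <= 1).
Let C1 : R := 12 + 2 * stein_const.

(** The ramp is written as [g y * exp (z y / 2)]; [tilted_stein] compares the tilted form with N(0,
    2) on [g], and [gauss2_tilt] undoes the tilt on the Gaussian side. *)
Lemma chaos_ramp_stein k : 0 < k -> exists l r, [/\ `|l| <= z ^+ 3 * m,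
  `|r| <= C1 * m * (1 + z) ^+ 2 &
  \int[gaussn R n]_t ramp k (Q t - z) =
  expR l * (\int[gauss R]_x ramp k (Num.sqrt 2 * x - z) +
            expR (- (z ^+ 2 / 4) + z / 2 / k) * r)].
Proof.
move=> k0; have h0 : 0 <= z / 2 by rewrite divr_ge0.
(* The extra [- z / 2 / k] keeps [g] below [1] on the whole support of the ramp, which starts at
   [- 1 / k]. *)
pose e y := expR (- (z / 2 * y) - z / 2 / k).
pose g y := ramp k y * e y.
have ce : continuous e.
  move=> y; apply: (@continuous_comp _ _ _ (fun y : R => - (z / 2 * y) - z / 2 / k) expR); last exact: continuous_expR.
  apply: cvgB; last exact: cvg_cst.
  by apply: cvgN; apply: cvgM; [exact: cvg_cst|exact: cvg_id].
have cg : continuous g by move=> y; apply: cvgM; [exact: continuous_ramp|exact: ce].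
have g01 y : 0 <= g y <= 1.
  rewrite mulr_ge0 ?ramp_ge0 ?expR_ge0//= /g.
  apply: le_trans (ler_wpM2r (expR_ge0 _) (rampexp y k0 h0)) _.
  by rewrite -expRD -expR0 ler_expR; lra.
have gE y : g y * expR (z / 2 * y) = expR (- (z / 2 / k)) * ramp k y.
  by rewrite /g /e -mulrA -expRD mulrC; congr (expR _ * _); lra.
have [l [r [l1 r1 E]]] := tilted_stein a2 am m0 z0 zm cg g01.
exists l, r; split => //.
have g0 y : 0 <= g y by case/andP: (g01 y).
have G := gauss2_tilt z cg g0.
have E1 : expR (- (z / 2 / k)) * \int[gaussn R n]_t ramp k (Q t - z) =
    expR (- (z ^+ 2 / 4) + l) * (\int[gauss R]_x g (Num.sqrt 2 * x) + r).
  apply: EFin_inj; rewrite -E -RintegralZl ?EFin_Rintegral//.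
  - by apply: eq_integral => t _; rewrite gE.
  - exact: integrableZ_EFin.
have cr : continuous (fun x : R => ramp k (Num.sqrt 2 * x - z)).
  move=> x; apply: (@continuous_comp _ _ _ (fun x : R => Num.sqrt 2 * x - z) (ramp k)); last exact: continuous_ramp.
  by apply: cvgB; [apply: cvgM; [exact: cvg_cst|exact: cvg_id]|exact: cvg_cst].
have ir : (gauss R).-integrable setT (EFin \o (fun x : R => ramp k (Num.sqrt 2 * x - z))).
  apply: (@gauss_integrable_poly _ 0 _ 1) => [|x]; first exact: continuous_measurable_fun.
  by rewrite expr0 mulr1 ger0_norm ?ramp_ge0// ramp_le1.
have cgs : continuous (fun x : R => g (Num.sqrt 2 * x)).
  move=> x; apply: (@continuous_comp _ _ _ (fun x : R => Num.sqrt 2 * x) g); last exact: cg.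
  by apply: cvgM; [exact: cvg_cst|exact: cvg_id].
have igs : (gauss R).-integrable setT (EFin \o (fun x : R => g (Num.sqrt 2 * x))).
  apply: (@gauss_integrable_poly _ 0 _ 1) => [|x]; first exact: continuous_measurable_fun.
  by rewrite expr0 mulr1 ger0_norm//; case/andP: (g01 (Num.sqrt 2 * x)).
have E2 : expR (- (z / 2 / k)) * \int[gauss R]_x ramp k (Num.sqrt 2 * x - z) =
    expR (- (z ^+ 2 / 4)) * \int[gauss R]_x g (Num.sqrt 2 * x).
  apply: EFin_inj; rewrite [in RHS]EFinM [in RHS]EFin_Rintegral// -G -RintegralZl ?EFin_Rintegral//.
  - by apply: eq_integral => t _; rewrite gE.
  - exact: integrableZ_EFin.
have ek : expR (z / 2 / k) * expR (- (z / 2 / k)) = 1 by rewrite -expRD subrr expR0.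
have inv (u : R) : u = expR (z / 2 / k) * (expR (- (z / 2 / k)) * u) by rewrite mulrA ek mul1r.
rewrite [LHS]inv E1 [X in expR l * (X + _)]inv E2 !expRD.
by ring.
Qed.

(** On the support [[0, 2]] of the tent the ramp is [1] and [exp (z y / 2) <= exp z], so the ramp
    dominates [exp (- z)] times the tilted tent. The loss [exp (- z)] buys a main term that does not
    decay with [z], against which the error [m (1 + z)^2] stays small up to [z] of order
    [1 / sqrt m]. *)
Lemma chaos_ramp_tent k : 0 < k ->
  expR (- z - z ^+ 2 / 4 - z ^+ 3 * m) * (gauss_tent - C1 * m * (1 + z) ^+ 2) <=
  \int[gaussn R n]_t ramp k (Q t - z).
Proof.
move=> k0.
have [l [r [l1 r1 E]]] := tilted_stein a2 am m0 z0 zm continuous_tent tent_itv.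
have i0 : 0 <= \int[gaussn R n]_t ramp k (Q t - z).
  by apply: Rintegral_ge0 => t _; exact: ramp_ge0.
have [neg|pos] := leP (gauss_tent - C1 * m * (1 + z) ^+ 2) 0.
  by apply: le_trans i0; rewrite mulr_ge0_le0// expR_ge0.
rewrite -lee_fin EFin_Rintegral; last exact: iramp.
have mt : measurable_fun setT (fun t : T => tent (Q t - z) * expR (z / 2 * (Q t - z))).
  apply: measurable_funM; apply: measurableT_comp => //.
  - by apply: continuous_measurable_fun; exact: continuous_tent.
  - exact: measurable_funB.
  - by apply: measurable_funM => //; exact: measurable_funB.
have tent0 (y : R) : 0 <= tent y by case/andP: (tent_itv y).
apply: (@le_trans _ _ (\int[gaussn R n]_t ((expR (- z))%:E * (tent (Q t - z) * expR (z / 2 * (Q t - z)))%:E))%E).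
  rewrite ge0_integralZl//; first last.
  - by move=> t _; rewrite lee_fin mulr_ge0// expR_ge0.
  - exact/measurable_EFinP.
  rewrite E -EFinM lee_fin -/gauss_tent [leRHS]mulrA -expRD.
  apply: ler_pM; rewrite ?expR_ge0 ?(ltW pos)//.
    by rewrite ler_expR; move: l1; rewrite ler_norml => /andP[]; lra.
  by move: r1; rewrite ler_norml => /andP[]; rewrite /C1; lra.
apply: ge0_le_integral => //.
- by move=> t _; rewrite -EFinM lee_fin mulr_ge0 ?expR_ge0// mulr_ge0// expR_ge0.
- by under eq_fun do rewrite -EFinM; apply/measurable_EFinP; exact: measurable_funM.
- exact: measurable_int (iramp k).
- move=> t _; rewrite -EFinM lee_fin; move: (Q t - z) => y.
  have [y0|y0] := leP y 0.
    rewrite (_ : tent y = 0) ?mul0r ?mulr0 ?ramp_ge0//.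
    by apply/max_idPl; rewrite ler0_norm; lra.
  have [y2|y2] := leP 2 y.
    rewrite (_ : tent y = 0) ?mul0r ?mulr0 ?ramp_ge0//.
    by apply/max_idPl; rewrite ger0_norm; lra.
  rewrite ramp1; last by rewrite mulr_ge0 ?ltW.
  rewrite mulrCA -expRD; apply: mulr_ile1 => //; rewrite ?expR_ge0//.
    by case/andP: (tent_itv y).
  rewrite -[leRHS]expR0 ler_expR; have : 0 <= z * (2 - y) by rewrite mulr_ge0//; lra.
  lra.
Qed.

End chaos_ramp.

Lemma cvgn_le {R : realType} (u v : nat -> R) (a b : R) :
  u n @[n --> \oo] --> a -> v n @[n --> \oo] --> b -> (forall n, u n <= v n) -> a <= b.
Proof. by move=> ua vb uv; apply: (ler_cvg_to ua vb); exact: nearW. Qed.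

(** * Tails of the law N(0, 2) *)

Section gauss_tail.
Context {R : realType}.
Local Notation s2 := (Num.sqrt 2 : R).

Definition gauss_tail (z : R) : R := fine (gauss R [set x | z <= s2 * x]).

Let ms2 : measurable_fun setT (fun x : measurableTypeR R => s2 * x : R).
Proof. by apply: measurable_funM => //; exact: measurable_id. Qed.

Lemma gauss_tail_cvg z :
  \int[gauss R]_x ramp n.+1%:R (s2 * x - z) @[n --> \oo] --> gauss_tail z.
Proof. by apply: ramp_cvg. Qed.

Lemma continuous_ramp_affine (k b c : R) : continuous (fun x : R => ramp k (b * x - c)).
Proof.
move=> x; apply: (@continuous_comp _ _ _ (fun x : R => b * x - c) (ramp k)); last exact: continuous_ramp.
by apply: cvgB; [apply: cvgM; [exact: cvg_cst|exact: cvg_id]|exact: cvg_cst].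
Qed.

Lemma ge0_integral_gaussN (g : R -> R) : continuous g -> (forall x, 0 <= g x) ->
  (\int[gauss R]_x (g (- x))%:E = \int[gauss R]_x (g x)%:E)%E.
Proof.
move=> cg g0.
have cgN : continuous (fun x : R => g (- x)).
  by move=> x; apply: (@continuous_comp _ _ _ (fun x : R => - x) g); [exact: opp_continuous|exact: cg].
have mg := continuous_measurable_fun cg.
have mgN := continuous_measurable_fun cgN.
rewrite !ge0_integral_gauss; first last.
- exact/measurable_EFinP.
- by move=> x; rewrite lee_fin.
- exact/measurable_EFinP.
- by move=> x; rewrite lee_fin.
have mN : measurable_fun setT (-%R : R -> measurableTypeR R).
  exact: oppr_measurable.
pose f := fun x : R => ((g x)%:E * (normal_pdf 0 1 x)%:E)%E.
rewrite -/f -[RHS](_ : (\int[pushforward lebesgue_measure (-%R : R -> measurableTypeR R)]_x f x)%E = _).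
  rewrite ge0_integral_pushforward; first last.
  - by move=> x _; rewrite mule_ge0// lee_fin// normal_pdf_ge0.
  - apply: emeasurable_funM; first exact/measurable_EFinP.
    by apply/measurable_EFinP; exact: measurable_normal_pdf.
  - exact: measurableT.
  - exact: mN.
  - apply: eq_integral => x _; rewrite /f /=; congr (_ * _%:E)%E.
    by rewrite !normal_pdfE ?oner_neq0// /normal_fun !subr0 sqrrN.
apply: eq_measure_integral => A mA _; exact: lebesgue_measureN.
Qed.

Lemma Rintegral_normal_gauss (g : R -> R) (m s : R) : s != 0 -> continuous g ->
  (forall x, 0 <= g x) ->
  \int[normal_prob m s]_x g x = \int[gauss R]_x g (m + `|s| * x).
Proof. by move=> s0 cg g0; rewrite /Rintegral ge0_integral_normal_gauss. Qed.

Lemma normal_prob_set1 (m s x : R) : normal_prob m s [set x] = 0%E.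
Proof.
by have /null_content_dominatesP := @normal_prob_dominates R m s; apply => //; exact: lebesgue_measure_set1.
Qed.

Let s2n0 : s2 != 0. Proof. by rewrite gt_eqF// sqrtr_gt0. Qed.

(** Both sides are limits of the same ramp integrals, which the change of variables identifies
    because ramps are continuous. *)
Lemma normal_prob_ge (z : R) : normal_prob 0 s2 `[z, +oo[ = (gauss_tail z)%:E.
Proof.
have m1 : measurable_fun setT (fun x : measurableTypeR R => x : R) by exact: measurable_id.
have := @ramp_cvg _ _ _ (normal_prob 0 s2) _ z m1.
under eq_cvg => n.
  rewrite (_ : \int[_]_x _ = \int[gauss R]_x ramp n.+1%:R (s2 * x - z)); last first.
    rewrite (@Rintegral_normal_gauss (fun x => ramp n.+1%:R (x - z)))//.
    - by apply: eq_Rintegral => x _; rewrite add0r ger0_norm ?sqrtr_ge0.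
    - by move=> x; have := @continuous_ramp_affine n.+1%:R 1 z x; under eq_fun do rewrite mul1r.
    - by move=> x; exact: ramp_ge0.
  over.
move=> h; rewrite (cvg_unique _ (@gauss_tail_cvg z) h)//.
rewrite (_ : [set w | _] = `[z, +oo[%classic); last first.
  by apply/seteqP; split => x /=; rewrite in_itv/= andbT.
by rewrite fineK// fin_num_measure.
Qed.

Lemma normal_prob_le (z : R) : normal_prob 0 s2 `]-oo, - z] = (gauss_tail z)%:E.
Proof.
have m1 : measurable_fun setT (fun x : measurableTypeR R => - x : R).
  exact: oppr_measurable.
have := @ramp_cvg _ _ _ (normal_prob 0 s2) _ z m1.
under eq_cvg => n.
  rewrite (_ : \int[_]_x _ = \int[gauss R]_x ramp n.+1%:R (s2 * x - z)); last first.
    have c1 := @continuous_ramp_affine n.+1%:R (- s2) z.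
    rewrite (@Rintegral_normal_gauss (fun x => ramp n.+1%:R (- x - z)))//.
    - have E := ge0_integral_gaussN (@continuous_ramp_affine n.+1%:R s2 z) (fun=> ramp_ge0 _ _).
      transitivity (\int[gauss R]_x ramp n.+1%:R (s2 * - x - z)); last by rewrite /Rintegral E.
      by apply: eq_Rintegral => x _; rewrite add0r ger0_norm ?sqrtr_ge0// mulrN.
    - by move=> x; have := @continuous_ramp_affine n.+1%:R (-1) z x; under eq_fun do rewrite mulN1r.
    - by move=> x; exact: ramp_ge0.
  over.
move=> h; rewrite (cvg_unique _ (@gauss_tail_cvg z) h)//.
rewrite (_ : [set w | _] = `]-oo, - z]%classic); last first.
  by apply/seteqP; split => x /=; rewrite in_itv/= lerNr.
by rewrite fineK// fin_num_measure.
Qed.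

Lemma Phi2_tail (z : R) : (1 - Phi 2 z)%E = (gauss_tail z)%:E.
Proof.
rewrite /Phi /gaussian_law (negbTE s2n0) -probability_setC//.
rewrite setCitvl -normal_prob_ge -(@setU1itv _ _ _ _ false)// measureU//.
- rewrite -[LHS]add0e; congr (_ + _)%E; exact/esym/normal_prob_set1.
- by apply/seteqP; split => x //= -[-> ]; rewrite in_itv/= ltxx.
Qed.

Lemma Phi2N (z : R) : Phi 2 (- z) = (gauss_tail z)%:E.
Proof. by rewrite /Phi /gaussian_law (negbTE s2n0) normal_prob_le. Qed.

Lemma expR_divS_cvg (c : R) : expR (c / n.+1%:R) @[n --> \oo] --> (1 : R).
Proof.
rewrite -[X in _ --> X](@expR0 R); apply: continuous_cvg; first exact: continuous_expR.
rewrite -[X in _ --> X](mulr0 c); apply: cvgM; first exact: cvg_cst.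
exact: cvg_harmonic.
Qed.

Let iramp k z : (gauss R).-integrable setT (EFin \o (fun x : R => ramp k (s2 * x - z))).
Proof. exact: ramp_integrable. Qed.

Lemma ramp_le_expR k (y h : R) : 0 < k -> 0 <= h -> ramp k y <= expR (h * y + h / k).
Proof.
move=> k0 h0; have [ky|ky] := leP (k * y) (-1); first by rewrite ramp0// expR_ge0.
apply: le_trans (ramp_le1 _ _) _; rewrite -expR0 ler_expR.
have -> : h * y + h / k = h / k * (k * y + 1) by field; rewrite gt_eqF.
by rewrite mulr_ge0 ?divr_ge0// ?(ltW k0)//; lra.
Qed.

Let c1 : continuous (fun _ : R => 1 : R). Proof. by move=> x; exact: cvg_cst. Qed.

(** Chernoff's bound with [h = z / 2], the exponential moment coming from [gauss2_tilt] with a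
    constant [g]. *)
Lemma gauss_tail_le z : 0 <= z -> gauss_tail z <= expR (- (z ^+ 2 / 4)).
Proof.
move=> z0; have h0 : 0 <= z / 2 by rewrite divr_ge0.
have C : expR (z / 2 / n.+1%:R) * expR (- (z ^+ 2 / 4)) @[n --> \oo] --> 1 * expR (- (z ^+ 2 / 4)).
  by apply: cvgM; [exact: expR_divS_cvg|exact: cvg_cst].
rewrite mul1r in C; apply: (cvgn_le (@gauss_tail_cvg z) C) => n.
have k0 : (0 : R) < n.+1%:R by rewrite ltr0n.
rewrite -lee_fin EFin_Rintegral//.
have G := gauss2_tilt z c1 (fun=> ler01); rewrite integral_gauss_cst mule1 in G.
rewrite EFinM -G -ge0_integralZl//; first last.
- apply/measurable_EFinP; apply: measurable_funM => //; apply: measurableT_comp => //.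
  by apply: measurable_funM => //; exact: measurable_funB.
apply: ge0_le_integral => //.
- by move=> x _; rewrite lee_fin ramp_ge0.
- exact: measurable_int (iramp _ _).
- under eq_fun do rewrite -EFinM; apply/measurable_EFinP; apply: measurable_funM => //.
  apply: measurable_funM => //; apply: measurableT_comp => //.
  by apply: measurable_funM => //; exact: measurable_funB.
move=> x _; rewrite -EFinM lee_fin mul1r -expRD.
by apply: le_trans (ramp_le_expR _ k0 h0) _; rewrite ler_expR addrC.
Qed.

(** Three lower bounds multiplied: [exp (-1) / 2] for the function [g] of the next proof on an
    interval of length [1 / (2 (1 + z))] inside [[0, 1]], and [normal_pdf 0 1 1] for the density
    there. *)
Definition mills_const : R := expR (-1) * normal_pdf 0 1 1 / 4.

Lemma mills_const_gt0 : 0 < mills_const.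
Proof.
rewrite /mills_const !mulr_gt0 ?expR_gt0//.
by rewrite normal_pdfE ?oner_neq0// mulr_gt0 ?normal_peak_gt0 ?oner_neq0// expR_gt0.
Qed.

(** Beyond [z] the mass of N(0, 2) sits within a distance of order [1 / (1 + z)], hence a tent
    shrunk by [1 + z]. On its support [z y / 2 <= 1], so the factor [exp (-1)] keeps the tilted tent
    below the ramp. *)
Lemma gauss_tail_ge z : 0 <= z -> mills_const * expR (- (z ^+ 2 / 4)) / (1 + z) <= gauss_tail z.
Proof.
move=> z0; have z1 : 0 < 1 + z by rewrite ltr_wpDr.
have p0 : 0 <= normal_pdf 0 1 1 :> R by exact: normal_pdf_ge0.
apply: (cvgn_le (@cvg_cst R (mills_const * expR (- (z ^+ 2 / 4)) / (1 + z)) _ \oo _) (@gauss_tail_cvg z)) => n.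
have k0 : (0 : R) < n.+1%:R by rewrite ltr0n.
pose g y := expR (-1) * tent ((1 + z) * y).
have cg : continuous g.
  move=> y; apply: cvgM; first exact: cvg_cst.
  apply: (@continuous_comp _ _ _ (fun y : R => (1 + z) * y) tent); last exact: continuous_tent.
  by apply: cvgM; [exact: cvg_cst|exact: cvg_id].
have g0 y : 0 <= g y by rewrite mulr_ge0 ?expR_ge0//; case/andP: (tent_itv ((1 + z) * y)).
have G := gauss2_tilt z cg g0.
rewrite -lee_fin EFin_Rintegral//.
apply: (@le_trans _ _ (\int[gauss R]_x (g (s2 * x - z) * expR (z / 2 * (s2 * x - z)))%:E)%E).
  rewrite G.
  have cg' : continuous (fun x : R => g (s2 * x)).
    move=> x; apply: (@continuous_comp _ _ _ (fun y : R => s2 * y) g); last exact: cg.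
    by apply: cvgM; [exact: cvg_cst|exact: cvg_id].
  have u0 : 0 <= (2 * (1 + z))^-1 by rewrite invr_ge0 mulr_ge0// ltW.
  have L := @gauss_lower R (fun x : R => g (s2 * x)) (expR (-1) / 2) (2 * (1 + z))^-1 (1 + z)^-1 cg' (fun=> g0 _) _ u0 _ _ _.
  apply: (@le_trans _ _ ((expR (- (z ^+ 2 / 4)))%:E * (expR (-1) / 2 * normal_pdf 0 1 1 * ((1 + z)^-1 - (2 * (1 + z))^-1))%:E)%E).
    rewrite -EFinM lee_fin le_eqVlt; apply/orP; left; apply/eqP.
    by rewrite /mills_const; field; rewrite gt_eqF.
  apply: lee_wpmul2l; first by rewrite lee_fin expR_ge0.
  apply: L.
  - by rewrite divr_ge0 ?expR_ge0.
  - by rewrite lef_pV2 ?posrE ?mulr_gt0//; lra.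
  - by rewrite invf_le1//; lra.
  (* On this interval [(1 + z) x] lies in [[1/2, 1]], so [sqrt 2 (1 + z) x] is within [1/2] of the
     peak of the tent. *)
  move=> x /andP[x1 x2]; rewrite /g ler_wpM2l ?expR_ge0//.
  set y := (1 + z) * x.
  have y1 : 2^-1 <= y.
    have := ler_wpM2l (ltW z1) x1; rewrite -/y; apply: le_trans.
    by rewrite le_eqVlt; apply/orP; left; apply/eqP; field; rewrite gt_eqF.
  have y2 : y <= 1 by have := ler_wpM2l (ltW z1) x2; rewrite divff// gt_eqF.
  have -> : (1 + z) * (s2 * x) = s2 * y by rewrite /y mulrCA.
  have s22 : s2 ^+ 2 = 2 by rewrite sqr_sqrtr.
  have s0 : 0 <= s2 by rewrite sqrtr_ge0.
  have s1 : 1 <= s2 by rewrite -[leLHS]sqrtr1 ler_wsqrtr// ler1n.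
  have s3 : s2 <= 3 / 2 by move: s0 s22; nra.
  rewrite /tent le_max; apply/orP; right.
  have : `|s2 * y - 1| <= 2^-1 by rewrite ler_norml; apply/andP; split; nra.
  lra.
apply: ge0_le_integral => //.
- by move=> x _; rewrite lee_fin mulr_ge0 ?expR_ge0.
- apply/measurable_EFinP; apply: measurable_funM.
    apply: measurableT_comp; first exact: continuous_measurable_fun.
    exact: measurable_funB.
  apply: measurableT_comp => //.
  by apply: measurable_funM => //; exact: measurable_funB.
- exact: measurable_int (iramp _ _).
move=> x _; rewrite lee_fin; move: (s2 * x - z) => y {x}.
have [y0|y0] := leP y 0.
  rewrite (_ : g y = 0) ?mul0r ?ramp_ge0//; rewrite /g (_ : tent _ = 0) ?mulr0//.
  apply/max_idPl; have : (1 + z) * y <= 0 by rewrite mulr_ge0_le0// ltW.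
  move=> h; rewrite ler0_norm; lra.
have [y2|y2] := leP 2 ((1 + z) * y).
  rewrite (_ : g y = 0) ?mul0r ?ramp_ge0//; rewrite /g (_ : tent _ = 0) ?mulr0//.
  by apply/max_idPl; rewrite ger0_norm; lra.
rewrite ramp1; last by rewrite mulr_ge0 ?ltW.
rewrite /g mulrAC -expRD; apply: mulr_ile1; rewrite ?expR_ge0//.
- by case/andP: (tent_itv ((1 + z) * y)).
- by rewrite -[leRHS]expR0 ler_expR; nra.
- by case/andP: (tent_itv ((1 + z) * y)).
Qed.

End gauss_tail.

Lemma cvgn_ext {R : realType} (u v : nat -> R) (l : R) :
  u =1 v -> v n @[n --> \oo] --> l -> u n @[n --> \oo] --> l.
Proof. by move=> /funext ->. Qed.

Lemma Rintegral_prob1B {R : realType} d (U : measurableType d)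
    (mu : {measure set U -> \bar R}) (f : U -> R) : mu setT = 1%E ->
  mu.-integrable setT (EFin \o f) ->
  \int[mu]_w (1 - f w) = 1 - \int[mu]_w f w.
Proof.
move=> mu1 fi; rewrite RintegralB//.
  by rewrite Rintegral_cst// [fine _](_ : _ = 1) ?mulr1// mu1.
apply/integrableP; split; first exact: measurable_cst.
by rewrite integral_cst// mu1 mule1/= ltry.
Qed.

(** * Limits of quadratic forms *)

Section chaos_limit.
Context {R : realType} d (U : measurableType d) (P : probability U R).
Implicit Types (F : U -> R) (m z : R).

(* The law of F is the limit of the laws of centred quadratic forms
   \sum_i a_i (xi_i^2 - 1) in i.i.d. standard Gaussian xi_i, with
   \sum_i a_i^2 = 1 and |a_i| <= m; the convergence is tested on ramps. *)
Definition chaos_limit F m : Prop :=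
  measurable_fun setT F /\
  exists (n : nat -> nat) (a : forall j, 'I_(n j) -> R),
  [/\ forall j, \sum_i a j i ^+ 2 = 1, forall j i, `|a j i| <= m &
    forall k z, 0 < k ->
      \int[gaussn R (n j)]_t ramp k (qform (a j) t - \sum_i a j i - z)
        @[j --> \oo] --> \int[P]_w ramp k (F w - z)].

Lemma chaos_limitN F m : chaos_limit F m -> chaos_limit (fun w => - F w) m.
Proof.
move=> [mF [n [a [a2 am aF]]]]; split; first exact: measurableT_comp.
exists n, (fun j i => - a j i); split.
- by move=> j; rewrite -[RHS](a2 j); apply: eq_bigr => i _; rewrite sqrrN.
- by move=> j i; rewrite normrN.
move=> k z k0; have kn0 : k != 0 by rewrite gt_eqF.
have E (y : R) : ramp k (- y - z) = 1 - ramp k (y - (k^-1 - z)).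
  by rewrite -rampN//; congr (ramp k _); ring.
under eq_Rintegral do rewrite E.
rewrite Rintegral_prob1B//; first last.
- exact: ramp_integrable.
- exact: probability_setT.
apply: (@cvgn_ext _ _ (fun j => 1 - \int[gaussn R (n j)]_t ramp k (qform (a j) t - \sum_i a j i - (k^-1 - z)))).
  move=> j; rewrite -Rintegral_prob1B; first last.
  - apply: (@gaussn_bounded_integrable _ _ _ 1) => [|t]; last by rewrite ger0_norm ?ramp_ge0// ramp_le1.
    apply: measurableT_comp; first exact: measurable_ramp.
    by do 2 apply: measurable_funB => //; exact: measurable_qform.
  - exact: gaussn_setT.
  apply: eq_Rintegral => t _; rewrite -E; congr (ramp k (_ - z)).
  rewrite /qform sumrN opprK opprB addrC; congr (_ + _).
  by rewrite -sumrN; apply: eq_bigr => i _; rewrite mulNr.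
by apply: cvgB; [exact: cvg_cst|exact: aF].
Qed.

Section tails.
Variables (F : U -> R) (m z : R).
Hypotheses (FP : chaos_limit F m) (z0 : 0 <= z).

Let ramp_limit_le k (C : R) : 0 < k ->
  (forall n (a : 'I_n -> R), \sum_i a i ^+ 2 = 1 -> (forall i, `|a i| <= m) ->
    \int[gaussn R n]_t ramp k (qform a t - \sum_i a i - z) <= C) ->
  \int[P]_w ramp k (F w - z) <= C.
Proof.
move=> k0 H; have [mF [n [a [a2 am aF]]]] := FP.
apply: (cvgn_le (aF k z k0) (@cvg_cst R C _ \oo _)) => j.
exact: H (a2 j) (am j).
Qed.

Let ramp_limit_ge k (C : R) : 0 < k ->
  (forall n (a : 'I_n -> R), \sum_i a i ^+ 2 = 1 -> (forall i, `|a i| <= m) ->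
    C <= \int[gaussn R n]_t ramp k (qform a t - \sum_i a i - z)) ->
  C <= \int[P]_w ramp k (F w - z).
Proof.
move=> k0 H; have [mF [n [a [a2 am aF]]]] := FP.
apply: (cvgn_le (@cvg_cst R C _ \oo _) (aF k z k0)) => j.
exact: H (a2 j) (am j).
Qed.

Let Pz : R := fine (P [set w | z <= F w]).

Let Pz_cvg : \int[P]_w ramp n.+1%:R (F w - z) @[n --> \oo] --> Pz.
Proof. by apply: ramp_cvg; case: FP. Qed.

Lemma chaos_weight_bound_ge0 : 0 <= m.
Proof. by have [_ [n [a [a2 am _]]]] := FP; exact: chaos_weight_ge0 (a2 0) (am 0). Qed.

Lemma chaos_chernoff :
  fine (P [set w | z <= F w]) <= expR (- (z ^+ 2 / (4 * (1 + m * z)))).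
Proof.
set C := expR (- _); set h := z / (2 * (1 + m * z)).
have Ccvg : expR (h / n.+1%:R) * C @[n --> \oo] --> 1 * C.
  by apply: cvgM; [exact: expR_divS_cvg|exact: cvg_cst].
rewrite mul1r in Ccvg; apply: (cvgn_le Pz_cvg Ccvg) => n.
have k0 : (0 : R) < n.+1%:R by rewrite ltr0n.
by apply: ramp_limit_le => // N a a2 am; exact: chaos_ramp_chernoff.
Qed.

Hypotheses (m0 : 0 < m) (zm : 2 * z * m <= 1).
Let C1 : R := 12 + 2 * stein_const.
Let eps := C1 * m * (1 + z) ^+ 2.

(** [chaos_ramp_stein] is uniform over the forms, so at a fixed slope it passes to [F]; the slope
    then tends to infinity, which turns ramps into tails and removes the factor
    [exp (z / 2 / k)]. *)
Lemma chaos_stein :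
  expR (- (z ^+ 3 * m)) * (gauss_tail z - expR (- (z ^+ 2 / 4)) * eps) <= Pz /\
  Pz <= expR (z ^+ 3 * m) * (gauss_tail z + expR (- (z ^+ 2 / 4)) * eps).
Proof.
have C e : expR (- (z ^+ 2 / 4) + z / 2 / n.+1%:R) * e @[n --> \oo] --> expR (- (z ^+ 2 / 4)) * e.
  apply: cvgM; last exact: cvg_cst.
  apply: (@cvgn_ext _ _ (fun n => expR (- (z ^+ 2 / 4)) * expR (z / 2 / n.+1%:R))).
    by move=> n; rewrite expRD.
  rewrite -[expR (- (z ^+ 2 / 4)) in X in _ --> X]mulr1; apply: cvgM; first exact: cvg_cst.
  exact: expR_divS_cvg.
have e0 n : 0 <= expR (- (z ^+ 2 / 4) + z / 2 / n.+1%:R) by exact: expR_ge0.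
have l3 : 0 <= z ^+ 3 * m by rewrite mulr_ge0 ?exprn_ge0// ltW.
have k0 n : (0 : R) < n.+1%:R by rewrite ltr0n.
have bound n N (a : 'I_N -> R) : \sum_i a i ^+ 2 = 1 -> (forall i, `|a i| <= m) ->
    let G := \int[gauss R]_x ramp n.+1%:R (Num.sqrt 2 * x - z) in
    let e := expR (- (z ^+ 2 / 4) + z / 2 / n.+1%:R) * eps in
    let I := \int[gaussn R N]_t ramp n.+1%:R (qform a t - \sum_i a i - z) in
    expR (- (z ^+ 3 * m)) * (G - e) <= I <= expR (z ^+ 3 * m) * (G + e).
  move=> a2 am /=.
  have [l [r [hl hr E]]] := chaos_ramp_stein a2 am z0 m0 zm (k0 n).
  have : 0 <= \int[gaussn R N]_t ramp n.+1%:R (qform a t - \sum_i a i - z).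
    by apply: Rintegral_ge0 => t _; exact: ramp_ge0.
  move: hl hr; rewrite !ler_norml => /andP[l1 l2] /andP[r1 r2].
  rewrite {}E; set G := Rintegral _ _ _; set b := expR (- (z ^+ 2 / 4) + _).
  have b0 : 0 <= b by exact: expR_ge0.
  rewrite (pmulr_rge0 _ (expR_gt0 _)) => pos; apply/andP; split.
    (* The lower bound of [exp l] transfers to the product when the bracket is positive; otherwise
       the claim is trivial, the integral being nonnegative. *)
    have [neg|pos'] := leP (G - b * eps) 0.
      by apply: (@le_trans _ _ 0); rewrite ?mulr_ge0 ?mulr_ge0_le0 ?expR_ge0.
    apply: ler_pM; rewrite ?expR_ge0 ?(ltW pos')//; first by rewrite ler_expR; lra.
    by rewrite lerD2l -mulrN ler_wpM2l.
  apply: ler_pM; rewrite ?expR_ge0//; first by rewrite ler_expR; lra.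
  by rewrite lerD2l ler_wpM2l.
split.
- apply: (@cvgn_le R (fun n => expR (- (z ^+ 3 * m)) * (\int[gauss R]_x ramp n.+1%:R (Num.sqrt 2 * x - z) - expR (- (z ^+ 2 / 4) + z / 2 / n.+1%:R) * eps)) _ _ _ _ Pz_cvg).
    apply: cvgM; first exact: cvg_cst.
    by apply: cvgB; [exact: gauss_tail_cvg|exact: C].
  by move=> n; apply: ramp_limit_ge => // N a a2 am; have /andP[] := bound n N a a2 am.
- apply: (@cvgn_le R _ (fun n => expR (z ^+ 3 * m) * (\int[gauss R]_x ramp n.+1%:R (Num.sqrt 2 * x - z) + expR (- (z ^+ 2 / 4) + z / 2 / n.+1%:R) * eps)) _ _ Pz_cvg).
    apply: cvgM; first exact: cvg_cst.
    by apply: cvgD; [exact: gauss_tail_cvg|exact: C].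
  by move=> n; apply: ramp_limit_le => // N a a2 am; have /andP[] := bound n N a a2 am.
Qed.

Lemma chaos_tent :
  expR (- z - z ^+ 2 / 4 - z ^+ 3 * m) * (gauss_tent - eps) <= Pz.
Proof.
apply: (cvgn_le (@cvg_cst R _ _ \oo _) Pz_cvg) => n.
have k0 : (0 : R) < n.+1%:R by rewrite ltr0n.
by apply: ramp_limit_ge => // N a a2 am; exact: chaos_ramp_tent.
Qed.

End tails.
End chaos_limit.

(** * The moment problem on the unit interval *)

Section bernstein.
Context {R : realType}.

(** Evaluated at [u], the mean of [f] at a binomial variable of parameters [n] and [u]: the
    recursion conditions on the first trial, [f \o S] standing for a success. *)
Fixpoint bernstein (n : nat) (f : nat -> R) : {poly R} :=
  if n is n'.+1 then 'X * bernstein n' (f \o S) + (1 - 'X) * bernstein n' f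
  else (f 0)%:P.

Lemma horner_bernsteinS n f (u : R) :
  (bernstein n.+1 f).[u] = u * (bernstein n (f \o S)).[u] + (1 - u) * (bernstein n f).[u].
Proof. by rewrite /= !hornerE. Qed.

Lemma le_bernstein n f g (u : R) : 0 <= u <= 1 -> (forall i, (i <= n)%N -> f i <= g i) ->
  (bernstein n f).[u] <= (bernstein n g).[u].
Proof.
move=> /andP[u0 u1]; elim: n f g => [|n IH] f g fg; first by rewrite /= !hornerE fg.
rewrite !horner_bernsteinS lerD// ler_wpM2l ?subr_ge0// IH// => i ni; apply: fg => //.
exact: leqW.
Qed.

Lemma bernsteinD n f g (u : R) :
  (bernstein n (fun i => f i + g i)).[u] = (bernstein n f).[u] + (bernstein n g).[u].
Proof.
elim: n f g => [|n IH] f g; first by rewrite /= !hornerE.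
rewrite !horner_bernsteinS (IH (f \o S) (g \o S)) (IH f g); ring.
Qed.

Lemma bernsteinZ n (c : R) f (u : R) :
  (bernstein n (fun i => c * f i)).[u] = c * (bernstein n f).[u].
Proof.
elim: n f => [|n IH] f; first by rewrite /= !hornerE.
rewrite !horner_bernsteinS (IH (f \o S)) (IH f); ring.
Qed.

Lemma bernstein_cst n (c u : R) : (bernstein n (fun=> c)).[u] = c.
Proof.
elim: n => [|n IH]; first by rewrite /= !hornerE.
by rewrite horner_bernsteinS [(fun=> c) \o S](_ : _ = fun=> c)// IH; ring.
Qed.

(** For the binomial variable, variance plus squared bias. *)
Lemma bernstein_sqr n (c u : R) :
  (bernstein n (fun i => (i%:R - c) ^+ 2)).[u] = n%:R * u * (1 - u) + (n%:R * u - c) ^+ 2.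
Proof.
elim: n c => [|n IH] c; first by rewrite /= !hornerE; ring.
rewrite horner_bernsteinS IH.
rewrite [(fun i => (i%:R - c) ^+ 2) \o S](_ : _ = fun i : nat => (i%:R - (c - 1)) ^+ 2).
  by rewrite IH -natr1; ring.
by apply/funext => i /=; rewrite -natr1; ring.
Qed.

(** With [w] the distance from [u] to the binomial frequency, [w <= e / 2 + w^2 / (2 e)]; the mean
    of [w^2] is [u (1 - u) / n], so the second term has mean at most [e / 2] once [n >= 1 / e^2]. *)
Lemma bernstein_lipschitz (phi : R -> R) (L u e : R) n :
  (forall x y, 0 <= x <= 1 -> 0 <= y <= 1 -> `|phi x - phi y| <= L * `|x - y|) ->
  0 <= L -> 0 <= u <= 1 -> 0 < e -> e^-1 ^+ 2 <= n%:R ->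
  `|(bernstein n (fun i => phi (i%:R / n%:R))).[u] - phi u| <= L * e.
Proof.
move=> phiL L0 u01 e0 ne; have /andP[u0 u1] := u01.
have n0 : (0 : R) < n%:R by apply: lt_le_trans ne; rewrite exprn_gt0// invr_gt0.
pose K i := L * (e / 2) + L * (e^-1 / 2 * n%:R^-1 ^+ 2) * (i%:R - n%:R * u) ^+ 2.
have key i : (i <= n)%N -> `|phi (i%:R / n%:R) - phi u| <= K i.
  move=> ni; have i01 : 0 <= (i%:R / n%:R : R) <= 1.
    by rewrite divr_ge0//= ler_pdivrMr// mul1r ler_nat.
  apply: le_trans (phiL _ _ i01 u01) _; rewrite /K -mulrA -mulrDr ler_wpM2l//.
  have -> : i%:R / n%:R - u = (i%:R - n%:R * u) / n%:R by field; rewrite gt_eqF.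
  set w := _ / n%:R.
  have -> : e^-1 / 2 * n%:R^-1 ^+ 2 * (i%:R - n%:R * u) ^+ 2 = `|w| ^+ 2 / (2 * e).
    by rewrite real_normK ?num_real// /w; field; rewrite !gt_eqF.
  rewrite -subr_ge0 (_ : _ - _ = (e - `|w|) ^+ 2 / (2 * e)); last by field; rewrite gt_eqF.
  by rewrite divr_ge0 ?sqr_ge0// mulr_ge0// ltW.
have v : (bernstein n K).[u] <= L * e.
  rewrite /K bernsteinD bernstein_cst bernsteinZ bernstein_sqr subrr expr0n addr0.
  have -> : L * (e / 2) + L * (e^-1 / 2 * n%:R^-1 ^+ 2) * (n%:R * u * (1 - u)) =
     L * (e / 2 + e^-1 / 2 * n%:R^-1 * (u * (1 - u))) by field; rewrite !gt_eqF.
  rewrite ler_wpM2l//.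
  have h1 : e^-1 / 2 * n%:R^-1 <= e / 2.
    rewrite ler_pdivrMr//.
    have -> : e / 2 * n%:R = e^-1 / 2 * (e ^+ 2 * n%:R) by field; rewrite gt_eqF.
    rewrite -[leLHS]mulr1 ler_wpM2l// ?divr_ge0 ?invr_ge0 ?(ltW e0)//.
    by rewrite -ler_pdivrMl ?exprn_gt0// mulr1 -exprVn.
  have h2 : 0 <= u * (1 - u) by rewrite mulr_ge0// subr_ge0.
  have h3 : u * (1 - u) <= 1 by nra.
  have := ler_pM (ltac:(by rewrite !mulr_ge0 ?invr_ge0// ltW) : 0 <= e^-1 / 2 * n%:R^-1) h2 h1 h3.
  lra.
clearbody K.
have up : (bernstein n (fun i => phi (i%:R / n%:R))).[u] <= (bernstein n (fun i => phi u + K i)).[u].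
  by apply: le_bernstein => // i ni; have := key i ni; rewrite ler_norml => /andP[]; lra.
have lo : (bernstein n (fun i => phi u + -1 * K i)).[u] <= (bernstein n (fun i => phi (i%:R / n%:R))).[u].
  by apply: le_bernstein => // i ni; have := key i ni; rewrite ler_norml => /andP[]; lra.
rewrite bernsteinD bernstein_cst in up.
rewrite bernsteinD bernstein_cst bernsteinZ in lo.
by rewrite ler_norml; apply/andP; split; lra.
Qed.

End bernstein.

Lemma Rintegral_sum {R : realType} d (S : measurableType d)
    (mu : {measure set S -> \bar R}) (I : Type) (s : seq I) (f : I -> S -> R) :
  (forall i, mu.-integrable setT (EFin \o f i)) ->
  \int[mu]_x (\sum_(i <- s) f i x) = \sum_(i <- s) \int[mu]_x f i x.
Proof.
move=> fi.
suff [] : mu.-integrable setT (EFin \o (fun x => \sum_(i <- s) f i x)) /\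
  \int[mu]_x (\sum_(i <- s) f i x) = \sum_(i <- s) \int[mu]_x f i x by [].
elim: s => [|i s [IHi IHe]].
  split; first by under eq_fun do rewrite /= big_nil; exact: integrable0.
  under eq_Rintegral do rewrite big_nil.
  by rewrite big_nil Rintegral_cst// mul0r.
split.
  apply: eq_integrable (integrableD measurableT (fi i) IHi) => // x _ /=.
  by rewrite big_cons.
under eq_Rintegral do rewrite big_cons.
by rewrite RintegralD// IHe big_cons.
Qed.

Section prob_bounded.
Context {R : realType} d (S : measurableType d) (mu : {measure set S -> \bar R}).
Hypothesis mu1 : mu setT = 1%E.

Lemma prob_bounded_integrable (f : S -> R) (C : R) : measurable_fun setT f ->
  (forall x, `|f x| <= C) -> mu.-integrable setT (EFin \o f).
Proof.
move=> mf fC; apply: (@le_integrable _ _ _ mu setT measurableT _ (cst C%:E)).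
- exact/measurable_EFinP.
- by move=> x _ /=; rewrite lee_fin (le_trans (fC x))// ler_norm.
- apply/integrableP; split; first exact: measurable_cst.
  by rewrite integral_cst// mu1 mule1/= ltry.
Qed.

Lemma prob_Rintegral_cst (c : R) : \int[mu]_x c = c.
Proof. by rewrite Rintegral_cst// [fine _](_ : _ = 1) ?mulr1// mu1. Qed.

Lemma prob_Rintegral_bound (f g : S -> R) (C e : R) : measurable_fun setT f ->
  measurable_fun setT g -> (forall x, `|f x| <= C) -> (forall x, `|g x| <= C) ->
  (forall x, `|f x - g x| <= e) -> `|\int[mu]_x f x - \int[mu]_x g x| <= e.
Proof.
move=> mf mg fC gC fge.
have fi := prob_bounded_integrable mf fC; have gi := prob_bounded_integrable mg gC.
rewrite -RintegralB//.
have mfg : measurable_fun setT (fun x => f x - g x) by exact: measurable_funB.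
have fgi := prob_bounded_integrable mfg fge.
apply: le_trans (le_normr_Rintegral measurableT fgi) _.
rewrite -[leRHS]prob_Rintegral_cst; apply: le_Rintegral => //.
- exact: (@integrable_norm _ _ _ _ _ (fun x => f x - g x)).
- by apply: (@prob_bounded_integrable _ `|e|) => //; exact: measurable_cst.
Qed.

Lemma prob_Rintegral_horner (p : {poly R}) (U : S -> R) : measurable_fun setT U ->
  (forall x, 0 <= U x <= 1) ->
  \int[mu]_x p.[U x] = \sum_(i < size p) p`_i * \int[mu]_x U x ^+ i.
Proof.
move=> mU U01.
have iU i : mu.-integrable setT (EFin \o (fun x => U x ^+ i)).
  apply: (@prob_bounded_integrable _ 1) => [|x]; first exact: measurable_funX.
  have /andP[u0 u1] := U01 x.
  by rewrite ger0_norm ?exprn_ge0// exprn_ile1.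
under eq_Rintegral do rewrite horner_coef.
rewrite Rintegral_sum; last by move=> i; exact: integrableZ_EFin.
by apply: eq_bigr => i _; rewrite RintegralZl.
Qed.

Lemma horner_bounded (p : {poly R}) (u : R) : 0 <= u <= 1 ->
  `|p.[u]| <= \sum_(i < size p) `|p`_i|.
Proof.
move=> /andP[u0 u1]; rewrite horner_coef; apply: le_trans (ler_norm_sum _ _ _) _.
apply: ler_sum => i _; rewrite normrM ler_piMr// ger0_norm ?exprn_ge0//.
by rewrite exprn_ile1.
Qed.

End prob_bounded.

Section hausdorff.
Context {R : realType} d1 (S : measurableType d1) d2 (T : measurableType d2).
Variables (mu : {measure set S -> \bar R}) (nu : {measure set T -> \bar R}).
Variables (U : S -> R) (V : T -> R).
Hypotheses (mu1 : mu setT = 1%E) (nu1 : nu setT = 1%E).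
Hypotheses (mU : measurable_fun setT U) (mV : measurable_fun setT V).
Hypotheses (U01 : forall x, 0 <= U x <= 1) (V01 : forall x, 0 <= V x <= 1).
Hypothesis moments : forall n, \int[mu]_x U x ^+ n = \int[nu]_x V x ^+ n.

(** Moments determine the integrals of polynomials, and a Bernstein polynomial of [phi] is uniformly
    close to it. *)
Lemma hausdorff_lipschitz (phi : R -> R) (L : R) :
  continuous phi -> (forall x, 0 <= phi x <= 1) -> 0 <= L ->
  (forall x y, 0 <= x <= 1 -> 0 <= y <= 1 -> `|phi x - phi y| <= L * `|x - y|) ->
  \int[mu]_x phi (U x) = \int[nu]_x phi (V x).
Proof.
move=> cphi phi01 L0 phiL.
have mphi := continuous_measurable_fun cphi.
apply/eqP; rewrite -subr_eq0 -normr_le0; apply/ler_addgt0Pr => e e0; rewrite add0r.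
pose e' := e / (2 * (L + 1)).
have e'0 : 0 < e' by rewrite divr_gt0// mulr_gt0// ltr_wpDl.
pose n := Num.bound (e'^-1 ^+ 2).
have ne : e'^-1 ^+ 2 <= n%:R.
  by apply/ltW/archi_boundP; rewrite exprn_ge0// invr_ge0 ltW.
pose p := bernstein n (fun i => phi (i%:R / n%:R)).
have pb u : 0 <= u <= 1 -> `|p.[u] - phi u| <= L * e'.
  by move=> u01; exact: bernstein_lipschitz.
have Le : L * e' <= e / 2.
  have -> : e / 2 = (L + 1) * e' by rewrite /e'; field; rewrite gt_eqF// ltr_wpDl.
  by rewrite ler_wpM2r ?(ltW e'0)//; lra.
pose C := \sum_(i < size p) `|p`_i| + 1.
have C0 : 0 <= \sum_(i < size p) `|p`_i| by exact: sumr_ge0.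
have pC u : 0 <= u <= 1 -> `|p.[u]| <= C.
  by move=> u01; apply: le_trans (horner_bounded p u01) _; rewrite lerDl.
have phiC u : `|phi u| <= C.
  by have /andP[h1 h2] := phi01 u; rewrite ger0_norm// (le_trans h2)// lerDr.
have mp : measurable_fun setT (fun u : R => p.[u]).
  by apply: continuous_measurable_fun; exact: continuous_horner.
have E : \int[mu]_x p.[U x] = \int[nu]_x p.[V x].
  rewrite !prob_Rintegral_horner//; apply: eq_bigr => i _; by rewrite moments.
have b1 : `|\int[mu]_x p.[U x] - \int[mu]_x phi (U x)| <= L * e'.
  apply: (@prob_Rintegral_bound _ _ _ _ mu1 _ _ C) => [||x|x|x].
  - exact: (measurableT_comp mp mU).
  - exact: (measurableT_comp mphi mU).
  - exact: pC.
  - exact: phiC.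
  - exact: pb.
have b2 : `|\int[nu]_x p.[V x] - \int[nu]_x phi (V x)| <= L * e'.
  apply: (@prob_Rintegral_bound _ _ _ _ nu1 _ _ C) => [||x|x|x].
  - exact: (measurableT_comp mp mV).
  - exact: (measurableT_comp mphi mV).
  - exact: pC.
  - exact: phiC.
  - exact: pb.
rewrite E in b1; move: b1 b2; rewrite !ler_norml => /andP[b1 b1'] /andP[b2 b2'].
by apply/andP; split; lra.
Qed.

End hausdorff.

(** * Squared norms of Gaussian vectors *)

Section real_spectral.
Import mathcomp.real_closed.complex.
Context {R : realType}.
Local Notation C := (complex.complex R).
Local Notation toC := (complex.real_complex R : R -> C).

Lemma toC_conj (x : R) : (toC x)^* = toC x.
Proof. by apply/CrealP/complex_realP; exists x. Qed.

(** A complex eigenvalue exists and is real since [A] is symmetric; it is then a root of the real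
    characteristic polynomial, which provides a real eigenvector. *)
Lemma symmetric_eigenvector n (A : 'M[R]_n.+1) : A^T = A ->
  exists (v : 'rV[R]_n.+1) (a : R), v != 0 /\ v *m A = a *: v.
Proof.
move=> AT; have [a] := eigenvalue_closed (map_mx toC A) (ltn0Sn n).
move=> ea; have /eigenvalueP[v va v0] := ea.
have aR : a \is Num.real.
  (* [q] is the squared norm of [v]; both [q] and [a q], the Hermitian form of [A] at [v], are fixed
     by conjugation, hence so is [a]. *)
  pose q : C := \sum_i v 0 i * (v 0 i)^*.
  have q0 : q != 0.
    apply: contraNneq v0 => q0; apply/eqP/rowP => i; rewrite mxE.
    have /eqP := q0; rewrite psumr_eq0; last by move=> j _; rewrite mul_conjC_ge0.
    move=> /allP/(_ i (mem_index_enum _)) /=; by rewrite mul_conjC_eq0 => /eqP.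
  have qR : q^* = q.
    by rewrite rmorph_sum; apply: eq_bigr => i _; rewrite rmorphM /= conjCK mulrC.
  have aq : a * q = \sum_i \sum_j v 0 j * toC (A j i) * (v 0 i)^*.
    rewrite mulr_sumr; apply: eq_bigr => i _.
    have /rowP/(_ i) := va; rewrite !mxE => /esym e; rewrite mulrA e mulr_suml.
    by apply: eq_bigr => j _; rewrite mxE.
  have aqR : (a * q)^* = a * q.
    rewrite aq rmorph_sum exchange_big; apply: eq_bigr => i _ /=.
    rewrite rmorph_sum; apply: eq_bigr => j _ /=.
    rewrite !rmorphM /= conjCK toC_conj.
    have -> : A j i = A i j by rewrite -[in LHS]AT mxE.
    by rewrite mulrC [X in _ * X]mulrC mulrA.
  by apply/CrealP; apply: (mulIf q0); rewrite -[RHS]aqR rmorphM /= qR.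
have [x ax] : exists x : R, a = toC x by exists (complex.Re a); rewrite RRe_real.
have : root (char_poly (map_mx toC A)) a by rewrite -eigenvalue_root_char.
rewrite -map_char_poly ax fmorph_root -eigenvalue_root_char => /eigenvalueP[w wx w0].
by exists w, x.
Qed.

(** For [w != 0], the reflection across the hyperplane orthogonal to [w]. *)
Definition householder n (w : 'rV[R]_n) : 'M[R]_n :=
  1%:M - (2 / (w *m w^T) 0 0) *: (w^T *m w).

Lemma dot_gt0 n (w : 'rV[R]_n) : w != 0 -> 0 < (w *m w^T) 0 0.
Proof.
move=> w0; rewrite lt0r mxE; apply/andP; split.
  apply: contraNneq w0 => q0; apply/eqP/rowP => i; rewrite mxE.
  have /eqP := q0; rewrite psumr_eq0; last by move=> j _; rewrite mxE -expr2 sqr_ge0.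
  by move=> /allP/(_ i (mem_index_enum _)) /=; rewrite mxE -expr2 sqrf_eq0 => /eqP.
by apply: sumr_ge0 => i _; rewrite mxE -expr2 sqr_ge0.
Qed.

Lemma householderT n (w : 'rV[R]_n) : (householder w)^T = householder w.
Proof. by rewrite /householder linearB /= trmx1 linearZ /= trmx_mul trmxK. Qed.

Lemma householderK n (w : 'rV[R]_n) : w != 0 -> householder w *m householder w = 1%:M.
Proof.
move=> /dot_gt0 q0; rewrite /householder; set q := (_ 0 0) in q0 *.
have ww : w *m w^T = q%:M by exact: mx11_scalar.
rewrite mulmxBl mul1mx mulmxBr mulmx1 -scalemxAl -scalemxAr scalerA.
rewrite mulmxA -(mulmxA _ w) ww mul_mx_scalar -scalemxAl scalerA.
rewrite (_ : 2 / q * (2 / q) * q = 2 / q + 2 / q); last by field; rewrite gt_eqF.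
by rewrite scalerDl opprB addrK subrK.
Qed.

(** The reflection along [v - e], [e] the first basis vector, exchanges these two unit vectors. If
    [v = e] there is nothing to reflect along, and the identity serves. *)
Lemma orthogonal_first_row n (v : 'rV[R]_n.+1) : v *m v^T = 1%:M ->
  exists H : 'M[R]_n.+1, [/\ H^T = H, H *m H = 1%:M & delta_mx 0 0 *m H = v].
Proof.
move=> v1; have [->|vn] := eqVneq v (delta_mx 0 0).
  by exists 1%:M; rewrite trmx1 mulmx1 mulmx1.
pose w := v - delta_mx 0 0.
have w0 : w != 0 by rewrite subr_eq0.
exists (householder w); rewrite householderT householderK//; split => //.
have v11 : (v *m v^T) 0 0 = 1 by rewrite v1 mxE eqxx.
have e1 : (delta_mx 0 0 *m w^T : 'M[R]_1) = (v 0 0 - 1)%:M.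
  apply/matrixP => i j; rewrite !ord1 !mxE eqxx (bigD1 ord0)//= big1; last first.
    by move=> k k0; rewrite !mxE eqxx (negbTE k0) mul0r.
  by rewrite !mxE !eqxx mul1r addr0 mulr1n.
have e2 : (w *m w^T) 0 0 = 2 * (1 - v 0 0).
  rewrite {1}/w mulmxBl e1 mxE [X in _ + X]mxE [X in - X]mxE eqxx mulr1n.
  have -> : v *m w^T = (1 - v 0 0)%:M.
    rewrite /w linearB /= mulmxBr v1.
    apply/matrixP => i j; rewrite !ord1 !mxE eqxx (bigD1 ord0)//= big1; last first.
      by move=> k k0; rewrite !mxE (negbTE k0) andbF mulr0.
    by rewrite !mxE !eqxx addr0 mulr1 mulr1n.
  by rewrite mxE eqxx mulr1n; ring.
have q0 := dot_gt0 w0; rewrite e2 in q0.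
rewrite /householder e2 mulmxBr mulmx1 -scalemxAr mulmxA e1 mul_scalar_mx scalerA.
have -> : 2 / (2 * (1 - v 0 0)) * (v 0 0 - 1) = -1.
  by field; apply/eqP => h; rewrite h mulr0 ltxx in q0.
by rewrite scaleN1r opprK /w addrC subrK.
Qed.

(** Deflation: a reflection moves a unit eigenvector to the first basis vector; the conjugated
    matrix then has a first row proportional to it, by symmetry also such a first column, and the
    induction hypothesis diagonalises the remaining block. *)
Lemma real_spectral n (A : 'M[R]_n) : A^T = A ->
  exists (Q : 'M[R]_n) (l : 'rV[R]_n), Q *m Q^T = 1%:M /\ Q *m A *m Q^T = diag_mx l.
Proof.
elim: n A => [|n IH] A AT.
  by exists 1%:M, 0; split; apply/matrixP => -[].
have [u [a [u0 ua]]] := symmetric_eigenvector AT.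
have q0 := dot_gt0 u0; set q := (_ 0 0) in q0.
have sq : Num.sqrt q ^+ 2 = q by rewrite sqr_sqrtr// ltW.
have sq0 : Num.sqrt q != 0 by rewrite gt_eqF// sqrtr_gt0.
pose v := (Num.sqrt q)^-1 *: u.
have v1 : v *m v^T = 1%:M.
  rewrite /v linearZ /= -scalemxAl -scalemxAr scalerA [u *m _]mx11_scalar -/q.
  rewrite -scalemx1 scalerA (_ : _ * q = 1) ?scale1r//.
  by rewrite -[X in _ * X]sq; field.
have va : v *m A = a *: v by rewrite -scalemxAl ua scalerA mulrC -scalerA.
have [H [HT HH Hv]] := orthogonal_first_row v1.
pose B : 'M[R]_(1 + n) := H *m A *m H.
have BT : B^T = B by rewrite /B !trmx_mul HT AT mulmxA.
have vH : v *m H = delta_mx 0 0 by rewrite -Hv -mulmxA HH mulmx1.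
have B0 : delta_mx 0 0 *m B = a *: delta_mx 0 0 :> 'rV[R]_(1 + n).
  by rewrite /B !mulmxA Hv va -scalemxAl vH.
have B0j j : B 0 j = a * (j == 0)%:R.
  have /rowP/(_ j) := B0; rewrite -rowE !mxE eqxx/= eq_sym => ->.
  by [].
have BH : B = H *m A *m H by [].
clearbody B; pose B' := drsubmx B.
have BE : B = block_mx a%:M 0 0 B'.
  rewrite -[LHS]submxK; congr block_mx.
  - by apply/matrixP => i j; rewrite !ord1 !mxE lshift0 B0j eqxx mulr1 mulr1n.
  - apply/matrixP => i j; rewrite !ord1 !mxE lshift0 B0j.
    by rewrite (_ : _ == _ = false) ?mulr0//; exact/negbTE.
  - apply/matrixP => i j; rewrite !ord1 !mxE -BT mxE lshift0 B0j.
    by rewrite (_ : _ == _ = false) ?mulr0//; exact/negbTE.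
have B'T : B'^T = B' by rewrite /B' trmx_drsub BT.
have [Q' [l' [QQ' QB']]] := IH B' B'T.
pose K : 'M[R]_(1 + n) := block_mx 1%:M 0 0 Q'.
have KT : K^T = block_mx 1%:M 0 0 Q'^T by rewrite /K tr_block_mx trmx1 !trmx0.
have KK : K *m K^T = 1%:M.
  rewrite KT [LHS]mulmx_block.
  by rewrite !mulmx1 !mulmx0 !mul0mx !addr0 !add0r QQ' -scalar_mx_block.
have KBK : K *m B *m K^T = diag_mx (row_mx a%:M l').
  rewrite BE KT [X in X *m _]mulmx_block [LHS]mulmx_block.
  rewrite !mulmx1 !mul1mx !mulmx0 !mul0mx !addr0 !add0r !mul0mx ?mulmx0 QB'.
  by rewrite diag_mx_row; congr block_mx; apply/matrixP => i j; rewrite !ord1 !mxE eqxx.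
exists (K *m H), (row_mx a%:M l' : 'rV_(1 + n)); split.
  by rewrite trmx_mul HT mulmxA -(mulmxA K) HH mulmx1.
rewrite trmx_mul HT (_ : _ *m _ = K *m B *m K^T); last by rewrite BH !mulmxA.
exact: KBK.
Qed.

End real_spectral.

(** * Laws determined by their Laplace transforms *)

Section laplace.
Context {R : realType}.

Lemma ramp_lipschitz (k x y : R) : 0 < k -> `|ramp k x - ramp k y| <= k * `|x - y|.
Proof.
move=> k0; wlog xy : x y / y <= x.
  move=> H; have [/H//|/ltW/H] := leP y x.
  by rewrite distrC [`|x - y|]distrC.
have kxy : k * y <= k * x by rewrite ler_pM2l.
have m : ramp k y <= ramp k x.
  by rewrite /ramp le_max2 ?lexx// le_min2 ?lexx// lerD2r.
rewrite !ger0_norm ?subr_ge0// mulrBr.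
have [h|h] := leP 0 (k * x).
  rewrite [ramp k x]ramp1//; have [h2|h2] := leP 0 (k * y); first by rewrite ramp1//; lra.
  have : k * y + 1 <= ramp k y by rewrite /ramp le_max [Num.min _ _]min_r ?lexx ?orbT//; lra.
  lra.
have h1 : k * y < 0 by lra.
have [h2|h2] := leP (k * x) (-1).
  by rewrite [ramp k x]ramp0// [ramp k y]ramp0; lra.
have : k * y + 1 <= ramp k y by rewrite /ramp le_max [Num.min _ _]min_r ?lexx ?orbT//; lra.
have -> : ramp k x = k * x + 1 by rewrite /ramp min_r ?max_r//; lra.
lra.
Qed.

Lemma ln_lipschitz (d x y : R) : 0 < d -> d <= x -> d <= y ->
  `|ln x - ln y| <= d^-1 * `|x - y|.
Proof.
move=> d0; wlog xy : x y / y <= x.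
  move=> H dx dy; have [yx|/ltW xy] := leP y x; first exact: H.
  by rewrite distrC [`|x - y|]distrC; exact: H.
move=> dx dy; have x0 : 0 < x by exact: lt_le_trans dx.
have y0 : 0 < y by exact: lt_le_trans dy.
rewrite !ger0_norm ?subr_ge0// ?ler_ln ?posrE//.
rewrite -ln_div ?posrE//.
have -> : x / y = 1 + (x - y) / y by field; rewrite gt_eqF.
apply: le_trans (le_ln1Dx _) _.
  by apply: lt_le_trans (_ : -1 < 0) _; rewrite ?ltrN10// divr_ge0 ?subr_ge0// ltW.
by rewrite mulrC ler_wpM2r ?subr_ge0// lef_pV2 ?posrE.
Qed.

Section unique.
Context d1 (S : measurableType d1) d2 (T : measurableType d2).
Variables (mu : {measure set S -> \bar R}) (nu : {measure set T -> \bar R}).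
Variables (X : S -> R) (Y : T -> R).
Hypotheses (mu1 : mu setT = 1%E) (nu1 : nu setT = 1%E).
Hypotheses (mX : measurable_fun setT X) (mY : measurable_fun setT Y).
Hypotheses (X0 : forall x, 0 <= X x) (Y0 : forall x, 0 <= Y x).

(** The variables [exp (- X)] and [exp (- Y)] take values in the unit interval, and their moments
    are the Laplace transforms at the integers; it remains to write a ramp of [X] as a Lipschitz
    function of [exp (- X)]. *)
Lemma laplace_ramp :
  (forall n : nat, \int[mu]_x expR (- (n%:R * X x)) = \int[nu]_x expR (- (n%:R * Y x))) ->
  forall k c, 0 < k -> \int[mu]_x ramp k (X x - c) = \int[nu]_x ramp k (Y x - c).
Proof.
move=> L k c k0; set dl := expR (- c).
have dl0 : 0 < dl by exact: expR_gt0.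
(* Beyond [c] the ramp is constantly [1], so the logarithm may be cut off at [exp (- c)]; this
   removes its singularity at [0] and makes [phi] Lipschitz. *)
pose phi u := ramp k (- ln (Num.max u dl) - c).
have max0 u : dl <= Num.max u dl by rewrite le_max lexx orbT.
have phiE x : phi (expR (- x)) = ramp k (x - c).
  rewrite /phi; have [h|h] := leP (expR (- x)) dl.
    have : c <= x by move: h; rewrite ler_expR; lra.
    by rewrite /dl expRK opprK subrr => cx; rewrite !ramp1 ?mulr0// mulr_ge0 ?(ltW k0)// subr_ge0.
  by rewrite expRK opprK.
have cphi : continuous phi.
  move=> u; apply: (@continuous_comp _ _ _ (fun u => - ln (Num.max u dl) - c) (ramp k)); last exact: continuous_ramp.
  apply: cvgB; last exact: cvg_cst.
  apply: cvgN; apply: (@continuous_comp _ _ _ (fun u => Num.max u dl) (@ln R)).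
    by apply: (@continuous_max _ _ (fun u : R => u) (fun=> dl)); [exact: cvg_id|exact: cvg_cst].
  by apply: continuous_ln; exact: lt_le_trans (max0 u).
have phiL x y : 0 <= x <= 1 -> 0 <= y <= 1 -> `|phi x - phi y| <= k / dl * `|x - y|.
  move=> _ _; apply: le_trans (ramp_lipschitz _ _ k0) _.
  rewrite -mulrA ler_wpM2l ?(ltW k0)//.
  have -> : - ln (Num.max x dl) - c - (- ln (Num.max y dl) - c) = - (ln (Num.max x dl) - ln (Num.max y dl)) by ring.
  rewrite normrN; apply: le_trans (ln_lipschitz dl0 (max0 x) (max0 y)) _.
  rewrite ler_wpM2l ?invr_ge0 ?(ltW dl0)//.
  by case: (leP x dl) => hx; case: (leP y dl) => hy; rewrite ?subrr ?normr0//;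
    rewrite !ler_norml; apply/andP; split; have := ler_norm (x - y); have := ler_norm (y - x);
    rewrite [`|y - x|]distrC; lra.
have H := @hausdorff_lipschitz R _ S _ T mu nu (fun x => expR (- X x)) (fun x => expR (- Y x)) mu1 nu1.
transitivity (\int[mu]_x phi (expR (- X x))); first by apply: eq_Rintegral => x _; rewrite phiE.
transitivity (\int[nu]_x phi (expR (- Y x))); last by apply: eq_Rintegral => x _; rewrite phiE.
apply: H phiL => //.
- by apply: measurableT_comp => //; exact: measurableT_comp.
- by apply: measurableT_comp => //; exact: measurableT_comp.
- by move=> x; rewrite expR_ge0/= -[leRHS]expR0 ler_expR oppr_le0.
- by move=> x; rewrite expR_ge0/= -[leRHS]expR0 ler_expR oppr_le0.
- move=> n; transitivity (\int[mu]_x expR (- (n%:R * X x))).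
    by apply: eq_Rintegral => x _; rewrite -expRM_natl mulrN.
  by rewrite L; apply: eq_Rintegral => x _; rewrite -expRM_natl mulrN.
- by move=> u; exact: ramp_itv.
- by rewrite divr_ge0// ltW.
Qed.

End unique.
End laplace.

(** * Gaussian variables and vectors *)

Section gaussian_rv.
Context {R : realType} d (U : measurableType d) (P : probability U R).

(** Both branches of [gaussian_law], the point mass included, are images of the standard law under
    [x |-> m + |s| x]. *)
Lemma gaussian_rv_integral (Y : U -> R) : gaussian_rv P Y -> measurable_fun setT Y ->
  exists m s : R, forall g : R -> R, continuous g -> (forall x, 0 <= g x) ->
    (\int[P]_w (g (Y w))%:E = \int[gauss R]_x (g (m + s * x))%:E)%E.
Proof.
move=> [m [s law]] mY; exists m, `|s| => g cg g0.
have mg := continuous_measurable_fun cg.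
have push (nu : {measure set (measurableTypeR R) -> \bar R}) :
    (forall A, measurable A -> P (Y @^-1` A) = nu A) ->
    (\int[P]_w (g (Y w))%:E = \int[nu]_x (g x)%:E)%E.
  move=> nuE; transitivity (\int[pushforward P (Y : U -> measurableTypeR R)]_x (g x)%:E)%E.
    rewrite ge0_integral_pushforward//; first exact/measurable_EFinP.
    by move=> x _; rewrite lee_fin.
  by apply: eq_measure_integral => A mA _; rewrite -nuE.
have [s0|s0] := eqVneq s 0.
  rewrite (@push (@dirac _ (measurableTypeR R) m R)).
    rewrite integral_dirac//; last exact/measurable_EFinP.
    transitivity (\int[gauss R]_x (g m)%:E)%E; first by rewrite integral_gauss_cst diracT mul1e.
    by apply: eq_integral => x _; rewrite s0 normr0 mul0r addr0.
  by move=> A mA; rewrite law// /gaussian_law s0 eqxx.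
rewrite (@push (normal_prob m s)); first exact: ge0_integral_normal_gauss.
by move=> A mA; rewrite law// /gaussian_law (negbTE s0).
Qed.

Lemma gauss_affine (m s : R) : \int[gauss R]_x (m + s * x) = m.
Proof.
have ix : (gauss R).-integrable setT (EFin \o (fun x : R => x)).
  apply: (@gauss_integrable_poly _ 1 _ 1) => [|x]; first exact: measurable_id.
  by rewrite expr1 mul1r lerDr.
rewrite RintegralD//; last 2 first.
- exact: finite_measure_integrable_cst.
- exact: integrableZ_EFin.
rewrite RintegralZl// gauss_cst.
have E := @gauss_ibp R (fun=> 1) (fun=> 0) 1 0.
have : \int[gauss R]_x (x * 1) = \int[gauss R]_x 0.
  apply: E.
  - by move=> x; exact: cvg_cst.
  - by move=> x; rewrite expr0 mulr1 normr1.
  - by move=> x; rewrite expr0 mulr1 normr0.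
under eq_Rintegral do rewrite mulr1.
by move=> ->; rewrite gauss_cst mulr0 addr0.
Qed.

(** [1 + cos] gives access to the characteristic function through a nonnegative integrand, the only
    kind [gaussian_rv_integral] handles. For the same reason [m = 0] is derived from the positive
    and negative parts of [Y]. *)
Lemma gaussian_rv_centred (Y : U -> R) : gaussian_rv P Y -> measurable_fun setT Y ->
  (\int[P]_w (Y w)%:E = 0)%E ->
  exists2 s : R, (\int[P]_w (Y w ^+ 2)%:E = (s ^+ 2)%:E)%E &
    (\int[P]_w (1 + cos (Y w))%:E = (1 + expR (- (s ^+ 2 / 2)))%:E)%E.
Proof.
move=> gY mY EY; have [m [s H]] := gaussian_rv_integral gY mY.
have m0 : m = 0.
  suff : m%:E = (\int[P]_w (Y w)%:E)%E by rewrite EY => -[].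
  rewrite -[m in LHS](gauss_affine m s) EFin_Rintegral; last first.
    apply: (@gauss_integrable_poly _ 1 _ (`|m| + `|s|)) => [|x].
      by apply: measurable_funD => //; apply: measurable_funM => //; exact: measurable_id.
    rewrite expr1 (le_trans (ler_normD _ _))// normrM mulrDl !mulrDr !mulr1.
    have := mulr_ge0 (normr_ge0 m) (normr_ge0 x); have := normr_ge0 s; lra.
  rewrite [LHS]integralE [RHS]integralE; congr (_ - _)%E.
    transitivity (\int[gauss R]_x (Num.max (m + s * x) 0)%:E)%E.
      by apply: eq_integral => x _; rewrite funeposE EFin_max.
    rewrite -(H (fun y => Num.max y 0)).
    - by apply: eq_integral => x _; rewrite funeposE EFin_max.
    - by move=> y; apply: (@continuous_max _ _ (fun y : R => y) (fun=> 0)); [exact: cvg_id|exact: cvg_cst].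
    - by move=> y; rewrite le_max lexx orbT.
  transitivity (\int[gauss R]_x (Num.max (- (m + s * x)) 0)%:E)%E.
    by apply: eq_integral => x _; rewrite funenegE EFin_max.
  rewrite -(H (fun y => Num.max (- y) 0)).
  - by apply: eq_integral => x _; rewrite funenegE EFin_max.
  - move=> y; apply: (@continuous_max _ _ (fun y : R => - y) (fun=> 0)); last exact: cvg_cst.
    by apply: cvgN; exact: cvg_id.
  - by move=> y; rewrite le_max lexx orbT.
exists s.
  rewrite (H (fun y => y ^+ 2)); last 2 first.
  - by move=> y; exact: exprn_continuous.
  - by move=> y; exact: sqr_ge0.
  transitivity (\int[gauss R]_x ((s ^+ 2)%:E * (x ^+ 2)%:E))%E.
    by apply: eq_integral => x _; rewrite m0 add0r exprMn EFinM.
  rewrite ge0_integralZl//.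
  - by rewrite gauss_sqr mule1.
  - by apply/measurable_EFinP; exact: measurable_funX.
  - by move=> x _; rewrite lee_fin sqr_ge0.
  - by rewrite lee_fin sqr_ge0.
rewrite (H (fun y => 1 + cos y)); last 2 first.
- by move=> y; apply: cvgD; [exact: cvg_cst|exact: continuous_cos].
- by move=> y; have := cos_geN1 y; lra.
have mc : measurable_fun setT (fun x : R => cos (m + s * x)).
  apply: measurableT_comp; first by apply: continuous_measurable_fun; exact: continuous_cos.
  by apply: measurable_funD => //; apply: measurable_funM => //; exact: measurable_id.
have ic : (gauss R).-integrable setT (EFin \o (fun x : R => cos (m + s * x))).
  apply: (@gauss_integrable_poly _ 0 _ 1) => [|x]; first exact: mc.
  by rewrite expr0 mulr1 ler_norml cos_geN1 cos_le1.
rewrite -EFin_Rintegral; last first.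
  apply: (@gauss_integrable_poly _ 0 _ 2) => [|x]; first exact: measurable_funD.
  rewrite expr0 mulr1 ler_norml; have := cos_geN1 (m + s * x); have := cos_le1 (m + s * x).
  by move=> *; apply/andP; split; lra.
rewrite RintegralD//; last exact: finite_measure_integrable_cst.
rewrite gauss_cst; congr (_ + _)%:E.
have := gauss_cos s 0; rewrite cos0 mulr1 => <-.
by apply: eq_Rintegral => x _; rewrite m0 add0r addr0.
Qed.

End gaussian_rv.

Lemma integrable_sumR {R : realType} d (S : measurableType d)
    (mu : {measure set S -> \bar R}) (I : Type) (s : seq I) (f : I -> S -> R) :
  (forall i, mu.-integrable setT (EFin \o f i)) ->
  mu.-integrable setT (EFin \o (fun x => \sum_(i <- s) f i x)).
Proof.
move=> fi; elim: s => [|i s IH].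
  by under eq_fun do rewrite /= big_nil; exact: integrable0.
apply: eq_integrable (integrableD measurableT (fi i) IH) => // x _ /=.
by rewrite big_cons.
Qed.

Section square_integrable.
Context {R : realType} d (U : measurableType d) (P : probability U R).
Implicit Types X Y : U -> R.

Lemma sqr_integrable X (v : R) : measurable_fun setT X ->
  (\int[P]_w (X w * X w)%:E = v%:E)%E ->
  P.-integrable setT (EFin \o (fun w => X w ^+ 2)).
Proof.
move=> mX Xv; apply/integrableP; split; first by apply/measurable_EFinP; exact: measurable_funX.
rewrite (_ : (\int[_]_w _)%E = v%:E) ?ltry//.
by rewrite -Xv; apply: eq_integral => w _ /=; rewrite ger0_norm ?sqr_ge0// expr2.
Qed.

Lemma mul_integrable X Y : measurable_fun setT X -> measurable_fun setT Y ->
  P.-integrable setT (EFin \o (fun w => X w ^+ 2)) ->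
  P.-integrable setT (EFin \o (fun w => Y w ^+ 2)) ->
  P.-integrable setT (EFin \o (fun w => X w * Y w)).
Proof.
move=> mX mY iX iY.
apply: (@le_integrable _ _ _ P setT measurableT _ (EFin \o (fun w => X w ^+ 2 + Y w ^+ 2))).
- by apply/measurable_EFinP; exact: measurable_funM.
- move=> w _ /=; rewrite lee_fin normrM [leRHS]ger0_norm ?addr_ge0 ?sqr_ge0//.
  rewrite -[X w ^+ 2]real_normK ?num_real// -[Y w ^+ 2]real_normK ?num_real//.
  by have := normr_ge0 (X w); have := normr_ge0 (Y w); nra.
- by apply: eq_integrable (integrableD measurableT iX iY).
Qed.

Lemma integrable_of_sqr X : measurable_fun setT X ->
  P.-integrable setT (EFin \o (fun w => X w ^+ 2)) -> P.-integrable setT (EFin \o X).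
Proof.
move=> mX iX; have i1 : P.-integrable setT (EFin \o (fun=> 1 : R)) by exact: finite_measure_integrable_cst.
have m1 : measurable_fun setT (fun _ : U => 1 : R) by exact: measurable_cst.
apply: eq_integrable (mul_integrable m1 mX _ iX) => //.
- by move=> w _ /=; rewrite mul1r.
- by apply: eq_integrable i1 => // w _ /=; rewrite expr1n.
Qed.

End square_integrable.

Section gaussian_vector.
Context {R : realType} d (U : measurableType d) (P : probability U R).
Variables (n : nat) (X : 'I_n -> U -> R) (A : 'M[R]_n).
Hypotheses (mX : forall i, measurable_fun setT (X i))
  (gX : forall c : 'I_n -> R, gaussian_rv P (fun w => \sum_i c i * X i w))
  (EX : forall i, (\int[P]_w (X i w)%:E = 0)%E)
  (VX : forall i j, (\int[P]_w (X i w * X j w)%:E = (A i j)%:E)%E).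

Let mlin (c : 'I_n -> R) : measurable_fun setT (fun w => \sum_i c i * X i w).
Proof. by apply: measurable_sum => i; exact: measurable_funM. Qed.

Let iX2 i : P.-integrable setT (EFin \o (fun w => X i w ^+ 2)).
Proof. exact: sqr_integrable (VX i i). Qed.

Let iXX i j : P.-integrable setT (EFin \o (fun w => X i w * X j w)).
Proof. exact: mul_integrable. Qed.

Let iX i : P.-integrable setT (EFin \o X i).
Proof. exact: integrable_of_sqr. Qed.

Definition cov_form (c : 'I_n -> R) : R := \sum_i \sum_j c i * c j * A i j.

Lemma lin_second_moment (c : 'I_n -> R) :
  (\int[P]_w ((\sum_i c i * X i w) ^+ 2)%:E = (cov_form c)%:E)%E.
Proof.
have E w : (\sum_i c i * X i w) ^+ 2 = \sum_i \sum_j c i * c j * (X i w * X j w).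
  rewrite expr2 mulr_suml; apply: eq_bigr => i _; rewrite mulr_sumr.
  by apply: eq_bigr => j _; ring.
have ij i j : P.-integrable setT (EFin \o (fun w => c i * c j * (X i w * X j w))).
  exact: integrableZ_EFin.
have isum i : P.-integrable setT (EFin \o (fun w => \sum_j c i * c j * (X i w * X j w))).
  exact: integrable_sumR.
have isum2 : P.-integrable setT (EFin \o (fun w => \sum_i \sum_j c i * c j * (X i w * X j w))).
  exact: integrable_sumR.
under eq_integral do rewrite E.
rewrite -EFin_Rintegral// Rintegral_sum//; congr EFin; apply: eq_bigr => i _.
rewrite Rintegral_sum//; apply: eq_bigr => j _; rewrite RintegralZl//.
by congr (_ * _); rewrite /Rintegral VX.
Qed.

Lemma lin_mean (c : 'I_n -> R) : (\int[P]_w (\sum_i c i * X i w)%:E = 0)%E.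
Proof.
have ij i : P.-integrable setT (EFin \o (fun w => c i * X i w)) by exact: integrableZ_EFin.
have isum : P.-integrable setT (EFin \o (fun w => \sum_i c i * X i w)).
  exact: integrable_sumR.
rewrite -EFin_Rintegral// Rintegral_sum// big1// => i _.
by rewrite RintegralZl// /Rintegral EX mulr0.
Qed.

Lemma cov_form_ge0 c : 0 <= cov_form c.
Proof.
by rewrite -lee_fin -lin_second_moment; apply: integral_ge0 => w _; rewrite lee_fin sqr_ge0.
Qed.

Lemma lin_cos (c : 'I_n -> R) :
  (\int[P]_w (1 + cos (\sum_i c i * X i w))%:E = (1 + expR (- (cov_form c / 2)))%:E)%E.
Proof.
have [s s2 ->] := gaussian_rv_centred (gX c) (mlin c) (lin_mean c).
by move: s2; rewrite lin_second_moment => -[->].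
Qed.

Variables (Q : 'M[R]_n) (l : 'rV[R]_n).
Hypotheses (QQ : Q *m Q^T = 1%:M) (QA : Q *m A *m Q^T = diag_mx l).

Lemma cov_formE (c : 'rV[R]_n) : cov_form (fun i => c 0 i) = (c *m A *m c^T) 0 0.
Proof.
rewrite mxE /cov_form exchange_big; apply: eq_bigr => j _ /=.
by rewrite !mxE mulr_suml; apply: eq_bigr => i _; ring.
Qed.

Lemma cov_form_spectral (t : 'rV[R]_n) :
  cov_form (fun i => (t *m Q) 0 i) = \sum_i l 0 i * t 0 i ^+ 2.
Proof.
rewrite (cov_formE (t *m Q)) trmx_mul !mulmxA -(mulmxA t) -(mulmxA t) QA mxE.
by apply: eq_bigr => i _; rewrite mul_mx_diag !mxE; ring.
Qed.

Lemma spectral_ge0 i : 0 <= l 0 i.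
Proof.
have := cov_form_ge0 (fun j => ((delta_mx 0 i : 'rV[R]_n) *m Q) 0 j).
rewrite cov_form_spectral (bigD1 i)//= big1 ?addr0.
  by rewrite mxE !eqxx expr1n mulr1.
by move=> j ji; rewrite mxE (negbTE ji) andbF expr0n mulr0.
Qed.

Let Z i w := \sum_j Q i j * X j w.

Let Z2 w : \sum_i Z i w ^+ 2 = \sum_i X i w ^+ 2.
Proof.
pose x : 'cV[R]_n := \col_j X j w.
have ZE i : Z i w = (Q *m x) i 0 by rewrite mxE; apply: eq_bigr => j _; rewrite mxE.
have nE (y : 'cV[R]_n) : \sum_i y i 0 ^+ 2 = (y^T *m y) 0 0.
  by rewrite mxE; apply: eq_bigr => i _; rewrite mxE expr2.
under eq_bigr do rewrite ZE.
rewrite nE trmx_mul mulmxA -(mulmxA x^T) (mulmx1C QQ) mulmx1 -nE.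
by apply: eq_bigr => i _; rewrite mxE.
Qed.

Let tcos tau : 0 <= tau ->
  (\int[P]_w \int[gaussn R n]_t (1 + cos (\sum_i Num.sqrt (2 * tau) * Z i w * tnth t i + 0))%:E =
   \int[gaussn R n]_t \int[P]_w (1 + cos (\sum_i Num.sqrt (2 * tau) * Z i w * tnth t i + 0))%:E)%E.
Proof.
move=> tau0.
apply: (fubini_tonelli (fun wt : U * n.-tuple (measurableTypeR R) =>
  (1 + cos (\sum_i Num.sqrt (2 * tau) * Z i wt.1 * tnth wt.2 i + 0))%:E)); last first.
  by move=> wt; rewrite lee_fin; have := cos_geN1 (\sum_i Num.sqrt (2 * tau) * Z i wt.1 * tnth wt.2 i + 0); lra.
apply/measurable_EFinP; apply: measurable_funD; first exact: measurable_cst.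
apply: measurableT_comp; first by apply: continuous_measurable_fun; exact: continuous_cos.
apply: measurable_funD; last exact: measurable_cst.
apply: measurable_sum => i; apply: measurable_funM.
  apply: measurable_funM; first exact: measurable_cst.
  exact: (measurableT_comp (mlin (Q i)) measurable_fst).
exact: (measurableT_comp (measurable_tnth i) measurable_snd).
Qed.

(** Gaussian randomisation: [exp (- tau |X|^2)] is the mean of [cos (sqrt (2 tau) <Z, t>)] over a
    standard Gaussian vector [t], where [Z] is [X] in the eigenbasis and has the same norm.
    Integrating over [P] first produces the characteristic function of [X], known from the
    covariance, at a multiple of [t]. The argument uses no density, so a singular [A] causes no
    trouble; adding [1] to the cosine makes Tonelli's theorem applicable. *)
Lemma gaussian_vector_laplace tau : 0 <= tau ->
  \int[P]_w expR (- (tau * \sum_i X i w ^+ 2)) =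
  \int[gaussn R n]_t expR (- (tau * qform (fun i => l 0 i) t)).
Proof.
move=> tau0; have st : Num.sqrt (2 * tau) ^+ 2 = 2 * tau by rewrite sqr_sqrtr// mulr_ge0.
have mS : measurable_fun setT (fun w => \sum_i X i w ^+ 2).
  by apply: measurable_sum => i; exact: measurable_funX.
have mE : measurable_fun setT (fun w => expR (- (tau * \sum_i X i w ^+ 2))).
  by apply: measurableT_comp => //; apply: measurableT_comp => //; exact: measurable_funM.
have e1 (x : R) : 0 <= x -> `|expR (- (tau * x))| <= 1.
  by move=> x0; rewrite ger0_norm ?expR_ge0// -[leRHS]expR0 ler_expR oppr_le0 mulr_ge0.
have P1 : P setT = 1%E by exact: probability_setT.
have iE := prob_bounded_integrable P1 mE (fun w => e1 _ (sumr_ge0 _ (fun i _ => sqr_ge0 (X i w)))).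
have mG : measurable_fun setT (fun t : n.-tuple (measurableTypeR R) => expR (- (tau * qform (fun i => l 0 i) t))).
  apply: measurableT_comp => //; apply: measurableT_comp => //; apply: measurable_funM => //.
  exact: measurable_qform.
have iG := @gaussn_bounded_integrable R n _ 1 mG (fun t => e1 _ (qform_ge0 t spectral_ge0)).
have icst (c : R) : P.-integrable setT (EFin \o (fun=> c : R)) by exact: finite_measure_integrable_cst.
have igcst (c : R) : (gaussn R n).-integrable setT (EFin \o (fun=> c : R)).
  by apply: (@gaussn_bounded_integrable _ _ _ `|c|) => //; exact: measurable_cst.
have := tcos tau0.
rewrite [LHS](_ : _ = \int[P]_w (1 + expR (- (tau * \sum_i X i w ^+ 2)))%:E)%E; last first.
  apply: eq_integral => w _; rewrite -Z2.
  have mc : measurable_fun setT (fun t : n.-tuple (measurableTypeR R) => cos (\sum_i Num.sqrt (2 * tau) * Z i w * tnth t i + 0)).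
    apply: measurableT_comp; first by apply: continuous_measurable_fun; exact: continuous_cos.
    apply: measurable_funD; last exact: measurable_cst.
    by apply: measurable_sum => i; apply: measurable_funM => //; exact: measurable_tnth.
  have ic : (gaussn R n).-integrable setT (EFin \o (fun t => cos (\sum_i Num.sqrt (2 * tau) * Z i w * tnth t i + 0))).
    by apply: (@gaussn_bounded_integrable _ _ _ 1) => // t; rewrite ler_norml cos_geN1 cos_le1.
  under eq_integral do rewrite EFinD.
  rewrite integralD//; last exact: igcst.
  rewrite gaussn_cst gaussn_cos cos0 mulr1 -EFinD; congr (1 + expR (- _))%:E.
  by rewrite mulr_suml mulr_sumr; apply: eq_bigr => i _; rewrite exprMn st; field.
rewrite [RHS](_ : _ = \int[gaussn R n]_t (1 + expR (- (tau * qform (fun i => l 0 i) t)))%:E)%E; last first.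
  apply: eq_integral => t _.
  pose c : 'rV[R]_n := Num.sqrt (2 * tau) *: (\row_i tnth t i).
  rewrite (_ : tau * _ = cov_form (fun i => (c *m Q) 0 i) / 2).
    rewrite -lin_cos; apply: eq_integral => w _; congr (1 + cos _)%:E.
    rewrite addr0 /Z.
    under eq_bigr do rewrite mulr_sumr mulr_suml.
    rewrite exchange_big; apply: eq_bigr => j _ /=; rewrite mxE mulr_suml.
    by apply: eq_bigr => i _; rewrite !mxE; ring.
  rewrite cov_form_spectral mulr_suml mulr_sumr; apply: eq_bigr => i _.
  by rewrite !mxE exprMn st; field.
rewrite -!EFin_Rintegral => [||]; last 2 first.
- by apply: eq_integrable (integrableD measurableT (igcst 1) iG).
- by apply: eq_integrable (integrableD measurableT (icst 1) iE).
move=> []; rewrite !RintegralD//.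
rewrite !prob_Rintegral_cst//; last exact: gaussn_setT.
by move/addrI.
Qed.

End gaussian_vector.

(** The rows of [Q] are eigenvectors: the eigenvalue equation for row [i], read at its entry of
    largest modulus, bounds the eigenvalue by an absolute column sum of [A]. *)
Lemma spectral_row_bound {R : realType} n (A Q : 'M[R]_n) (l : 'rV[R]_n) (B : R) :
  Q *m Q^T = 1%:M -> Q *m A *m Q^T = diag_mx l ->
  (forall j, \sum_i `|A i j| <= B) -> forall i, `|l 0 i| <= B.
Proof.
move=> QQ QA AB i.
have QAl : Q *m A = diag_mx l *m Q by rewrite -QA -mulmxA (mulmx1C QQ) mulmx1.
have [j _ jmax] := @arg_maxP _ _ _ i xpredT (fun j => `|Q i j|) isT.
have Qij : 0 < `|Q i j|.
  rewrite normr_gt0; apply/eqP => Q0.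
  have /matrixP/(_ i i) := QQ; rewrite !mxE eqxx big1 => [/eqP|k _].
    by rewrite eq_sym oner_eq0.
  have := jmax k isT; rewrite Q0 normr0 => h.
  by rewrite mxE (_ : Q i k = 0) ?mul0r//; apply/eqP; rewrite -normr_le0.
rewrite -(ler_pM2r Qij) -normrM.
have -> : l 0 i * Q i j = \sum_k Q i k * A k j.
  by have /matrixP/(_ i j) := QAl; rewrite mul_diag_mx !mxE => ->.
apply: le_trans (ler_norm_sum _ _ _) _.
apply: (@le_trans _ _ (\sum_k `|Q i j| * `|A k j|)).
  by apply: ler_sum => k _; rewrite normrM ler_wpM2r//; exact: jmax.
by rewrite -mulr_sumr mulrC ler_wpM2r.
Qed.

Section gaussian_vector_chaos.
Context {R : realType} d (U : measurableType d) (P : probability U R).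
Variables (n : nat) (X : 'I_n -> U -> R) (A : 'M[R]_n) (B : R).
Hypotheses (mX : forall i, measurable_fun setT (X i))
  (gX : forall c : 'I_n -> R, gaussian_rv P (fun w => \sum_i c i * X i w))
  (EX : forall i, (\int[P]_w (X i w)%:E = 0)%E)
  (VX : forall i j, (\int[P]_w (X i w * X j w)%:E = (A i j)%:E)%E)
  (AB : forall j, \sum_i `|A i j| <= B).

(** The weights are the eigenvalues of the covariance matrix, so their sum and their sum of squares
    are the traces of [A] and of [A^2]; the equality of laws is that of Laplace transforms. *)
Lemma gaussian_vector_sqr_law : exists l : 'I_n -> R,
  [/\ forall i, 0 <= l i <= B, \sum_i l i = \sum_i A i i,
    \sum_i l i ^+ 2 = \sum_i \sum_j A i j ^+ 2 &
    forall k c, 0 < k -> \int[P]_w ramp k (\sum_i X i w ^+ 2 - c) =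
      \int[gaussn R n]_t ramp k (qform l t - c)].
Proof.
have AT : A^T = A.
  apply/matrixP => i j; rewrite mxE; apply: EFin_inj; rewrite -!VX.
  by apply: eq_integral => w _; rewrite mulrC.
have [Q [l [QQ QA]]] := real_spectral AT.
have l0 := spectral_ge0 mX VX QA.
exists (fun i => l 0 i); split.
- move=> i; rewrite l0/=; have := spectral_row_bound QQ QA AB i.
  by rewrite ger0_norm.
- have : \tr (Q *m A *m Q^T) = \tr A by rewrite mxtrace_mulC mulmxA (mulmx1C QQ) mul1mx.
  by rewrite QA mxtrace_diag.
- have : \tr (diag_mx l *m diag_mx l) = \tr (A *m A).
    rewrite -QA !mulmxA -(mulmxA _ Q^T Q) (mulmx1C QQ) mulmx1 mxtrace_mulC.
    by rewrite !mulmxA (mulmx1C QQ) mul1mx.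
  rewrite mulmx_diag mxtrace_diag => E.
  transitivity (\sum_i (\row_j (l 0 j * l 0 j)) 0 i : R).
    by apply: eq_bigr => i _; rewrite mxE expr2.
  rewrite E /mxtrace; apply: eq_bigr => i _; rewrite mxE; apply: eq_bigr => j _.
  by rewrite expr2; congr (_ * _); rewrite -[in LHS]AT mxE.
apply: laplace_ramp.
- exact: probability_setT.
- exact: gaussn_setT.
- by apply: measurable_sum => i; exact: measurable_funX.
- exact: measurable_qform.
- by move=> w; apply: sumr_ge0 => i _; exact: sqr_ge0.
- by move=> t; exact: qform_ge0.
- move=> k; exact: (gaussian_vector_laplace mX gX EX VX QQ QA).
Qed.

Lemma gaussian_vector_chaos (s : R) : 0 < s -> s ^+ 2 = \sum_i \sum_j A i j ^+ 2 ->
  exists a : 'I_n -> R, [/\ \sum_i a i ^+ 2 = 1, forall i, `|a i| <= B / s &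
    forall k z, 0 < k ->
      \int[gaussn R n]_t ramp k (qform a t - \sum_i a i - z) =
      \int[P]_w ramp k ((\sum_i X i w ^+ 2 - \sum_i A i i) / s - z)].
Proof.
move=> s0 s2; have [l [lB l1 l2 law]] := gaussian_vector_sqr_law.
exists (fun i => l i / s); split.
- under eq_bigr do rewrite exprMn.
  by rewrite -mulr_suml l2 -s2 exprVn divff// expf_neq0// gt_eqF.
- move=> i; have /andP[li0 liB] := lB i.
  by rewrite ger0_norm ?divr_ge0 ?(ltW s0)// ler_wpM2r// invr_ge0 ltW.
move=> k z k0; have ks : 0 < k / s by rewrite divr_gt0.
(* An affine normalisation only changes the slope and the threshold of a ramp. *)
have E y : ramp k ((y - \sum_i A i i) / s - z) = ramp (k / s) (y - (\sum_i A i i + s * z)).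
  by rewrite /ramp; congr (Num.max _ (Num.min _ (_ + _))); field; rewrite gt_eqF.
under [RHS]eq_Rintegral do rewrite E.
rewrite law//; apply: eq_Rintegral => t _; rewrite -E -l1; congr (ramp k (_ - z)).
rewrite -mulr_suml mulrBl; congr (_ - _).
by rewrite /qform mulr_suml; apply: eq_bigr => i _; rewrite mulrAC.
Qed.

End gaussian_vector_chaos.

(** * Riemann sums of the Brownian sheet *)

Section ar_matrix.
Context {R : realType}.

(* Covariance of the variables sqrt (1 - r^2) r^(-i) W (r^(2 i)), W a Brownian
   motion. *)
Definition ar (r : R) (i j : nat) : R := (1 - r ^+ 2) * r ^+ ((i - j) + (j - i)).

Lemma ar_diag r i : ar r i i = 1 - r ^+ 2.
Proof. by rewrite /ar subnn addn0 expr0 mulr1. Qed.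

Lemma arC r i j : ar r i j = ar r j i.
Proof. by rewrite /ar addnC. Qed.

Lemma sum_ar_last r N : \sum_(i < N) ar r i N ^+ 2 =
  (1 - r ^+ 2) * (r ^+ 2) * (1 - (r ^+ 2) ^+ N).
Proof.
set q := r ^+ 2; have E i : (i <= N)%N -> ar r i N ^+ 2 = (1 - q) ^+ 2 * q ^+ (N - i).
  move=> iN; rewrite /ar exprMn (eqP (_ : i - N == 0)%N) ?subn_eq0// add0n.
  by rewrite -!exprM mulnC.
under eq_bigr => i _ do rewrite E ?(ltnW (ltn_ord i))//.
rewrite -mulr_sumr -(big_mkord xpredT (fun i => q ^+ (N - i))) big_nat_rev/= add0n big_mkord.
have -> : \sum_(i < N) q ^+ (N - (N - i.+1)) = \sum_(i < N) q ^+ i.+1.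
  by apply: eq_bigr => i _; rewrite subKn.
have G : (1 - q) * (\sum_(i < N) q ^+ i.+1) = q * (1 - q ^+ N).
  elim: N {E} => [|N IH]; first by rewrite big_ord0 expr0; ring.
  by rewrite big_ord_recr/= mulrDr IH !exprS; ring.
rewrite (_ : forall u : R, (1 - q) ^+ 2 * u = (1 - q) * ((1 - q) * u)); last by move=> u; ring.
by rewrite G mulrA.
Qed.

(** Enlarging the matrix by one adds a row, a column and a diagonal entry. The closed form is what
    makes the limit of the variance along the grids computable. *)
Lemma sum_ar_sqr r N : \sum_(i < N) \sum_(j < N) ar r i j ^+ 2 =
  N%:R * (1 - r ^+ 2) * (1 + r ^+ 2) - 2 * (r ^+ 2) * (1 - (r ^+ 2) ^+ N).
Proof.
elim: N => [|N IH]; first by rewrite big_ord0 expr0; ring.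
rewrite big_ord_recr/=.
under eq_bigr do rewrite big_ord_recr/=.
rewrite big_split/= IH big_ord_recr/= ar_diag sum_ar_last.
under eq_bigr do rewrite arC.
by rewrite sum_ar_last -natr1 [(r ^+ 2) ^+ N.+1]exprS; ring.
Qed.

(** On each side of the diagonal stands a geometric series of sum at most [1 / (1 - r)], and
    [(1 - r^2) * 2 / (1 - r) = 2 (1 + r) <= 4]. [S_lt] follows the partial sums up to the diagonal,
    [S_ge] beyond it; with [1 - r] kept as a factor, [r = 1] needs no exception. *)
Lemma sum_ar_le r N j : 0 <= r <= 1 -> \sum_(i < N) `|ar r i j| <= 4.
Proof.
move=> /andP[r0 r1].
have S_lt M : (M <= j)%N -> (1 - r) * (\sum_(i < M) r ^+ ((i - j) + (j - i))) <= r ^+ (j - M).+1.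
  elim: M => [|M IH] Mj; first by rewrite big_ord0 mulr0 exprn_ge0.
  rewrite big_ord_recr/= mulrDr; have := IH (ltnW Mj).
  rewrite (eqP (_ : M - j == 0)%N) ?subn_eq0 ?(ltnW Mj)// add0n -(subnSK Mj) !exprS; lra.
have S_ge M : (j <= M)%N -> (1 - r) * (\sum_(i < M) r ^+ ((i - j) + (j - i))) <= 2 - r ^+ (M - j).
  move/subnKC <-; elim: (M - j)%N => [|k IH].
    rewrite addn0; have := S_lt j (leqnn j); rewrite subnn expr1 expr0; lra.
  rewrite addnS big_ord_recr/= mulrDr; move: IH.
  rewrite -addnS !addKn (eqP (_ : j - (j + k) == 0)%N) ?subn_eq0 ?leq_addr// addn0 exprS; lra.
have S : (1 - r) * (\sum_(i < N) r ^+ ((i - j) + (j - i))) <= 2.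
  have [/S_ge|/ltnW/S_lt] := leqP j N.
    by have : 0 <= r ^+ (N - j) by [exact: exprn_ge0]; lra.
  have : r ^+ (j - N).+1 <= 1 by rewrite exprn_ile1.
  lra.
have -> : \sum_(i < N) `|ar r i j| = (1 + r) * ((1 - r) * (\sum_(i < N) r ^+ ((i - j) + (j - i)))).
  rewrite mulrA !mulr_sumr; apply: eq_bigr => i _.
  have q1 : 0 <= 1 - r ^+ 2 by rewrite subr_ge0 exprn_ile1.
  by rewrite /ar ger0_norm ?mulr_ge0 ?exprn_ge0//; ring.
have := ler_wpM2l (addr_ge0 ler01 r0) S.
have : 0 <= (1 - r) * (\sum_(i < N) r ^+ ((i - j) + (j - i))).
  by rewrite mulr_ge0 ?subr_ge0// sumr_ge0// => i _; rewrite exprn_ge0.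
nra.
Qed.

Lemma ar_min r i j : 0 < r -> r <= 1 ->
  (Num.sqrt (1 - r ^+ 2) / r ^+ i) * (Num.sqrt (1 - r ^+ 2) / r ^+ j) *
    Num.min ((r ^+ 2) ^+ i) ((r ^+ 2) ^+ j) = ar r i j.
Proof.
move=> r0 r1.
have sq : Num.sqrt (1 - r ^+ 2) ^+ 2 = 1 - r ^+ 2.
  by rewrite sqr_sqrtr// subr_ge0 exprn_ile1// ltW.
have q0 : 0 <= r ^+ 2 by exact: sqr_ge0.
have q1 : r ^+ 2 <= 1 by rewrite exprn_ile1// ltW.
wlog ij : i j / (i <= j)%N.
  move=> H; have [/H//|/ltnW/H] := leqP i j.
  by rewrite arC minC => <-; ring.
rewrite min_r ?ler_wiXn2l// /ar (eqP (_ : i - j == 0)%N) ?subn_eq0// add0n -[X in _ = X * _]sq.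
have -> : r ^+ j = r ^+ i * r ^+ (j - i) by rewrite -exprD subnKC.
have -> : (r ^+ 2) ^+ j = (r ^+ i) ^+ 2 * (r ^+ (j - i)) ^+ 2.
  by rewrite -exprMn -exprD subnKC// -!exprM mulnC.
by field; rewrite !expf_neq0// gt_eqF.
Qed.

End ar_matrix.

Section tensor.
Context {R : realType} (d N : nat).
Local Notation I := {ffun 'I_d -> 'I_N}.

Lemma sum_enum_val (T : finType) (F : T -> R) :
  \sum_(k < #|T|) F (enum_val k) = \sum_x F x.
Proof. by rewrite -big_enum_val. Qed.

(** Through this lemma and the next two the dimension enters the trace, the variance and the
    eigenvalue bound as an exponent only. *)
Lemma sum_prod_ffun (g : 'I_N -> R) :
  \sum_(J : I) \prod_(i < d) g (J i) = (\sum_j g j) ^+ d.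
Proof. by rewrite -(bigA_distr_bigA (fun _ j => g j)) prodr_const card_ord. Qed.

Lemma sum2_prod_ffun (h : 'I_N -> 'I_N -> R) :
  \sum_(J : I) \sum_(K : I) \prod_(i < d) h (J i) (K i) = (\sum_j \sum_k h j k) ^+ d.
Proof.
rewrite -sum_prod_ffun; apply: eq_bigr => J _.
by rewrite -(bigA_distr_bigA (fun i k => h (J i) k)).
Qed.

Lemma sum_prod_ffun_le (h : 'I_N -> 'I_N -> R) (B : R) (K : I) :
  (forall j k, 0 <= h j k) -> (forall k, \sum_j h j k <= B) ->
  \sum_(J : I) \prod_(i < d) h (J i) (K i) <= B ^+ d.
Proof.
move=> h0 hB; rewrite -(bigA_distr_bigA (fun i j => h j (K i))).
rewrite -[d in leRHS]card_ord -prodr_const; apply: ler_prod => i _.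
by rewrite hB andbT; apply: sumr_ge0.
Qed.

End tensor.

(** * Geometric grids and convergence of Riemann sums *)

Section cells.
Context {R : realType}.
Variables (q : R) (N : nat).
Hypotheses (q0 : 0 < q) (q1 : q < 1).

(* The cells ]q^(j+1), q^j] partition ]q^(N+1), 1]; the last one is closed on
   the left so that they partition [q^(N+1), 1]. *)
Definition cell (j : nat) : set R :=
  [set` Interval (BSide (j == N) (q ^+ j.+1)) (BRight (q ^+ j))].

Lemma measurable_cell j : measurable (cell j). Proof. exact: measurable_itv. Qed.

Let qS j : q ^+ j.+1 < q ^+ j.
Proof. by rewrite exprS gtr_pMl// exprn_gt0. Qed.

Lemma lebesgue_measure_cell j : lebesgue_measure (cell j) = (q ^+ j - q ^+ j.+1)%:E.
Proof. by rewrite lebesgue_measure_itv/= lte_fin qS EFinB. Qed.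

Lemma cell_itv j t : cell j t -> q ^+ j.+1 <= t <= q ^+ j.
Proof.
by rewrite /cell /= itv_boundlr /=; case: (j == N); rewrite !bnd_simp => /andP[h ->]; rewrite ?h ?ltW.
Qed.

Lemma cell_lt j t : cell j t -> j != N -> q ^+ j.+1 < t.
Proof. by rewrite /cell /= itv_boundlr /= => + /negbTE jN; rewrite jN bnd_simp => /andP[]. Qed.

Lemma cell_ex t : q ^+ N.+1 <= t <= 1 -> exists j : 'I_N.+1, cell j t.
Proof.
move=> /andP[tN t1].
(* The cell of [t] is the smallest [j] with [q^(j+1) < t]; the alternative [j = N] ends the search
   and takes care of the end point [t = q^(N+1)]. *)
have ex : exists j, (q ^+ j.+1 < t) || (j == N) by exists N; rewrite eqxx orbT.
case: (ex_minnP ex) => j jP jmin.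
have jN : (j < N.+1)%N by rewrite ltnS jmin// eqxx orbT.
exists (Ordinal jN); rewrite /cell /= itv_boundlr /= andbC; apply/andP; split.
  rewrite bnd_simp; case: j jP jmin {jN} => [|j] _ jmin; first by rewrite expr0.
  rewrite leNgt; apply/negP => h; have := jmin j; rewrite h => /(_ isT).
  by rewrite ltnn.
by case: eqVneq jP => [->|_]; rewrite !bnd_simp ?orbF.
Qed.

Lemma cell_inj (j k : 'I_N.+1) t : cell j t -> cell k t -> j = k.
Proof.
wlog jk : j k / (j <= k)%N.
  by move=> H cj ck; have [/H->//|/ltnW/H/(_ ck cj)->//] := leqP j k.
move=> cj ck; apply: val_inj; apply/eqP; rewrite eqn_leq jk leqNgt; apply/negP => kj.
have jN : (j : nat) != N by rewrite neq_ltn (leq_trans kj)// -ltnS ltn_ord.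
have := cell_lt cj jN; have /andP[_] := cell_itv ck => h.
rewrite ltNge (le_trans h)//.
by rewrite ler_wiXn2l// ltW.
Qed.

Variable d : nat.
Local Notation J := {ffun 'I_d -> 'I_N.+1}.
Local Notation T := (d.-tuple (measurableTypeR R)).
Local Notation leb := (power_measure (@lebesgue_measure R) d).

Definition gridpt (j : J) : d.-tuple R := [tuple q ^+ j i | i < d].

Definition rect (j : J) : set T := [set t | forall i, cell (j i) (tnth t i)].

Definition gridstep (f : d.-tuple R -> R) (t : T) : R :=
  \sum_(j : J) f (gridpt j) * \1_(rect j) t.

Lemma gridpt_box j : box (q ^+ N.+1) 1 (gridpt j).
Proof.
move=> i; rewrite tnth_mktuple ler_wiXn2l ?(ltW q0) ?(ltW q1)//=; last exact: ltnW.
by rewrite exprn_ile1// ltW.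
Qed.

Lemma measurable_rect j : measurable (rect j).
Proof.
rewrite (_ : rect j = \bigcap_(i in [set: 'I_d]) ((fun t : T => tnth t i) @^-1` cell (j i))).
  apply: fin_bigcap_measurable => [|i _]; first exact: finite_finset.
  rewrite -[X in measurable X]setTI; apply: measurable_tnth => //.
  exact: measurable_cell.
by apply/seteqP; split=> [t h i _|t h i]; exact: h.
Qed.

Lemma measurable_gridstep f : measurable_fun setT (gridstep f).
Proof.
apply: measurable_sum => j; apply: measurable_funM; first exact: measurable_cst.
by apply: measurable_indic; exact: measurable_rect.
Qed.

Lemma gridstepE f t : box (q ^+ N.+1) 1 t ->
  exists2 j : J, (forall i, cell (j i) (tnth t i)) & gridstep f t = f (gridpt j).
Proof.
move=> tb; have [j0 j0P] := @fin_all_exists _ _ (fun i (k : 'I_N.+1) => cell k (tnth t i)) (fun i => cell_ex (tb i)).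
pose j : J := [ffun i => j0 i].
have jP i : cell (j i) (tnth t i) by rewrite ffunE.
exists j => //; rewrite /gridstep (bigD1 j)//= big1 ?addr0.
  by rewrite indicE mem_set ?mulr1.
move=> k kj; rewrite indicE memNset ?mulr0// => kP.
move/eqP: kj; apply; apply/ffunP => i; exact: cell_inj (kP i) (jP i).
Qed.

Lemma gridstep_out f t : ~ box (q ^+ N.+1) 1 t -> gridstep f t = 0.
Proof.
move=> tb; rewrite /gridstep big1// => j _; rewrite indicE memNset ?mulr0// => jP.
apply: tb => i; have /andP[h1 h2] := cell_itv (jP i); apply/andP; split.
  by apply: le_trans h1; rewrite ler_wiXn2l ?ltW//.
by apply: le_trans h2 _; rewrite exprn_ile1// ltW.
Qed.

Lemma power_measure_cell j : leb (rect j) = (\prod_(i < d) (q ^+ j i - q ^+ (j i).+1))%:E.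
Proof.
rewrite /rect (@power_measure_rect _ _ _ (@lebesgue_measure R) d (fun i => cell (j i)) (fun=> measurable_cell _)).
rewrite (eq_bigr (fun i => (q ^+ j i - q ^+ (j i).+1)%:E)) => [|i _]; last exact: lebesgue_measure_cell.
by rewrite prodEFin.
Qed.

Lemma Rintegral_gridstep f : \int[leb]_(t in box (q ^+ N.+1) 1) gridstep f t =
  \sum_(j : J) f (gridpt j) * \prod_(i < d) (q ^+ j i - q ^+ (j i).+1).
Proof.
rewrite Rintegral_mkcond.
rewrite (_ : _ \_ _ = gridstep f); last first.
  apply/funext => t; rewrite patchE; case: ifPn => // /negP h.
  by rewrite gridstep_out// => /mem_set.
have ij j : leb.-integrable setT (EFin \o (\1_(rect j) : T -> R)).
  apply/integrableP; split; first by apply/measurable_EFinP; apply: measurable_indic; exact: measurable_rect.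
  rewrite (_ : (\int[_]_t _)%E = \int[leb]_t (\1_(rect j) t)%:E)%E.
    rewrite integral_indic ?setIT//; last exact: measurable_rect.
    by rewrite [X in (X < _)%E](power_measure_cell j) ltry.
  by apply: eq_integral => t _ /=; rewrite ger0_norm// indicE.
rewrite /gridstep Rintegral_sum; last by move=> j; apply: integrableZ_EFin; exact: ij.
apply: eq_bigr => j _; rewrite RintegralZl; [|exact: measurableT|exact: ij]; congr (_ * _).
rewrite /Rintegral integral_indic ?setIT//; last exact: measurable_rect.
by rewrite [X in fine X](power_measure_cell j).
Qed.

End cells.

Lemma measurable_box {R : realType} (d : nat) (a b : R) :
  measurable (box a b : set (d.-tuple (measurableTypeR R))).
Proof.
rewrite (_ : box a b = \bigcap_(i in [set: 'I_d]) ((fun t : d.-tuple (measurableTypeR R) => tnth t i) @^-1` `[a, b]%classic)).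
  apply: fin_bigcap_measurable => [|i _]; first exact: finite_finset.
  by rewrite -[X in measurable X]setTI; apply: measurable_tnth.
by apply/seteqP; split=> [t h i _|t h i]; have := h i; rewrite /= in_itv/=; [|move=> /(_ I)].
Qed.

Lemma power_measure_box {R : realType} (d : nat) (a b : R) :
  (power_measure (@lebesgue_measure R) d (box a b) < +oo)%E.
Proof.
have := @power_measure_rect _ _ _ (@lebesgue_measure R) d (fun=> `[a, b]%classic) (fun=> measurable_itv _).
rewrite (_ : [set t | _] = box a b) => [->|]; last first.
  by apply/seteqP; split=> [t h i|t h i]; have := h i; rewrite /= in_itv/=.
rewrite (eq_bigr (fun _ : 'I_d => (fine (lebesgue_measure `[a, b]))%:E)) ?prodEFin ?ltry// => i _.
by rewrite fineK//= lebesgue_measure_itv/=; case: ifP.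
Qed.

Section riemann.
Context {R : realType} (d : nat) (x0 M : R) (q : nat -> R) (f : d.-tuple R -> R).
Local Notation T := (d.-tuple (measurableTypeR R)).
Local Notation leb := (power_measure (@lebesgue_measure R) d).
Hypotheses (q0 : forall N, 0 < q N) (q1 : forall N, q N < 1)
  (qN : forall N, q N ^+ N.+1 = x0) (qcvg : q N @[N --> \oo] --> (1 : R)).
Hypotheses (fM : forall t, box x0 1 t -> `|f t| <= M).
Hypothesis fc : forall t, box x0 1 t -> forall e, 0 < e -> exists2 dl : R, 0 < dl &
  forall s, box x0 1 s -> (forall i, `|tnth s i - tnth t i| <= dl) -> `|f s - f t| < e.

(** All cells have sides at most [1 - q], since [q^j - q^(j+1) <= 1 - q]. *)
Lemma gridstep_cvg t : box x0 1 t -> gridstep (q N) N f t @[N --> \oo] --> f t.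
Proof.
move=> tb; apply/cvgrPdist_lt => e e0; have [dl dl0 fd] := fc tb e0.
have : \forall N \near \oo, 1 - q N <= dl.
  have /cvgrPdist_le/(_ dl dl0) := qcvg.
  by apply: filterS => N; rewrite ger0_norm// subr_ge0 ltW.
apply: filterS => N Nd; rewrite distrC.
have tbN : box (q N ^+ N.+1) 1 t by rewrite qN.
have [j jP ->] := gridstepE (q0 N) (q1 N) f tbN.
apply: fd; first by rewrite -(qN N); exact: gridpt_box.
move=> i; rewrite tnth_mktuple; have /andP[h1 h2] := cell_itv (jP i).
rewrite ger0_norm ?subr_ge0//; apply: le_trans Nd.
have qj : q N ^+ j i <= 1 by rewrite exprn_ile1// ltW.
rewrite exprS in h1; have := q1 N; have : 0 <= q N ^+ j i by rewrite exprn_ge0// ltW.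
nra.
Qed.

(** Measurability on the box is inherited from the step functions, which converge to [f] at every
    point of it. *)
Lemma measurable_fun_box : measurable_fun (box x0 1 : set T) f.
Proof.
apply: (@measurable_fun_cvg _ _ _ _ (fun N => gridstep (q N) N f)).
  by move=> N; apply: measurable_funTS; exact: measurable_gridstep.
exact: gridstep_cvg.
Qed.

Lemma riemann_cvg :
  \sum_(j : {ffun 'I_d -> 'I_N.+1}) f (gridpt (q N) j) *
    \prod_(i < d) (q N ^+ j i - q N ^+ (j i).+1) @[N --> \oo] -->
  \int[leb]_(t in box x0 1) f t.
Proof.
apply: (@cvgn_ext _ _ (fun N => \int[leb]_(t in box x0 1) gridstep (q N) N f t)).
  by move=> N; rewrite -[in RHS](qN N) Rintegral_gridstep.
have mb : measurable (box x0 1 : set T) by exact: measurable_box.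
have iM : leb.-integrable (box x0 1) (EFin \o cst M).
  apply/integrableP; split; first by apply/measurable_EFinP; exact: measurable_cst.
  by rewrite /= integral_cst//=; apply: lte_mul_pinfty => //; exact: power_measure_box.
have gM N t : box x0 1 t -> `|gridstep (q N) N f t| <= M.
  move=> tb; have tbN : box (q N ^+ N.+1) 1 t by rewrite qN.
  have [j _ ->] := gridstepE (q0 N) (q1 N) f tbN.
  by apply: fM; rewrite -(qN N); exact: gridpt_box.
have mf := measurable_fun_box.
have i_f : leb.-integrable (box x0 1) (EFin \o f).
  apply: le_integrable iM => //; first exact/measurable_EFinP.
  by move=> t tb /=; rewrite lee_fin (le_trans (fM tb))// ler_norm.
apply: fine_cvg; rewrite fineK; last exact: integrable_fin_num.
have [] := @dominated_convergence _ _ _ leb (box x0 1) mb (fun N t => (gridstep (q N) N f t)%:E) (EFin \o f) (EFin \o cst M) => //.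
- by move=> N; apply/measurable_EFinP; apply: measurable_funTS; exact: measurable_gridstep.
- exact/measurable_EFinP.
- apply/aeW => t tb; apply/cvg_EFin; first by near=> N.
  exact: gridstep_cvg.
- by apply/aeW => t N tb /=; rewrite lee_fin; exact: gM.
Unshelve. all: by end_near. Qed.

End riemann.

Section box_functions.
Context {R : realType} (d : nat) (a b : R).
Local Notation cube := [set r : 'rV[R]_d | forall i, a <= r ord0 i <= b].
Local Notation tup r := [tuple r ord0 i | i < d].

Let tupK (t : d.-tuple R) : tup (\row_i tnth t i) = t.
Proof. by apply: eq_from_tnth => i; rewrite tnth_mktuple mxE. Qed.

Lemma box_bounded (g : d.-tuple R -> R) :
  {within cube, continuous (fun r => g (tup r))} ->
  exists M, forall t, box a b t -> `|g t| <= M.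
Proof.
move=> cg; have cK : compact cube.
  have := @rV_compact R d (fun=> `[a, b]%classic) (fun=> @segment_compact R a b).
  rewrite (_ : [set v | _] = cube)//.
have [M [_ MP]] := compact_bounded (continuous_compact cg cK).
exists (M + 1) => t tb; apply: (MP (M + 1)); first by rewrite ltrDl.
by exists (\row_i tnth t i) => [i|]; rewrite ?tupK// mxE; exact: tb.
Qed.

Lemma box_continuous (g : d.-tuple R -> R) :
  {within cube, continuous (fun r => g (tup r))} ->
  forall t, box a b t -> forall e, 0 < e -> exists2 dl : R, 0 < dl &
  forall s, box a b s -> (forall i, `|tnth s i - tnth t i| <= dl) -> `|g s - g t| < e.
Proof.
move=> /subspace_continuousP cg t tb e e0.
have rb : cube (\row_i tnth t i) by move=> i; rewrite mxE; exact: tb.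
have /cvgrPdist_lt/(_ e e0) := cg _ rb; rewrite near_withinE => /nbhs_ballP[dl /= dl0 H].
(* Half of the radius, because balls are open whereas the condition on [s] is a weak inequality. *)
exists (dl / 2); first by rewrite divr_gt0.
move=> s sb st.
have H' : ball (\row_i tnth t i) dl (\row_i tnth s i) -> cube (\row_i tnth s i) ->
  `|g (tup (\row_i tnth t i)) - g (tup (\row_i tnth s i))| < e := H (\row_i tnth s i).
rewrite !tupK distrC in H'; apply: H'.
  split=> // i j; rewrite !mxE -ball_normE /= distrC (le_lt_trans (st j))//.
  by rewrite ltr_pdivrMr// ltr_pMr// ltr1n.
by move=> i; rewrite mxE; exact: sb.
Qed.

Lemma within_cube_ratio (g : d.-tuple R -> R) : 0 < a ->
  {within cube, continuous (fun r => g (tup r))} ->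
  {within cube, continuous (fun r =>
    g (tup r) ^+ 2 / \prod_(i < d) tnth (tup r) i ^+ 2)}.
Proof.
move=> a0 /subspace_continuousP cg; apply/subspace_continuousP => r rA.
apply: cvgM.
  by apply: (@cvg_comp _ _ _ _ (fun x : R => x ^+ 2) _ _ _ (cg r rA)); exact: exprn_continuous.
apply: cvgV.
  apply/prodf_neq0 => i _; rewrite expf_neq0// tnth_mktuple gt_eqF//.
  by have /andP[h _] := rA i; exact: lt_le_trans h.
apply: cvg_big => [|i _]; first by move=> x; exact: mul_continuous.
under eq_fun do rewrite tnth_mktuple.
rewrite tnth_mktuple.
apply: (@cvg_comp _ _ _ (fun r : 'rV[R]_d => r ord0 i) (fun x : R => x ^+ 2)); last exact: exprn_continuous.
apply: cvg_trans (@coord_continuous _ 1 d ord0 i r).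
by apply: cvg_app; exact: cvg_within.
Qed.

End box_functions.

Section brownian_grid.
Context {R : realType} (d : nat) dO (Omega : measurableType dO)
  (P : probability Omega R) (W : d.-tuple R -> Omega -> R).
Hypothesis bW : brownian_sheet P W.
Variables (q : nat -> R) (x0 : R).
Hypotheses (q0 : forall N, 0 < q N) (q1 : forall N, q N < 1)
  (qN : forall N, q N ^+ N.+1 = x0) (qcvg : q N @[N --> \oo] --> (1 : R)).

Let x00 : 0 < x0. Proof. by rewrite -(qN 0) exprn_gt0. Qed.

Let sub_cube : [set r : 'rV[R]_d | forall i, x0 <= r ord0 i <= 1] `<=`
  [set r : 'rV[R]_d | forall i, 0 <= r ord0 i <= 1].
Proof. by move=> r rA i; have /andP[h ->] := rA i; rewrite (le_trans (ltW x00)). Qed.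

Lemma brownian_riemann_cvg w :
  \sum_(j : {ffun 'I_d -> 'I_N.+1})
    W (gridpt (q N) j) w ^+ 2 / (\prod_(i < d) tnth (gridpt (q N) j) i ^+ 2) *
    \prod_(i < d) (q N ^+ j i - q N ^+ (j i).+1) @[N --> \oo] -->
  \int[power_measure (@lebesgue_measure R) d]_(t in box x0 1)
    (W t w ^+ 2 / \prod_(i < d) tnth t i ^+ 2).
Proof.
have [_ _ _ cW] := bW.
have cf := @within_cube_ratio R d x0 1 (fun t => W t w) x00 (continuous_subspaceW sub_cube (cW w)).
pose f t := W t w ^+ 2 / \prod_(i < d) tnth t i ^+ 2.
have [M fM] := @box_bounded R d x0 1 f cf.
exact: (riemann_cvg q0 q1 qN qcvg fM (@box_continuous R d x0 1 f cf)).
Qed.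

End brownian_grid.

Lemma ramp_limit_Rintegral {R : realType} d (U : measurableType d) (P : probability U R)
    (F_ : nat -> U -> R) (F : U -> R) (k z : R) :
  (forall N, measurable_fun setT (F_ N)) ->
  (forall w, F_ N w @[N --> \oo] --> F w) ->
  \int[P]_w ramp k (F_ N w - z) @[N --> \oo] --> \int[P]_w ramp k (F w - z).
Proof.
move=> mF_ F_F; have mF : measurable_fun setT F.
  by apply: (@measurable_fun_cvg _ _ _ _ F_) => // w _; exact: F_F.
apply: fine_cvg; rewrite fineK; last exact/integrable_fin_num/ramp_integrable.
have [] := @dominated_convergence _ _ _ P setT measurableT
  (fun N w => (ramp k (F_ N w - z))%:E) (EFin \o (fun w => ramp k (F w - z))) (cst 1%E) => //.
- by move=> N; case/integrableP: (ramp_integrable P k z (mF_ N)).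
- by case/integrableP: (ramp_integrable P k z mF).
- apply/aeW => w _; apply/cvg_EFin; first by near=> N.
  have h : F_ N w - z @[N --> \oo] --> F w - z by apply: cvgB; [exact: F_F|exact: cvg_cst].
  exact: (cvg_comp _ _ h (@continuous_ramp _ k (F w - z))).
- exact: finite_measure_integrable_cst.
- by apply/aeW => w N _ /=; rewrite lee_fin ger0_norm ?ramp_ge0// ramp_le1.
Unshelve. all: by end_near. Qed.

Section brownian_grid_chaos.
Context {R : realType} (d : nat) dO (Omega : measurableType dO)
  (P : probability Omega R) (W : d.-tuple R -> Omega -> R).
Hypothesis bW : brownian_sheet P W.
Variables (N : nat) (r : R).
Hypotheses (r0 : 0 < r) (r1 : r < 1).
Local Notation q := (r ^+ 2).
Local Notation J := {ffun 'I_d -> 'I_N.+1}.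

Let q0 : 0 < q. Proof. by rewrite exprn_gt0. Qed.
Let q1 : q < 1. Proof. by rewrite exprn_ilt1// ltW. Qed.

Definition brownian_riemann (w : Omega) : R :=
  \sum_(j : J) W (gridpt q j) w ^+ 2 / (\prod_(i < d) tnth (gridpt q j) i ^+ 2) *
    \prod_(i < d) (q ^+ j i - q ^+ (j i).+1).

Let pt_box (j : J) : box 0 1 (gridpt q j).
Proof.
move=> i; have /andP[h1 h2] := gridpt_box q0 q1 j i.
by rewrite h2 (le_trans _ h1)// exprn_ge0// ltW.
Qed.

Let mW (j : J) : measurable_fun setT (W (gridpt q j)).
Proof. by have [[mW _] _ _ _] := bW; apply: mW; exact: pt_box. Qed.

Let WW (j k : J) : (\int[P]_w (W (gridpt q j) w * W (gridpt q k) w)%:E =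
  (\prod_(i < d) Num.min (q ^+ j i) (q ^+ k i))%:E)%E.
Proof.
have [_ _ cW _] := bW; have := cW _ _ (pt_box j) (pt_box k); rewrite unlock => ->.
by congr EFin; apply: eq_bigr => i _; rewrite !tnth_mktuple.
Qed.

Let iW2 (j : J) : P.-integrable setT (EFin \o (fun w => W (gridpt q j) w ^+ 2)).
Proof. exact: sqr_integrable (WW j j). Qed.

(** The square of [c j] is the weight of a grid point in the Riemann sum: in each coordinate the
    length of the cell over the squared abscissa is [(q^j - q^(j+1)) / q^(2 j) = (1 - q) / r^(2
    j)]. *)
Let c (j : J) : R := \prod_(i < d) (Num.sqrt (1 - q) / r ^+ j i).
Let pt (k : 'I_#|J|) : J := enum_val k.
Let X (k : 'I_#|J|) (w : Omega) : R := c (pt k) * W (gridpt q (pt k)) w.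
Let A : 'M[R]_#|J| := \matrix_(k, l) \prod_(i < d) ar r (pt k i) (pt l i).

Let mX k : measurable_fun setT (X k).
Proof. exact: measurable_funM. Qed.

Let gX (u : 'I_#|J| -> R) : gaussian_rv P (fun w => \sum_k u k * X k w).
Proof.
have [[_ gW] _ _ _] := bW.
have := gW _ (fun k => gridpt q (pt k)) (fun k => u k * c (pt k)) (fun k => pt_box _).
congr gaussian_rv; apply/funext => w.
by apply: eq_bigr => k _; rewrite mulrA.
Qed.

Let EX k : (\int[P]_w (X k w)%:E = 0)%E.
Proof.
have [_ eW _ _] := bW; have := eW _ (pt_box (pt k)); rewrite unlock => E.
under eq_integral do rewrite EFinM.
rewrite integralZl//; first by rewrite E mule0.
exact: integrable_of_sqr.
Qed.

Let VX k l : (\int[P]_w (X k w * X l w)%:E = (A k l)%:E)%E.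
Proof.
have E w : X k w * X l w = c (pt k) * c (pt l) * (W (gridpt q (pt k)) w * W (gridpt q (pt l)) w).
  by rewrite /X; ring.
under eq_integral do rewrite E EFinM.
rewrite integralZl//; last exact: mul_integrable.
rewrite WW -EFinM; congr EFin; rewrite mxE /c -!big_split /=.
by apply: eq_bigr => i _; rewrite ar_min// ltW.
Qed.

Let AB l : \sum_k `|A k l| <= 4 ^+ d.
Proof.
under eq_bigr => k _ do rewrite mxE normr_prod.
rewrite (@sum_enum_val R J (fun j => \prod_(i < d) `|ar r (j i) (pt l i)|)).
apply: (@sum_prod_ffun_le R d N.+1 (fun j k => `|ar r j k|)) => // k.
by apply: sum_ar_le; rewrite !ltW.
Qed.

Let trA : \sum_k A k k = (N.+1%:R * (1 - q)) ^+ d.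
Proof.
under eq_bigr => k _ do rewrite mxE.
rewrite (@sum_enum_val R J (fun j => \prod_(i < d) ar r (j i) (j i))).
rewrite (@sum_prod_ffun R d N.+1 (fun j => ar r j j)); congr (_ ^+ d).
by under eq_bigr do rewrite ar_diag; rewrite sumr_const card_ord mulr_natl.
Qed.

(** The closed form of [sum_ar_sqr] for [N + 1] indices and [r^2 = q]; its [d]-th power is half the
    variance of the Riemann sum. *)
Definition grid_variance : R :=
  N.+1%:R * (1 - q) * (1 + q) - 2 * q * (1 - q ^+ N.+1).

Let trA2 : \sum_k \sum_l A k l ^+ 2 = grid_variance ^+ d.
Proof.
under eq_bigr => k _.
  under eq_bigr => l _ do rewrite mxE -prodrXl.
  rewrite (@sum_enum_val R J (fun j => \prod_(i < d) ar r (pt k i) (j i) ^+ 2)).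
  over.
rewrite (@sum_enum_val R J (fun k => \sum_(j : J) \prod_(i < d) ar r (k i) (j i) ^+ 2)).
by rewrite (@sum2_prod_ffun R d N.+1 (fun j k => ar r j k ^+ 2)) sum_ar_sqr.
Qed.

Let X2 w : \sum_k X k w ^+ 2 = brownian_riemann w.
Proof.
rewrite (@sum_enum_val R J (fun j => (c j * W (gridpt q j) w) ^+ 2)).
apply: eq_bigr => j _; rewrite exprMn mulrC -mulrA; congr (_ * _).
rewrite /c -prodrXl -prodfV -big_split /=; apply: eq_bigr => i _.
rewrite tnth_mktuple exprMn sqr_sqrtr; last by rewrite subr_ge0 ltW.
have qj : q ^+ j i = (r ^+ j i) ^+ 2 by rewrite -!exprM mulnC.
have u0 : r ^+ j i != 0 by rewrite expf_neq0// gt_eqF.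
rewrite [q ^+ (j i).+1]exprS qj; move: (r ^+ j i) u0 => u u0.
by field.
Qed.

Lemma measurable_brownian_riemann : measurable_fun setT brownian_riemann.
Proof.
apply: measurable_sum => j; apply: measurable_funM; last exact: measurable_cst.
by apply: measurable_funM; [exact: measurable_funX|exact: measurable_cst].
Qed.

Lemma brownian_grid_chaos (s : R) : 0 < s -> s ^+ 2 = grid_variance ^+ d ->
  exists n (a : 'I_n -> R), [/\ \sum_i a i ^+ 2 = 1, forall i, `|a i| <= 4 ^+ d / s &
    forall k z, 0 < k ->
      \int[gaussn R n]_t ramp k (qform a t - \sum_i a i - z) =
      \int[P]_w ramp k ((brownian_riemann w - (N.+1%:R * (1 - q)) ^+ d) / s - z)].
Proof.
move=> s0 s2; rewrite -trA2 in s2.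
have [a [a2 am law]] := gaussian_vector_chaos mX gX EX VX AB s0 s2.
exists #|J|, a; split => // k z k0; rewrite law//.
by apply: eq_Rintegral => w _; rewrite X2 trA.
Qed.

End brownian_grid_chaos.

(** * Constants, and passage to the limit along the grids *)

Section chaos_constants.
Context {R : realType} (n : nat).
Hypothesis n2 : (2 <= n)%N.
Local Notation L := (ln (n%:R : R)).

(** The integral over [[1/n, 1]^2] of [min(s, t)^2 / (s t)^2], half the variance of the functional
    in dimension one. Normalising by the root of its [d]-th power leaves a variance [2], whence the
    comparison with N(0, 2). *)
Definition sheet_variance (n : nat) : R := 2 * ln n%:R - 2 * (1 - n%:R^-1).

Lemma ln_nat_gt0 : 0 < L. Proof. by rewrite ln_gt0// ltr1n. Qed.

Let n0 : 0 < n%:R :> R. Proof. by rewrite ltr0n (leq_trans _ n2). Qed.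

Lemma ln_ge1B (x : R) : 0 < x -> 1 - x^-1 <= ln x.
Proof.
move=> x0; have := @le_ln1Dx R (x^-1 - 1).
rewrite ltrBrDl subrr invr_gt0 => /(_ x0); rewrite addrC subrK lnV ?posrE//; lra.
Qed.

(** Equivalent to [ln n > (15/14) (1 - 1/n)], and tightest at [n = 2], where it reads
    [ln 2 > 15/28]. The inequality [ln x >= 1 - 1/x] at [x = 2] gives only [1/2]; applied at
    [sqrt 2] and doubled it suffices. Larger [n] follow from [ln n = ln 2 + ln (n / 2)]. *)
Lemma variance_gt : 16 * L < 120 * sheet_variance n.
Proof.
have s2 : (Num.sqrt 2 : R) ^+ 2 = 2 by rewrite sqr_sqrtr.
have s0 : 0 < (Num.sqrt 2 : R) by rewrite sqrtr_gt0.
have s1 : (Num.sqrt 2 : R) <= 3 / 2 by move: s0 s2; nra.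
have l2 : 1 / 2 + 1 / 20 <= ln (2 : R).
  have -> : ln (2 : R) = 2 * ln (Num.sqrt 2) by rewrite -[in LHS]s2 lnXn// mulr_natl.
  have := ln_ge1B s0.
  have si : (Num.sqrt 2 : R)^-1 = Num.sqrt 2 / 2 by apply: (mulIf (lt0r_neq0 s0)); rewrite mulVf ?gt_eqF// mulrAC -expr2 s2 divff.
  have s3 : (Num.sqrt 2 : R) <= 71 / 50 by move: s0 s2; nra.
  rewrite si; lra.
have h : ln 2 + (1 - 2 / n%:R) <= L.
  have -> : (n%:R : R) = 2 * (n%:R / 2) by field.
  rewrite lnM ?posrE ?divr_gt0// lerD2l.
  have := @ln_ge1B (n%:R / 2) (divr_gt0 n0 (ltr0n R 2)).
  rewrite invf_div; set x := n%:R / 2.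
  have -> : 2 / (2 * x) = 2 / n%:R by rewrite /x; congr (_ / _); field.
  by [].
have x0 : 0 < n%:R^-1 :> R by rewrite invr_gt0.
have x2 : n%:R^-1 <= 2^-1 :> R by rewrite lef_pV2 ?posrE// ler_nat.
rewrite /sheet_variance; lra.
Qed.

Lemma sheet_variance_gt0 : 0 < sheet_variance n.
Proof. by have := variance_gt; have := ln_nat_gt0; lra. Qed.

(** The bound [1] holds for any weights whose squares add up to one; it takes over when [Delta] is
    small, a case that the concentration bound includes. *)
Definition chaos_weight (d : nat) : R := Num.min 1 (128 * Delta R d n ^+ 2)^-1.

Lemma Delta_gt0 d : 0 < Delta R d n.
Proof.
by rewrite mulr_gt0 ?invr_gt0 ?mulr_gt0 ?sqrtr_gt0// powR_gt0// divr_gt0// ln_nat_gt0.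
Qed.

Lemma Delta_sqr d : 128 * Delta R d n ^+ 2 = (L / 120) `^ (d%:R / 2).
Proof.
have s2 : (Num.sqrt 2 : R) ^+ 2 = 2 by rewrite sqr_sqrtr.
have s0 : (Num.sqrt 2 : R) != 0 by rewrite gt_eqF// sqrtr_gt0.
have L0 := ln_nat_gt0.
rewrite /Delta exprMn exprVn exprMn s2 -[(_ `^ _) ^+ 2]powR_mulrn ?powR_ge0// -powRrM.
rewrite (_ : d%:R / 4 * 2%:R = d%:R / 2); last by field.
by rewrite mulrA (_ : 128 / _ = 1) ?mul1r//; field.
Qed.

Lemma chaos_weight_gt0 d : 0 < chaos_weight d.
Proof. by rewrite lt_min ltr01/= invr_gt0 mulr_gt0// exprn_gt0// Delta_gt0. Qed.

(** As [4^d = 16^(d/2)] and [128 Delta^2 = (L / 120)^(d/2)], the claim is the power [d / 2] of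
    [16 / v <= 120 / L]: the constant [120] of [Delta] is fitted to this inequality. *)
Lemma chaos_weight_le d (v : R) : 16 * L <= 120 * v -> 4 ^+ d / v `^ (d%:R / 2) <= (128 * Delta R d n ^+ 2)^-1.
Proof.
move=> Lv; have L0 := ln_nat_gt0.
have v0 : 0 < v by lra.
rewrite Delta_sqr ler_pdivrMr ?powR_gt0// mulrC ler_pdivlMr; last by rewrite powR_gt0// divr_gt0.
have -> : 4 ^+ d = (16 : R) `^ (d%:R / 2).
  rewrite (_ : (16 : R) = 4 `^ 2%:R); last by rewrite powR_mulrn//; ring.
  by rewrite -powRrM (_ : 2%:R * (d%:R / 2) = d%:R) ?powR_mulrn//; field.
rewrite -powRM// ?divr_ge0 ?(ltW L0)//; apply: ge0_ler_powR; rewrite ?nnegrE.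
- by rewrite divr_ge0.
- by rewrite mulr_ge0// divr_ge0// ltW.
- exact: ltW.
- lra.
Qed.

(** Chosen so that [q^(N+1) = 1 / n], with [N + 1] cells on each axis; the square root [r] of [q] is
    the parameter of [ar]. *)
Let r N : R := expR (- (L / (2 * N.+1%:R))).
Let q N : R := r N ^+ 2.

Let qE N : q N = expR (- L / N.+1%:R).
Proof. by rewrite /q /r -expRM_natl; congr expR; field. Qed.

Let q_lt1 N : q N < 1.
Proof. by rewrite qE expR_lt1 mulNr oppr_lt0 divr_gt0// ln_nat_gt0. Qed.

Let q_gt0 N : 0 < q N. Proof. by rewrite qE expR_gt0. Qed.

Let r_gt0 N : 0 < r N. Proof. exact: expR_gt0. Qed.

Let r_lt1 N : r N < 1.
Proof. by rewrite expR_lt1 oppr_lt0 divr_gt0// ?mulr_gt0// ln_nat_gt0. Qed.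

Let qN N : q N ^+ N.+1 = n%:R^-1.
Proof. by rewrite qE -expRM_natl mulrC divfK// expRN lnK. Qed.

Let qcvg : q N @[N --> \oo] --> (1 : R).
Proof. by apply: (cvgn_ext qE); exact: expR_divS_cvg. Qed.

(** With [x = L / (N + 1)] the sequence is [L (1 - exp (- x)) / x], which lies between [L / (1 + x)]
    and [L]. *)
Let trace_cvg : N.+1%:R * (1 - q N) @[N --> \oo] --> L.
Proof.
have L0 := ln_nat_gt0.
apply: (@squeeze_cvgr _ _ _ _ (fun N => L * (1 + L * N.+1%:R^-1)^-1) (fun=> L)).
- apply: nearW => N; have N0 : (0 : R) < N.+1%:R by rewrite ltr0n.
  set x := L * N.+1%:R^-1; have x0 : 0 < x by rewrite divr_gt0.
  have -> : q N = expR (- x) by rewrite qE /x mulNr.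
  have -> : L = N.+1%:R * x by rewrite /x; field; rewrite gt_eqF.
  rewrite -mulrA !ler_pM2l//; apply/andP; split.
    have e1 : 1 + x <= expR x by exact: expR_ge1Dx.
    have : expR (- x) <= (1 + x)^-1 by rewrite expRN lef_pV2 ?posrE ?expR_gt0//; lra.
    have -> : x * (1 + x)^-1 = 1 - (1 + x)^-1 by field; rewrite gt_eqF//; lra.
    lra.
  by have := expR_ge1Dx (- x); lra.
- rewrite -[X in _ --> X]mulr1; apply: cvgM; first exact: cvg_cst.
  rewrite -[X in _ --> X]invr1; apply: cvgV; first exact: oner_neq0.
  rewrite -[X in _ --> X]addr0; apply: cvgD; first exact: cvg_cst.
  rewrite -[X in _ --> X](mulr0 L); apply: cvgM; first exact: cvg_cst.
  exact: cvg_harmonic.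
- exact: cvg_cst.
Qed.

Let variance_cvg : grid_variance N (r N) @[N --> \oo] --> sheet_variance n.
Proof.
apply: (@cvgn_ext _ _ (fun N => N.+1%:R * (1 - q N) * (1 + q N) - 2 * q N * (1 - n%:R^-1))).
  by move=> N; rewrite /grid_variance -/(q N) qN.
have -> : sheet_variance n = L * (1 + 1) - 2 * 1 * (1 - n%:R^-1) by rewrite /sheet_variance; ring.
apply: cvgB; apply: cvgM.
- exact: trace_cvg.
- by apply: cvgD; [exact: cvg_cst|exact: qcvg].
- by apply: cvgM; [exact: cvg_cst|exact: qcvg].
- exact: cvg_cst.
Qed.

(** Visible on the double sum of squares behind the closed form, its diagonal entries being
    positive. *)
Let grid_variance_gt0 N : 0 < grid_variance N (r N).
Proof.
rewrite /grid_variance -sum_ar_sqr (bigD1 ord0)//= ltr_pwDl//.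
  rewrite (bigD1 ord0)//= ltr_pwDl//; last by apply: sumr_ge0 => j _; exact: sqr_ge0.
  by rewrite ar_diag exprn_gt0// subr_gt0; exact: q_lt1.
by apply: sumr_ge0 => i _; apply: sumr_ge0 => j _; exact: sqr_ge0.
Qed.

Let powR_variance_cvg (h : R) : grid_variance N (r N) `^ h @[N --> \oo] --> sheet_variance n `^ h.
Proof.
rewrite /powR (gt_eqF sheet_variance_gt0).
apply: (@cvgn_ext _ _ (fun N => expR (h * ln (grid_variance N (r N))))).
  by move=> N; rewrite gt_eqF// grid_variance_gt0.
have c1 : ln (grid_variance N (r N)) @[N --> \oo] --> ln (sheet_variance n).
  exact: (cvg_comp _ _ variance_cvg (continuous_ln sheet_variance_gt0)).
have c2 : h * ln (grid_variance N (r N)) @[N --> \oo] --> h * ln (sheet_variance n).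
  by apply: cvgM; [exact: cvg_cst|exact: c1].
exact: (cvg_comp _ _ c2 (@continuous_expR R _)).
Qed.

Context (d : nat) dO (Omega : measurableType dO)
  (P : probability Omega R) (W : d.-tuple R -> Omega -> R).
Hypothesis bW : brownian_sheet P W.

Let F_ N w : R := (brownian_riemann W N (r N) w - (N.+1%:R * (1 - q N)) ^+ d) /
  grid_variance N (r N) `^ (d%:R / 2).

Let F_cvg w : F_ N w @[N --> \oo] --> Ffun W n w.
Proof.
apply: cvgM.
  apply: cvgB.
    have H := @brownian_riemann_cvg R d dO Omega P W bW q n%:R^-1 q_gt0 q_lt1 qN (@qcvg) w.
    by apply: cvgn_ext H => N.
  by apply: (cvg_comp _ _ trace_cvg (@exprn_continuous R d L)).
apply: cvgV; last exact: powR_variance_cvg.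
by rewrite gt_eqF// powR_gt0// sheet_variance_gt0.
Qed.

Let mF_ N : measurable_fun setT (F_ N).
Proof.
apply: measurable_funM; last exact: measurable_cst.
apply: measurable_funB; last exact: measurable_cst.
exact: (measurable_brownian_riemann bW N (r_gt0 N) (r_lt1 N)).
Qed.

(** Each path being continuous, the normalised Riemann sums converge to [Ffun] at every sample
    point; dominated convergence then gives the convergence on ramps. *)
Lemma brownian_chaos : chaos_limit P (Ffun W n) (chaos_weight d).
Proof.
split; first by apply: (@measurable_fun_cvg _ _ _ _ F_) => // w _; exact: F_cvg.
(* The strict inequality [variance_gt] for the limit persists for all fine grids. The sequence of
   forms starts from the index [N0], so that a single bound holds for all its weights. *)
have [N0 _ N0P] : \forall N \near \oo, 16 * L <= 120 * grid_variance N (r N).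
  have e0 : 0 < sheet_variance n - 16 * L / 120 by have := variance_gt; lra.
  have /cvgrPdist_lt/(_ _ e0) := variance_cvg; apply: filterS => N.
  by rewrite ltr_norml => /andP[_]; lra.
have sq N : (grid_variance N (r N) `^ (d%:R / 2)) ^+ 2 = grid_variance N (r N) ^+ d.
  rewrite -!powR_mulrn ?powR_ge0 ?(ltW (grid_variance_gt0 N))//.
  by rewrite -powRrM; congr (_ `^ _); field.
have s0 N : 0 < grid_variance N (r N) `^ (d%:R / 2) by rewrite powR_gt0.
have ex N : exists a : {k : nat & 'I_k -> R}, [/\ \sum_i projT2 a i ^+ 2 = 1,
    forall i, `|projT2 a i| <= 4 ^+ d / grid_variance (N + N0) (r (N + N0)) `^ (d%:R / 2) &
    forall k z, 0 < k ->
      \int[gaussn R (projT1 a)]_t ramp k (qform (projT2 a) t - \sum_i projT2 a i - z) =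
      \int[P]_w ramp k (F_ (N + N0) w - z)].
  have [m [a [h1 h2 h3]]] := brownian_grid_chaos bW (r_gt0 (N + N0)) (r_lt1 (N + N0)) (s0 _) (sq _).
  by exists (existT (fun k => 'I_k -> R) m a).
have [a aP] := choice ex.
exists (fun N => projT1 (a N)), (fun N => projT2 (a N)); split.
- by move=> N; have [] := aP N.
- move=> N i; have [a2 am _] := aP N; rewrite le_min; apply/andP; split.
    rewrite -[leRHS](expr1n R 1) -(@ler_pXn2r _ 2) ?nnegrE ?expr1n//.
    rewrite real_normK ?num_real// -[leRHS]a2 (bigD1 i)//= lerDl.
    by apply: sumr_ge0 => j _; exact: sqr_ge0.
  apply: le_trans (am i) _; apply: chaos_weight_le; apply: N0P => /=.
  exact: leq_addl.
move=> k z k0.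
apply: (@cvgn_ext _ _ (fun N => \int[P]_w ramp k (F_ (N + N0) w - z))).
  by move=> N; have [_ _ ->] := aP N.
have H := @ramp_limit_Rintegral R _ Omega P F_ (Ffun W n) k z mF_ (fun w => @F_cvg w).
exact: (cvg_comp (fun N => (N + N0)%N) _ (@cvg_addnr N0) H).
Qed.

End chaos_constants.

(** * Deviation bounds *)

Section tail_ratio.
Context {R : realType}.
Local Notation C := (12 + 2 * stein_const : R).
Local Notation c := (mills_const : R).
Local Notation T := (gauss_tent : R).

Let c_gt0 : 0 < c. Proof. exact: mills_const_gt0. Qed.
Let T_gt0 : 0 < T. Proof. exact: gauss_tent_gt0. Qed.
Let C_gt0 : 0 < C. Proof. by have := @stein_const_ge1 R; lra. Qed.

Lemma gauss_tail_gt0 (z : R) : 0 <= z -> 0 < gauss_tail z.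
Proof.
move=> z0; apply: lt_le_trans (gauss_tail_ge z0).
have z1 : 0 < 1 + z by rewrite ltr_wpDr.
by rewrite divr_gt0// mulr_gt0// expR_gt0.
Qed.

(** With [m <= 1 / (128 D^2)] and [(1 + z)^3 <= 4 (1 + z^3)], the relative Stein error
    [(C / c) m (1 + z)^3] is at most [C / (32 c)] times [(1 + z^3) / D^2]. *)
Definition ratio_const : R := C / (32 * c).
Local Notation K := ratio_const.

Let K_gt0 : 0 < K. Proof. by rewrite divr_gt0// mulr_gt0. Qed.

(** Dominates the constants of the two ranges of [z]: [1 + 2 K] for Stein's bound, and [3] plus the
    two logarithms for the cruder one. *)
Definition tail_const : R := 3 + 2 * K + `|ln c| + `|ln (T / 2)|.

Lemma tail_const_gt0 : 0 < tail_const.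
Proof.
have := normr_ge0 (ln c); have := normr_ge0 (ln (T / 2)); have := K_gt0.
rewrite /tail_const; lra.
Qed.

Section bounds.
Context d (U : measurableType d) (P : probability U R).
Variables (F : U -> R) (m D z : R).
Hypotheses (FP : chaos_limit P F m) (m0 : 0 < m) (D1 : 1 <= D) (z0 : 0 <= z).
Hypothesis mD : 128 * D ^+ 2 * m <= 1.
Local Notation p := (fine (P [set w | z <= F w])).
Local Notation Psi := (gauss_tail z).

Let D0 : 0 < D. Proof. exact: lt_le_trans D1. Qed.
Let z3 : 0 <= z ^+ 3. Proof. exact: exprn_ge0. Qed.
Let y0 : 0 <= z ^+ 3 / D. Proof. by rewrite divr_ge0// ltW. Qed.
Let Psi0 : 0 < Psi. Proof. exact: gauss_tail_gt0. Qed.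

Let z3m : z ^+ 3 * m <= z ^+ 3 / D.
Proof.
rewrite ler_wpM2l// -[leRHS]mul1r ler_pdivlMr//.
have D2 : D <= D ^+ 2 by rewrite expr2 ler_peMl// ltW.
by have := ler_wpM2l (ltW m0) D2; move: mD; lra.
Qed.

(** The lower bound on the Gaussian tail read backwards: it turns errors proportional to
    [exp (- z^2 / 4)] into errors relative to the tail. *)
Let tail_mass : expR (- (z ^+ 2 / 4)) <= Psi * ((1 + z) / c).
Proof.
have := gauss_tail_ge z0; have z1 : 0 < 1 + z by rewrite ltr_wpDr.
by rewrite ler_pdivrMr// mulrA ler_pdivlMr// [leLHS]mulrC.
Qed.

(** In the range [z^2 <= D] the error [eta] relative to the tail is of order [(1 + z^3) / D^2] and
    at most [1 / 2], so [1 - eta >= exp (- 2 eta)]. The factor [exp (z^3 m)] is the Taylor remainder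
    of the log-Laplace transform. *)
Lemma tail_ratio_stein : 16 * K ^+ 2 <= D -> z ^+ 2 <= D ->
  Psi * expR (- ((1 + 2 * K) * ((1 + z ^+ 3) / D))) <= p <=
  Psi * expR ((1 + 2 * K) * ((1 + z ^+ 3) / D)).
Proof.
move=> KD zD.
have z1 : 0 < 1 + z by rewrite ltr_wpDr.
pose eta := C / c * m * (1 + z) ^+ 3.
have eta0 : 0 <= eta by rewrite !mulr_ge0 ?exprn_ge0 ?invr_ge0 ?(ltW C_gt0) ?(ltW m0) ?(ltW z1) ?(ltW c_gt0).
have etaD : eta <= K * (1 + z ^+ 3) / D ^+ 2.
  rewrite ler_pdivlMr ?exprn_gt0//.
  have cube : (1 + z) ^+ 3 <= 4 * (1 + z ^+ 3).
    rewrite -subr_ge0 (_ : _ - _ = 3 * ((1 - z) ^+ 2 * (1 + z))); last by ring.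
    by rewrite mulr_ge0// mulr_ge0 ?sqr_ge0// ltW.
  have -> : eta * D ^+ 2 = K / 4 * (128 * D ^+ 2 * m) * (1 + z) ^+ 3.
    by rewrite /eta /ratio_const; field; rewrite gt_eqF.
  have -> : K * (1 + z ^+ 3) = K / 4 * 1 * (4 * (1 + z ^+ 3)) by field.
  have K4 : 0 <= K / 4 by rewrite divr_ge0// ltW.
  have mD0 : 0 <= 128 * D ^+ 2 * m by rewrite !mulr_ge0// ?sqr_ge0// ltW.
  apply: ler_pM cube; [exact: mulr_ge0|by rewrite exprn_ge0// ltW|exact: ler_wpM2l].
have D2 : D <= D ^+ 2 by rewrite expr2 ler_peMl// ltW.
have D2gt0 : 0 < D ^+ 2 by rewrite exprn_gt0.
have sq_le (x : R) : 0 <= x -> (4 * K * x) ^+ 2 <= D ^+ 2 ^+ 2 -> K * x / D ^+ 2 <= 1 / 4.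
  move=> x0 h; have a0 : 0 <= 4 * K * x by rewrite mulr_ge0// mulr_ge0// ltW.
  have b0 := ltW D2gt0.
  have h' : 4 * K * x <= D ^+ 2 by rewrite -(@ler_pXn2r _ 2).
  by rewrite ler_pdivrMr//; lra.
(* [K / D^2 <= 1/4] follows from [16 K^2 <= D] and [1 <= D]; [K z^3 / D^2 <= 1/4] follows from
   [(4 K z^3)^2 <= 16 K^2 D^3 <= D^4], where [z^2 <= D] is used. *)
have half : eta <= 1 / 2.
  have h1 : K * 1 / D ^+ 2 <= 1 / 4.
    apply: sq_le => //; rewrite mulr1 exprMn (_ : 4 ^+ 2 = 16); last by ring.
    apply: (le_trans KD); apply: (le_trans D2).
    by rewrite [(D ^+ 2) ^+ 2]expr2 ler_peMl ?(ltW D2gt0)// (le_trans D1).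
  have h2 : K * z ^+ 3 / D ^+ 2 <= 1 / 4.
    apply: sq_le => //; rewrite exprMn exprMn (_ : 4 ^+ 2 = 16); last by ring.
    have -> : z ^+ 3 ^+ 2 = z ^+ 2 ^+ 3 by rewrite -!exprM.
    have -> : D ^+ 2 ^+ 2 = D * D ^+ 3 by ring.
    have a0 : 0 <= 16 * K ^+ 2 by rewrite mulr_ge0// sqr_ge0.
    have b0 : 0 <= (z ^+ 2) ^+ 3 by rewrite exprn_ge0// sqr_ge0.
    apply: (ler_pM a0 b0 KD).
    by rewrite lerXn2r ?nnegrE ?sqr_ge0// ltW.
  have -> : 1 / 2 = 1 / 4 + 1 / 4 :> R by field.
  apply: le_trans etaD _; apply: le_trans (lerD h1 h2).
  by rewrite -mulrDl -mulrDr.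
have zm : 2 * z * m <= 1.
  have zz : z <= 1 + z ^+ 2 by nra.
  have := ler_wpM2r (ltW m0) zz; have := ler_wpM2r (ltW m0) zD.
  have := ler_wpM2r (ltW m0) D2; have := ler_wpM2r (ltW m0) (le_trans D1 D2); move: mD; lra.
have [lo up] := chaos_stein FP z0 m0 zm.
have eps : expR (- (z ^+ 2 / 4)) * (C * m * (1 + z) ^+ 2) <= Psi * eta.
  have -> : Psi * eta = Psi * ((1 + z) / c) * (C * m * (1 + z) ^+ 2).
    by rewrite /eta; field; rewrite gt_eqF.
  by rewrite ler_wpM2r// !mulr_ge0 ?sqr_ge0 ?(ltW C_gt0)// ltW.
have etaB : 2 * eta <= 2 * K * ((1 + z ^+ 3) / D).
  apply: le_trans (_ : 2 * (K * (1 + z ^+ 3) / D ^+ 2) <= _); first by rewrite ler_wpM2l.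
  have a0 : 0 <= 2 * (K * (1 + z ^+ 3)) by rewrite mulr_ge0// mulr_ge0 ?addr_ge0// ltW.
  have Di : (D ^+ 2)^-1 <= D^-1 by rewrite lef_pV2 ?posrE.
  by have := ler_wpM2l a0 Di; lra.
have yB : z ^+ 3 / D <= (1 + z ^+ 3) / D by rewrite ler_wpM2r ?invr_ge0 ?(ltW D0)// lerDr.
apply/andP; split.
  apply: le_trans lo; have e1 : expR (- (2 * eta)) <= 1 - eta.
    have e0 : 0 < 1 - eta by lra.
    have h := ln_ge1B e0.
    rewrite -[leRHS]lnK ?posrE// ler_expR; apply: le_trans h.
    rewrite -subr_ge0 (_ : _ - _ = eta * (1 - 2 * eta) / (1 - eta)); last by field; rewrite gt_eqF; lra.
    have a1 : 0 <= 1 - 2 * eta by lra.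
    exact: divr_ge0 (mulr_ge0 eta0 a1) (ltW e0).
  apply: le_trans (_ : expR (- (z ^+ 3 * m)) * (Psi * (1 - eta)) <= _); last first.
    by rewrite ler_wpM2l ?expR_ge0//; lra.
  rewrite [leRHS]mulrCA ler_wpM2l ?(ltW Psi0)//.
  apply: le_trans (_ : expR (- (z ^+ 3 * m)) * expR (- (2 * eta)) <= _); last first.
    by rewrite ler_wpM2l ?expR_ge0.
  by rewrite -expRD ler_expR; move: z3m; lra.
apply: le_trans up _.
apply: le_trans (_ : expR (z ^+ 3 * m) * (Psi * (1 + eta)) <= _).
  by rewrite ler_wpM2l ?expR_ge0//; lra.
rewrite [leLHS]mulrCA ler_wpM2l ?(ltW Psi0)//.
apply: le_trans (_ : expR (z ^+ 3 * m) * expR eta <= _).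
  by rewrite ler_wpM2l ?expR_ge0// expR_ge1Dx.
by rewrite -expRD ler_expR; move: z3m; lra.
Qed.

(** In the range [D <= z^2] one has [1 <= z <= z^3 / D], so constants, factors [1 + z] and factors
    [exp z] are all of the allowed size: the tent bound is good enough from below, Chernoff's from
    above. *)
Lemma tail_ratio_crude (c1 : R) : 0 <= c1 -> c1 <= 1 -> C * c1 <= 16 * T -> C <= 16 * T * D ->
  D <= z ^+ 2 -> z <= c1 * D ->
  Psi * expR (- ((3 + `|ln c| + `|ln (T / 2)|) * ((1 + z ^+ 3) / D))) <= p <=
  Psi * expR ((3 + `|ln c| + `|ln (T / 2)|) * ((1 + z ^+ 3) / D)).
Proof.
move=> c10 c11 cT CD Dz zc.
have z1 : 1 <= z by rewrite -(@ler_pXn2r _ 2) ?nnegrE ?expr1n// (le_trans D1).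
have D2 : D <= D ^+ 2 by rewrite expr2 ler_peMl// ltW.
have yz : z <= z ^+ 3 / D.
  by rewrite ler_pdivlMr// exprS ler_wpM2l.
have yB : z ^+ 3 / D <= (1 + z ^+ 3) / D by rewrite ler_wpM2r ?invr_ge0 ?(ltW D0)// lerDr.
have B0 : 0 <= (1 + z ^+ 3) / D by apply: le_trans yB.
have l1 : `|ln c| <= `|ln c| * ((1 + z ^+ 3) / D) by rewrite ler_peMr//; lra.
have l2 : `|ln (T / 2)| <= `|ln (T / 2)| * ((1 + z ^+ 3) / D) by rewrite ler_peMr//; lra.
have l1' := mulr_ge0 (normr_ge0 (ln c)) B0.
have l2' := mulr_ge0 (normr_ge0 (ln (T / 2))) B0.
have mz0 : 0 <= m * z by rewrite mulr_ge0// ltW.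
have zD : z <= D by apply: le_trans zc _; rewrite ler_piMl// ltW.
apply/andP; split.
  have zm : 2 * z * m <= 1.
    have := ler_wpM2r (ltW m0) zD; have := ler_wpM2r (ltW m0) D2; move: mD; lra.
  apply: le_trans (chaos_tent FP z0 m0 zm).
  (* [C m (2 + 2 c1 D^2)] is at most [64 T D^2 m] by the two conditions on [C], hence at most
     [T / 2] because [128 D^2 m <= 1]. *)
  have eps : C * m * (1 + z) ^+ 2 <= T / 2.
    have h1 : (1 + z) ^+ 2 <= 2 + 2 * z ^+ 2.
      by rewrite -subr_ge0 (_ : _ - _ = (1 - z) ^+ 2) ?sqr_ge0//; ring.
    have h2 : z ^+ 2 <= c1 * D ^+ 2.
      have -> : c1 * D ^+ 2 = (c1 * D) * D by ring.
      by rewrite expr2; apply: ler_pM.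
    have h3 : C * m * (1 + z) ^+ 2 <= C * m * (2 + 2 * (c1 * D ^+ 2)).
      by rewrite ler_wpM2l ?mulr_ge0 ?(ltW C_gt0) ?(ltW m0)//; lra.
    apply: le_trans h3 _.
    have h4 : C * c1 * (D ^+ 2 * m) <= 16 * T * (D ^+ 2 * m).
      by rewrite ler_wpM2r// mulr_ge0 ?sqr_ge0// ltW.
    have h5 : C * m <= 16 * T * (D ^+ 2 * m).
      rewrite mulrA ler_wpM2r ?(ltW m0)//; apply: le_trans CD _.
      by rewrite ler_wpM2l// mulr_ge0// ltW.
    have h6 : T * (128 * D ^+ 2 * m) <= T * 1 by rewrite ler_wpM2l// ltW.
    lra.
  apply: le_trans (_ : expR (- z - z ^+ 2 / 4 - z ^+ 3 * m) * (T / 2) <= _); last first.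
    by rewrite ler_wpM2l ?expR_ge0//; lra.
  apply: le_trans (_ : expR (- (z ^+ 2 / 4)) * expR (- ((3 + `|ln c| + `|ln (T / 2)|) * ((1 + z ^+ 3) / D))) <= _).
    by rewrite ler_wpM2r ?expR_ge0// gauss_tail_le.
  rewrite -{2}[T / 2]lnK ?posrE ?divr_gt0// -!expRD ler_expR.
  have := ler_norm (- ln (T / 2)); rewrite normrN; move: z3m; lra.
apply: le_trans (chaos_chernoff FP z0) _.
have h1 : z ^+ 2 / 4 - z ^+ 3 * m <= z ^+ 2 / (4 * (1 + m * z)).
  rewrite ler_pdivlMr; last by rewrite mulr_gt0// ltr_wpDr.
  have -> : (z ^+ 2 / 4 - z ^+ 3 * m) * (4 * (1 + m * z)) =
    z ^+ 2 - 3 * (z ^+ 3 * m) - 4 * (z ^+ 3 * m) * (m * z) by field.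
  have : 0 <= z ^+ 3 * m by rewrite mulr_ge0// ltW.
  by move=> h; have := mulr_ge0 h mz0; lra.
apply: le_trans (_ : expR (- (z ^+ 2 / 4)) * expR (z ^+ 3 * m) <= _).
  by rewrite -expRD ler_expR; lra.
apply: le_trans (ler_wpM2r (expR_ge0 _) tail_mass) _.
rewrite -mulrA ler_wpM2l ?(ltW Psi0)//.
apply: le_trans (_ : expR z / c * expR (z ^+ 3 * m) <= _).
  by rewrite ler_wpM2r ?expR_ge0// ler_wpM2r ?invr_ge0 ?(ltW c_gt0)// expR_ge1Dx.
rewrite -{1}[c]lnK ?posrE// -expRN -!expRD ler_expR.
have := ler_norm (- ln c); rewrite normrN; move: z3m; lra.
Qed.

Lemma tail_ratio (c1 : R) : 0 <= c1 -> c1 <= 1 -> C * c1 <= 16 * T -> C <= 16 * T * D ->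
  16 * K ^+ 2 <= D -> z <= c1 * D ->
  (`|lne (P [set w | (z <= F w)%R] / Psi%:E)| <=
    (3 * tail_const * ((1 + (z / Num.sqrt 2) ^+ 3) / D))%:E)%E.
Proof.
move=> c10 c11 cT CD KD zc.
have B0 : 0 <= (1 + z ^+ 3) / D by rewrite divr_ge0 ?addr_ge0// ltW.
have b : Psi * expR (- (tail_const * ((1 + z ^+ 3) / D))) <= p <=
    Psi * expR (tail_const * ((1 + z ^+ 3) / D)).
  have K0 := ltW K_gt0.
  have n1 := normr_ge0 (ln c); have n2 := normr_ge0 (ln (T / 2)).
  have weaken (k : R) : k <= tail_const ->
      Psi * expR (- (k * ((1 + z ^+ 3) / D))) <= p <= Psi * expR (k * ((1 + z ^+ 3) / D)) ->
      Psi * expR (- (tail_const * ((1 + z ^+ 3) / D))) <= p <=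
      Psi * expR (tail_const * ((1 + z ^+ 3) / D)).
    move=> kt /andP[h1 h2]; have kB := ler_wpM2r B0 kt.
    apply/andP; split; [apply: le_trans h1|apply: le_trans h2 _];
      by rewrite ler_wpM2l ?(ltW Psi0)// ler_expR ?lerN2.
  have [zD|Dz] := leP (z ^+ 2) D.
    by apply: weaken (tail_ratio_stein KD zD); rewrite /tail_const; lra.
  by apply: weaken (tail_ratio_crude c10 c11 cT CD (ltW Dz) zc); rewrite /tail_const; lra.
have p0 : 0 < p by case/andP: b => + _; apply: lt_le_trans; rewrite mulr_gt0 ?expR_gt0.
have mF : measurable [set w | z <= F w].
  rewrite (_ : [set _ | _] = F @^-1` `[z, +oo[); last first.
    by apply/seteqP; split => w /=; rewrite in_itv/= andbT.
  by rewrite -[X in measurable X]setTI; case: FP => + _; exact.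
rewrite -[P _]fineK ?fin_num_measure// inver gt_eqF// -EFinM lne_EFin ?divr_gt0//.
rewrite abse_EFin lee_fin.
(* The statement measures [z] in standard deviations: [(sqrt 2)^3 = 2 sqrt 2 <= 3], the factor in
   front of [tail_const]. *)
have z33 : z ^+ 3 <= 3 * (z / Num.sqrt 2) ^+ 3.
  have s2 : (Num.sqrt 2 : R) ^+ 2 = 2 by rewrite sqr_sqrtr.
  have s0 : 0 < (Num.sqrt 2 : R) by rewrite sqrtr_gt0.
  have s1 : (Num.sqrt 2 : R) <= 3 / 2 by move: s0 s2; nra.
  rewrite expr_div_n mulrA ler_pdivlMr ?exprn_gt0// [leLHS]mulrC ler_wpM2r//.
  rewrite exprS s2; lra.
apply: (@le_trans _ _ (tail_const * ((1 + z ^+ 3) / D))); last first.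
  have -> : 3 * tail_const * ((1 + (z / Num.sqrt 2) ^+ 3) / D) =
    tail_const * ((3 + 3 * (z / Num.sqrt 2) ^+ 3) / D) by move: ((z / _) ^+ 3) => u; field; rewrite gt_eqF.
  rewrite ler_wpM2l ?(ltW tail_const_gt0)// ler_wpM2r ?invr_ge0 ?(ltW D0)//; lra.
case/andP: b => b1 b2; rewrite ler_norml -[X in X <= _ <= _]expRK -[X in _ <= _ <= X]expRK.
rewrite !ler_ln ?posrE ?expR_gt0 ?divr_gt0//.
by rewrite ler_pdivlMr// ler_pdivrMr// !(mulrC (expR _)) b1 b2.
Qed.

End bounds.
End tail_ratio.

(** * Concentration *)

Section concentration.
Context {R : realType} d (U : measurableType d) (P : probability U R).
Variables (F : U -> R) (m D z : R).
Hypotheses (FP : chaos_limit P F m) (D0 : 0 < D) (mD : 2 * D * m <= 1) (z0 : 0 <= z).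

(** If [m z <= 1] the denominator [1 + m z] is at most [2], which gives [z^2 / 2]. Otherwise it is
    at most [2 m z], and [2 D m <= 1] gives [z D]. *)
Let one_sided (G : U -> R) : chaos_limit P G m ->
  (P [set w | (z <= G w)%R] <= (expR (- (4^-1 * Num.min (z ^+ 2 / 2) (z * D))))%:E)%E.
Proof.
move=> GP; have m0 := chaos_weight_bound_ge0 GP.
have mG : measurable [set w | z <= G w].
  rewrite (_ : [set _ | _] = G @^-1` `[z, +oo[); last first.
    by apply/seteqP; split => w /=; rewrite in_itv/= andbT.
  by rewrite -[X in measurable X]setTI; case: GP => + _; exact.
rewrite -[P _]fineK ?fin_num_measure// lee_fin.
apply: le_trans (chaos_chernoff GP z0) _; rewrite ler_expR lerN2.
have mz0 : 0 <= m * z by rewrite mulr_ge0.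
have d0 : 0 < 1 + m * z by rewrite ltr_wpDr.
have -> : z ^+ 2 / (4 * (1 + m * z)) = 4^-1 * (z ^+ 2 / (1 + m * z)).
  by field; rewrite gt_eqF.
rewrite ler_wpM2l// ge_min; have [h|h] := leP (m * z) 1.
  by rewrite ler_wpM2l ?sqr_ge0// lef_pV2 ?posrE//; lra.
apply/orP; right; rewrite ler_pdivlMr//.
have -> : z * D * (1 + m * z) = z * D + z * z * (D * m) by ring.
have h1 : z * z * (2 * D * m) <= z * z * 1 by rewrite ler_wpM2l// mulr_ge0.
have h2 : z * D * 1 <= z * D * (m * z) by rewrite ler_wpM2l ?mulr_ge0 ?(ltW h)// ltW.
rewrite expr2; lra.
Qed.

Lemma chaos_concentration :
  (P [set w | (z <= `|F w|)%R] <=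
    (2 * expR (- (4^-1 * Num.min (z ^+ 2 / 2) (z * D))))%:E)%E.
Proof.
have mS (G : U -> R) : measurable_fun setT G -> measurable [set w | z <= G w].
  move=> mG; rewrite (_ : [set _ | _] = G @^-1` `[z, +oo[); last first.
    by apply/seteqP; split => w /=; rewrite in_itv/= andbT.
  by rewrite -[X in measurable X]setTI; exact: mG.
have NP := chaos_limitN FP; have [mF _] := FP; have [mN _] := NP.
rewrite (_ : [set w | _] = [set w | z <= F w] `|` [set w | z <= - F w]); last first.
  apply/seteqP; split => w /=; last by rewrite ler_normr => -[->//|->]; rewrite orbT.
  by rewrite ler_normr => /orP.
have U2 := @measureU2 _ _ _ P _ _ (mS _ mF) (mS _ mN).
apply: (le_trans U2).
rewrite [2 * _](_ : _ = expR (- (4^-1 * Num.min (z ^+ 2 / 2) (z * D))) + expR (- (4^-1 * Num.min (z ^+ 2 / 2) (z * D)))); last by ring.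
by rewrite EFinD leeD// one_sided.
Qed.

End concentration.

Lemma limn_esup_le {R : realType} (u : nat -> \bar R) (c : \bar R) :
  (\forall n \near \oo, (u n <= c)%E) -> (limn_esup u <= c)%E.
Proof.
move=> [N _ NP]; rewrite /limn_esup /limf_esup.
apply: (@le_trans _ _ (ereal_sup [set u x | x in [set n | (N <= n)%N]])).
  apply: ereal_inf_lbound; exists [set n | (N <= n)%N] => //.
  by exists N.
by apply: ge_ereal_sup => _ [n /= Nn <-]; exact: NP.
Qed.

Lemma limn_einf_ge {R : realType} (u : nat -> \bar R) (c : \bar R) :
  (\forall n \near \oo, (c <= u n)%E) -> (c <= limn_einf u)%E.
Proof.
move=> H; rewrite /limn_einf leeNr; apply: limn_esup_le.
by apply: filterS H => n; rewrite leeN2.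
Qed.

(** * Moderate deviations *)

Section moderate_deviations.
Context {R : realType} dO (Omega : measurableType dO) (P : probability Omega R).
Variables (a m : nat -> R).
Hypotheses (a_oo : a n @[n --> \oo] --> +oo)
  (am0 : a n ^+ 2 * m n @[n --> \oo] --> (0 : R)).
Implicit Type F : nat -> Omega -> R.
Local Notation chaos F := (\forall n \near \oo, chaos_limit P (F n) (m n) /\ 0 < m n).

Let a_ge A : \forall n \near \oo, A <= a n.
Proof. by move: A; apply/cvgryPge. Qed.

Let am_le e : 0 < e -> \forall n \near \oo, a n ^+ 2 * m n <= e.
Proof.
move=> e0; have /cvgrPdist_le/(_ e e0) := am0; apply: filterS => n.
by rewrite sub0r normrN; apply: le_trans; exact: ler_norm.
Qed.

(** In Chernoff's bound at [a rho] the denominator [1 + m a rho] tends to [1], as [m a <= a^2 m]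
    once [a >= 1]; its effect is absorbed in [e]. *)
Lemma mdp_upper F rho e : chaos F -> 0 <= rho -> 0 < e ->
  \forall n \near \oo, fine (P [set w | a n * rho <= F n w]) <=
    expR (- (a n ^+ 2 * (rho ^+ 2 / 4 - e))).
Proof.
(* Threshold for [a^2 m] under which [rho^3 m a <= 4 e]; the [+ 1] covers [rho = 0]. *)
move=> FP r0 e0; have e10 : 0 < 4 * e / (rho ^+ 3 + 1).
  by rewrite divr_gt0// ?mulr_gt0// ltr_wpDl// exprn_ge0.
near=> n.
have [Fn m0] : chaos_limit P (F n) (m n) /\ 0 < m n by near: n.
have a1 : 1 <= a n by near: n; exact: a_ge.
have h : a n ^+ 2 * m n <= 4 * e / (rho ^+ 3 + 1) by near: n; exact: am_le.
have a0 : 0 < a n by exact: lt_le_trans a1.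
have z0 : 0 <= a n * rho by rewrite mulr_ge0// ltW.
apply: le_trans (chaos_chernoff Fn z0) _; rewrite ler_expR lerN2.
have x0 : 0 <= m n * (a n * rho) by rewrite mulr_ge0// ltW.
rewrite ler_pdivlMr; last by rewrite mulr_gt0// ltr_wpDr.
have r3 : 0 <= rho ^+ 3 by exact: exprn_ge0.
have h1 : rho ^+ 3 * (m n * a n) <= 4 * e.
  have h2 : m n * a n <= a n ^+ 2 * m n.
    by rewrite expr2 -mulrA [leLHS]mulrC ler_peMl// mulr_ge0// ltW.
  have := ler_wpM2l r3 (le_trans h2 h).
  have : rho ^+ 3 * (4 * e / (rho ^+ 3 + 1)) <= 4 * e.
    rewrite mulrA ler_pdivrMr ?ltr_wpDl//; nra.
  lra.
have -> : a n ^+ 2 * (rho ^+ 2 / 4 - e) * (4 * (1 + m n * (a n * rho))) =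
  (a n * rho) ^+ 2 + a n ^+ 2 * (rho ^+ 3 * (m n * a n) - 4 * e) - 4 * e * a n ^+ 2 * (m n * (a n * rho)).
  by field.
have := mulr_ge0 (mulr_ge0 (mulr_ge0 (ler0n R 4) (ltW e0)) (sqr_ge0 (a n))) x0.
have : a n ^+ 2 * (rho ^+ 3 * (m n * a n) - 4 * e) <= 0.
  by rewrite mulr_ge0_le0 ?sqr_ge0// subr_le0.
lra.
Unshelve. all: by end_near. Qed.

(** The tail at [a z] minus the tail at [a (z + dl)], exponentially smaller by [mdp_upper]. The
    first is bounded by the tent and not by Stein's comparison: only [a^2 m] is known to vanish,
    which controls the error [m (1 + a z)^2] but not [m (1 + a z)^3]. The loss [exp (- a z)] is
    invisible at speed [a^2]. *)
Lemma mdp_lower F z dl e : chaos F -> 0 <= z -> 0 < dl -> 0 < e ->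
  \forall n \near \oo, expR (- (a n ^+ 2 * (z ^+ 2 / 4 + e))) <=
    fine (P [set w | a n * z <= F n w < a n * (z + dl)]).
Proof.
move=> FP z0 dl0 e0; set T := (gauss_tent : R); set C : R := 12 + 2 * stein_const.
have T0 : 0 < T by exact: gauss_tent_gt0.
have C0 : 0 < C by rewrite /C; have := @stein_const_ge1 R; lra.
(* The tent bound loses [2 e1] in the exponent and the final constant another [e1], in all at most
   [e]; [4 e1 <= dl^2 / 4] puts the tail beyond [z + dl] a further factor [exp (- a^2 e1)] below. *)
pose e1 := Num.min (e / 3) (dl ^+ 2 / 16).
have e10 : 0 < e1 by rewrite lt_min !divr_gt0// exprn_gt0.
have e1e : 3 * e1 <= e.
  by have : e1 <= e / 3 by [rewrite ge_min lexx]; lra.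
have e1d : 4 * e1 <= dl ^+ 2 / 4.
  by have : e1 <= dl ^+ 2 / 16 by [rewrite ge_min lexx orbT]; lra.
have z3 : 0 <= z ^+ 3 by exact: exprn_ge0.
have d1 : 0 < e1 / (z ^+ 3 + 1) by rewrite divr_gt0// ltr_wpDl.
have d2 : 0 < T / (2 * (C * (2 + 2 * z ^+ 2))).
  by rewrite divr_gt0// !mulr_gt0// ltr_wpDr// mulr_ge0// sqr_ge0.
have d3 : 0 < (2 * z + 1)^-1 by rewrite invr_gt0 ltr_wpDl// mulr_ge0.
near=> n.
have [Fn m0] : chaos_limit P (F n) (m n) /\ 0 < m n by near: n.
have a1 : 1 <= a n by near: n; exact: a_ge.
have az : z / e1 <= a n by near: n; exact: a_ge.
have aT : - ln (T / 4) / e1 <= a n by near: n; exact: a_ge.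
have h1 : a n ^+ 2 * m n <= e1 / (z ^+ 3 + 1) by near: n; exact: am_le.
have h2 : a n ^+ 2 * m n <= T / (2 * (C * (2 + 2 * z ^+ 2))) by near: n; exact: am_le.
have h3 : a n ^+ 2 * m n <= (2 * z + 1)^-1 by near: n; exact: am_le.
have up : fine (P [set w | a n * (z + dl) <= F n w]) <= expR (- (a n ^+ 2 * ((z + dl) ^+ 2 / 4 - e1))).
  by near: n; apply: mdp_upper => //; rewrite addr_ge0// ltW.
have a0 : 0 < a n by exact: lt_le_trans a1.
have a2 : a n <= a n ^+ 2 by rewrite expr2 ler_peMl// ltW.
have a20 : 0 < a n ^+ 2 by rewrite exprn_gt0.
have am : m n * a n <= a n ^+ 2 * m n by rewrite [leLHS]mulrC ler_wpM2r// ltW.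
have az0 : 0 <= a n * z by rewrite mulr_ge0// ltW.
have zm : 2 * (a n * z) * m n <= 1.
  have : 2 * z * (m n * a n) <= 2 * z * (2 * z + 1)^-1.
    by rewrite ler_wpM2l ?mulr_ge0// (le_trans am).
  have : 2 * z * (2 * z + 1)^-1 <= 1 by rewrite ler_pdivrMr ?mul1r ?lerDl// ltr_wpDl// mulr_ge0.
  lra.
have lo := chaos_tent Fn az0 m0 zm; rewrite -/T -/C in lo.
have eps : C * m n * (1 + a n * z) ^+ 2 <= T / 2.
  have s1 : (1 + a n * z) ^+ 2 <= a n ^+ 2 * (2 + 2 * z ^+ 2).
    have : (1 + a n * z) ^+ 2 <= 2 + 2 * (a n * z) ^+ 2.
      by rewrite -subr_ge0 (_ : _ - _ = (1 - a n * z) ^+ 2) ?sqr_ge0//; ring.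
    have : 1 <= a n ^+ 2 by exact: le_trans a2.
    rewrite exprMn; lra.
  have s2 : C * m n * (1 + a n * z) ^+ 2 <= C * m n * (a n ^+ 2 * (2 + 2 * z ^+ 2)).
    by apply: ler_wpM2l s1; apply: mulr_ge0; exact: ltW.
  have Q0 : 0 < C * (2 + 2 * z ^+ 2) by rewrite mulr_gt0// ltr_wpDr// mulr_ge0// sqr_ge0.
  have := ler_wpM2l (ltW Q0) h2.
  rewrite (_ : C * (2 + 2 * z ^+ 2) * (T / (2 * (C * (2 + 2 * z ^+ 2)))) = T / 2); last first.
    by move: (C * (2 + _)) Q0 => Q Q0; field; rewrite gt_eqF.
  lra.
set E := expR (- (a n ^+ 2 * (z ^+ 2 / 4 + 2 * e1))).
have E0 : 0 <= E by exact: expR_ge0.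
have tail : expR (- (a n ^+ 2 * e1)) <= T / 4.
  rewrite -[leRHS]lnK ?posrE ?divr_gt0// ler_expR lerNl.
  move: aT; rewrite ler_pdivrMr// => aT.
  have := ler_wpM2r (ltW e10) a2; lra.
have p1 : E * (T / 2) <= fine (P [set w | a n * z <= F n w]).
  apply: le_trans lo; apply: ler_pM => //; rewrite ?divr_ge0 ?(ltW T0)//; last by lra.
  rewrite ler_expR.
  have k1 : a n * z <= a n ^+ 2 * e1.
    by rewrite expr2 -mulrA ler_wpM2l ?(ltW a0)//; move: az; rewrite ler_pdivrMr.
  have k2 : (a n * z) ^+ 3 * m n <= a n ^+ 2 * e1.
    have : z ^+ 3 * (m n * a n) <= e1.
      have := ler_wpM2l z3 (le_trans am h1).
      have : z ^+ 3 * (e1 / (z ^+ 3 + 1)) <= e1.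
        by rewrite mulrA ler_pdivrMr ?ltr_wpDl//; nra.
      lra.
    by move=> /(ler_wpM2l (ltW a20)); rewrite exprMn; lra.
  rewrite exprMn; lra.
have p2 : fine (P [set w | a n * (z + dl) <= F n w]) <= E * (T / 4).
  apply: le_trans up _; apply: le_trans (_ : E * expR (- (a n ^+ 2 * e1)) <= _); last first.
    by rewrite ler_wpM2l.
  rewrite -expRD ler_expR -opprD lerN2 -mulrDr ler_wpM2l ?(ltW a20)//.
  have : 0 <= z * dl by rewrite mulr_ge0// ltW.
  rewrite sqrrD; lra.
have mF c : measurable [set w | c <= F n w].
  rewrite (_ : [set w | _] = F n @^-1` `[c, +oo[); last first.
    by apply/seteqP; split => w /=; rewrite in_itv/= andbT.
  by rewrite -[X in measurable X]setTI; case: Fn => + _; exact.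
have mS : measurable [set w | a n * z <= F n w < a n * (z + dl)].
  rewrite (_ : [set w | _] = F n @^-1` `[a n * z, a n * (z + dl)[); last first.
    by apply/seteqP; split => w /=; rewrite in_itv/=.
  by rewrite -[X in measurable X]setTI; case: Fn => + _; exact.
have split : fine (P [set w | a n * z <= F n w]) <=
    fine (P [set w | a n * z <= F n w < a n * (z + dl)]) + fine (P [set w | a n * (z + dl) <= F n w]).
  rewrite -lee_fin EFinD !fineK ?fin_num_measure//; try exact: mF.
  apply: le_trans (@measureU2 _ _ _ P _ _ mS (mF _)).
  apply: le_measure; rewrite ?inE//; first by apply: measurableU => //; exact: mF.
  by move=> w /= h; have [h'|h'] := leP (a n * (z + dl)) (F n w); [right|left; rewrite h].
apply: (@le_trans _ _ (E * (T / 4))); last by lra.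
apply: le_trans (_ : E * expR (- (a n ^+ 2 * e1)) <= _); last by rewrite ler_wpM2l.
rewrite -expRD ler_expR -opprD lerN2 -mulrDr ler_wpM2l ?(ltW a20)//; lra.
Unshelve. all: by end_near. Qed.

Lemma limn_einf_mdp F (B : set R) z dl : chaos F -> 0 <= z -> 0 < dl -> measurable B ->
  (forall x, z <= x < z + dl -> B x) ->
  ((- (z ^+ 2 / 4))%:E <=
    limn_einf (fun n => (((a n) ^+ 2)^-1)%:E *
      lne (P ((fun w => ((a n)^-1 * F n w)%R) @^-1` B))))%E.
Proof.
move=> FP z0 dl0 mB zB; apply/lee_subgt0Pr => e e0; apply: limn_einf_ge.
near=> n.
have [[mF _] _] : chaos_limit P (F n) (m n) /\ 0 < m n by near: n.
have a1 : 1 <= a n by near: n; exact: a_ge.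
have lo : expR (- (a n ^+ 2 * (z ^+ 2 / 4 + e))) <=
    fine (P [set w | a n * z <= F n w < a n * (z + dl)]) by near: n; exact: mdp_lower.
have a0 : 0 < a n by exact: lt_le_trans a1.
have mFB : measurable ((fun w => (a n)^-1 * F n w) @^-1` B).
  by rewrite -[X in measurable X]setTI; apply: measurable_funM => //; exact: measurable_cst.
have mS : measurable [set w | a n * z <= F n w < a n * (z + dl)].
  rewrite (_ : [set w | _] = F n @^-1` `[a n * z, a n * (z + dl)[); last first.
    by apply/seteqP; split => w /=; rewrite in_itv/=.
  by rewrite -[X in measurable X]setTI; exact: mF.
have le : fine (P [set w | a n * z <= F n w < a n * (z + dl)]) <=
    fine (P ((fun w => (a n)^-1 * F n w) @^-1` B)).
  rewrite fine_le ?fin_num_measure// le_measure ?inE// => w /= /andP[w1 w2]; apply: zB.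
  by rewrite ler_pdivlMl// ltr_pdivrMl// w1.
have p0 : 0 < fine (P ((fun w => (a n)^-1 * F n w) @^-1` B)).
  by apply: lt_le_trans (le_trans lo le); exact: expR_gt0.
rewrite -[P _]fineK ?fin_num_measure// lne_EFin// -EFinB -EFinM lee_fin.
rewrite ler_pdivlMl ?exprn_gt0//.
have := le_trans lo le; rewrite -ler_ln ?posrE ?expR_gt0// expRK; lra.
Unshelve. all: by end_near. Qed.

(** The set lies in [|x| >= 2 sqrt y], so its probability is at most the sum of two one-sided tails;
    the resulting factor [2] disappears at speed [a^2]. *)
Lemma limn_esup_mdp F (B : set R) y : chaos F -> chaos (fun n w => - F n w) ->
  0 <= y -> measurable B -> (forall x, B x -> y <= x ^+ 2 / 4) ->
  (limn_esup (fun n => (((a n) ^+ 2)^-1)%:E *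
      lne (P ((fun w => ((a n)^-1 * F n w)%R) @^-1` B))) <= (- y)%:E)%E.
Proof.
move=> FP NP y0 mB yB; apply/lee_addgt0Pr => e e0; apply: limn_esup_le.
pose rho := 2 * Num.sqrt y.
have rho0 : 0 <= rho by rewrite mulr_ge0// sqrtr_ge0.
have rho2 : rho ^+ 2 / 4 = y by rewrite exprMn sqr_sqrtr//; field.
have e2 : 0 < e / 2 by rewrite divr_gt0.
near=> n.
have [[mF _] _] : chaos_limit P (F n) (m n) /\ 0 < m n by near: n.
have a1 : 1 <= a n by near: n; exact: a_ge.
have ae : ln 2 / (e / 2) <= a n by near: n; exact: a_ge.
have u1 : fine (P [set w | a n * rho <= F n w]) <= expR (- (a n ^+ 2 * (rho ^+ 2 / 4 - e / 2))).
  by near: n; exact: mdp_upper.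
have u2 : fine (P [set w | a n * rho <= - F n w]) <= expR (- (a n ^+ 2 * (rho ^+ 2 / 4 - e / 2))).
  by near: n; exact: (@mdp_upper (fun n w => - F n w)).
have a0 : 0 < a n by exact: lt_le_trans a1.
have mG (G : Omega -> R) : measurable_fun setT G -> measurable [set w | a n * rho <= G w].
  move=> mG; rewrite (_ : [set w | _] = G @^-1` `[a n * rho, +oo[); last first.
    by apply/seteqP; split => w /=; rewrite in_itv/= andbT.
  by rewrite -[X in measurable X]setTI; exact: mG.
have m1 := mG _ mF.
have m2 := mG _ (measurableT_comp (@oppr_measurable R setT) mF).
have mFB : measurable ((fun w => (a n)^-1 * F n w) @^-1` B).
  by rewrite -[X in measurable X]setTI; apply: measurable_funM => //; exact: measurable_cst.
have le : fine (P ((fun w => (a n)^-1 * F n w) @^-1` B)) <=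
    2 * expR (- (a n ^+ 2 * (y - e / 2))).
  rewrite rho2 in u1 u2.
  apply: (@le_trans _ _ (fine (P [set w | a n * rho <= F n w]) + fine (P [set w | a n * rho <= - F n w]))); last by lra.
  rewrite -lee_fin EFinD !fineK ?fin_num_measure//.
  apply: le_trans (@measureU2 _ _ _ P _ _ m1 m2).
  apply: le_measure; rewrite ?inE//; first exact: measurableU.
  move=> w /= /yB; rewrite -rho2 => h.
  have : rho <= `|(a n)^-1 * F n w|.
    rewrite -(@ler_pXn2r _ 2) ?nnegrE// real_normK ?num_real//; lra.
  rewrite normrM gtr0_norm ?invr_gt0// ler_pdivlMl// ler_normr => /orP[]; by [left|right].
(* If the probability vanishes, its [lne] is [-oo] and the bound is trivial. *)
have [p0|p0] := leP (fine (P ((fun w => (a n)^-1 * F n w) @^-1` B))) 0.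
  rewrite -[P _]fineK ?fin_num_measure// le0_lneNy ?lee_fin//.
  by rewrite gt0_muleNy ?lte_fin ?invr_gt0 ?exprn_gt0// leNye.
rewrite -[P _]fineK ?fin_num_measure// lne_EFin// -EFinD -EFinM lee_fin.
rewrite ler_pdivrMl ?exprn_gt0//.
move: le; rewrite -ler_ln ?posrE ?mulr_gt0 ?expR_gt0// lnM ?posrE ?expR_gt0// expRK.
have a2 : a n <= a n ^+ 2 by rewrite expr2 ler_peMl// ltW.
move: ae; rewrite ler_pdivrMr// => ae.
have := ler_wpM2r (ltW e2) a2; lra.
Unshelve. all: by end_near. Qed.

Lemma chaos_mdp F : chaos F ->
  large_deviation_principle P (fun n w => (a n)^-1 * F n w)
    (fun n => a n ^+ 2) (fun z => (z ^+ 2 / 4)%:E).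
Proof.
move=> FP; have NP : chaos (fun n w => - F n w).
  by apply: filterS FP => n [h ?]; split => //; exact: chaos_limitN.
split.
- apply: filterS FP => n [[mF _] _].
  by apply: measurable_funM => //; exact: measurable_cst.
- apply/cvgryPge => A; near=> n.
  have a1 : 1 <= a n by near: n; exact: a_ge.
  have aA : A <= a n by near: n; exact: a_ge.
  by apply: le_trans aA _; rewrite expr2 ler_peMl// (le_trans ler01).
- split.
  + by move=> z; rewrite lee_fin divr_ge0// sqr_ge0.
  + apply/lower_semicontinuousP => c.
    rewrite (_ : [set x | _] = (fun x : R => x ^+ 2 / 4) @^-1` `]c, +oo[%classic); last first.
      by apply/seteqP; split => x /=; rewrite lte_fin in_itv/= andbT.
    apply: open_comp; last exact: rray_open.
    by move=> x _; apply: cvgM; [exact: exprn_continuous|exact: cvg_cst].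
  + move=> c; have [c0|c0] := ltP c 0.
      rewrite (_ : [set z | _] = set0); first exact: compact0.
      apply/seteqP; split => z //=; rewrite lee_fin => h.
      by have := sqr_ge0 z; lra.
    rewrite (_ : [set z | _] = `[- (2 * Num.sqrt c), 2 * Num.sqrt c]%classic); first exact: segment_compact.
    have s0 : 0 <= 2 * Num.sqrt c by rewrite mulr_ge0// sqrtr_ge0.
    have s2 : (2 * Num.sqrt c) ^+ 2 = 4 * c by rewrite exprMn sqr_sqrtr//; ring.
    apply/seteqP; split => z /=; rewrite lee_fin in_itv/= -ler_norml;
      rewrite -(@ler_pXn2r _ 2 isT `|z|) ?nnegrE// s2 real_normK ?num_real//; lra.
- move=> B mB; split.
    rewrite leeNl; apply: le_ereal_inf_tmp => _ [z zB <-]; rewrite leeNl -EFinN.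
    have /nbhs_ballP[dl /= dl0 zdl] : nbhs z B by exact: zB.
    have [z0|z0] := leP 0 z.
      apply: (limn_einf_mdp FP z0 dl0 mB) => x /andP[zx xz]; apply: zdl.
      by rewrite -ball_normE /= distrC ger0_norm ?subr_ge0//; lra.
    (* A negative [z] is reduced to [- z] by reflecting both [B] and [F]. *)
    have mB' : measurable [set x : R | B (- x)].
      by rewrite -[X in measurable X]setTI; exact: oppr_measurable.
    have zN : 0 <= - z by rewrite oppr_ge0 ltW.
    have := @limn_einf_mdp _ [set x | B (- x)] (- z) dl NP zN dl0 mB'.
    rewrite sqrrN.
    rewrite (_ : (fun n => _) = (fun n => (((a n) ^+ 2)^-1)%:E *
      lne (P ((fun w => ((a n)^-1 * F n w)%R) @^-1` B)))%E); last first.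
      apply/funext => n; congr (_ * lne (P _))%E.
      by apply/seteqP; split => w /=; rewrite mulrN opprK.
    apply => x /andP[zx xz]; apply: zdl.
    by rewrite -ball_normE /= opprK ger0_norm; lra.
set J := ereal_inf _.
have J0 : (0 <= J)%E.
  by apply: le_ereal_inf_tmp => _ [z _ <-]; rewrite lee_fin divr_ge0// sqr_ge0.
have JB y : (y%:E <= J)%E -> forall x, B x -> y <= x ^+ 2 / 4.
  move=> yJ x Bx; rewrite -lee_fin; apply: le_trans yJ _.
  by apply: ereal_inf_lbound; exists x => //; exact: subset_closure.
case: J J0 JB => [r||//] J0 JB.
  by apply: limn_esup_mdp => //; exact: JB.
(* Here the infimum is [+oo]: every real number bounds the rate from below on [B], so the upper
   limit is below every real number. *)
set X := limn_esup _; have key r : (X <= r%:E)%E.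
  have := @limn_esup_mdp F B (Num.max 0 (- r)) FP NP _ mB.
  rewrite le_max lexx => /(_ isT (JB _ (leey _))) h.
  by apply: le_trans h _; rewrite lee_fin lerNl le_max lexx orbT.
case: X key => [r||] key //; last by have := key 0.
by exfalso; move: (key (r - 1)) => {key}; rewrite lee_fin; lra.
Unshelve. all: by end_near. Qed.

End moderate_deviations.

Theorem theorem7 (R : realType) :
  (forall (d : nat) (dO : measure_display) (Omega : measurableType dO)
      (P : probability Omega R) (W : d.-tuple R -> Omega -> R)
      (a : nat -> R),
    (1 <= d)%N -> brownian_sheet P W ->
    a n @[n --> \oo] --> +oo ->
    a n / Delta R d n @[n --> \oo] --> (0 : R) ->
    large_deviation_principle P (fun n w => (a n)^-1 * Ffun W n w)
      (fun n => a n ^+ 2) (fun z => (z ^+ 2 / 4)%:E)) /\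
  (exists c0 c1 c2 : R, [/\ 0 < c0, 0 < c1, 0 < c2 &
    forall (d : nat) (dO : measure_display) (Omega : measurableType dO)
      (P : probability Omega R) (W : d.-tuple R -> Omega -> R)
      (n : nat) (z : R),
    (1 <= d)%N -> brownian_sheet P W ->
    (2 <= n)%N -> c0 <= Delta R d n -> 0 <= z <= c1 * Delta R d n ->
    (`| lne (P [set w | (z <= Ffun W n w)%R] / (1 - Phi 2 z)) | <=
       (c2 * ((1 + (z / Num.sqrt 2) ^+ 3) / Delta R d n))%:E)%E /\
    (`| lne (P [set w | (Ffun W n w <= - z)%R] / Phi 2 (- z)) | <=
       (c2 * ((1 + (z / Num.sqrt 2) ^+ 3) / Delta R d n))%:E)%E]) /\
  (forall (d : nat) (dO : measure_display) (Omega : measurableType dO)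
      (P : probability Omega R) (W : d.-tuple R -> Omega -> R)
      (n : nat) (z : R),
    (1 <= d)%N -> brownian_sheet P W ->
    (2 <= n)%N -> 0 <= z ->
    (P [set w | (z <= `|Ffun W n w|)%R] <=
       (2 * expR (- (4^-1 * Num.min (z ^+ 2 / 2) (z * Delta R d n))))%:E)%E).
Proof.
split; [|split].
- move=> d dO Omega P W a d1 bW a_oo aD.
  apply: (@chaos_mdp R dO Omega P a (fun n => chaos_weight n d) a_oo).
    (* The second entry of the minimum in [chaos_weight] bounds [a^2 m] by [(a / Delta)^2 / 128]. *)
    have lim0 : 128^-1 * (a n / Delta R d n) ^+ 2 @[n --> \oo] --> (0 : R).
      have := @exprn_continuous R 2 0 => /(cvg_comp _ _ aD) aD2.
      rewrite -(mulr0 (128^-1 : R)); apply: cvgM; first exact: cvg_cst.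
      by move: aD2; rewrite expr0n.
    apply: (@squeeze_cvgr _ _ _ _ (fun=> 0) (fun n => 128^-1 * (a n / Delta R d n) ^+ 2)).
    + near=> n; have n2 : (2 <= n)%N by near: n; exact: nbhs_infty_ge.
      have w0 := @chaos_weight_gt0 R n n2 d.
      have D0 := @Delta_gt0 R n n2 d.
      rewrite mulr_ge0 ?sqr_ge0 ?(ltW w0)//=.
      rewrite exprMn mulrCA ler_wpM2l ?sqr_ge0//.
      have : chaos_weight n d <= (128 * Delta R d n ^+ 2)^-1.
        by rewrite ge_min lexx orbT.
      by rewrite invfM exprVn.
    + exact: cvg_cst.
    + exact: lim0.
  near=> n; have n2 : (2 <= n)%N by near: n; exact: nbhs_infty_ge.
  by split; [exact: brownian_chaos|exact: chaos_weight_gt0].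
- set C : R := 12 + 2 * stein_const; set T : R := gauss_tent; set K : R := ratio_const.
  have C0 : 0 < C by rewrite /C; have := @stein_const_ge1 R; lra.
  have T0 : 0 < T by exact: gauss_tent_gt0.
  have CT0 : 0 < C / (16 * T) by rewrite divr_gt0// mulr_gt0.
  have K0 : 0 <= 16 * K ^+ 2 by rewrite mulr_ge0// sqr_ge0.
  have TC0 : 0 < 16 * T / C by rewrite divr_gt0// mulr_gt0.
  (* The three summands of [c0] provide [1 <= D], [16 K^2 <= D] and [C <= 16 T D]; the minimum [c1]
     provides [C c1 <= 16 T]. None depends on [d], which enters through [Delta] alone. *)
  exists (1 + 16 * K ^+ 2 + C / (16 * T)), (Num.min 1 (16 * T / C)), (3 * tail_const).
  split; [by lra|by rewrite lt_min ltr01|by rewrite mulr_gt0// tail_const_gt0|].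
  move=> d dO Omega P W n z d1 bW n2 D1 /andP[z0 zD].
  have FP := brownian_chaos n2 bW; have NP := chaos_limitN FP.
  have m0 := @chaos_weight_gt0 R n n2 d.
  have Dgt0 := @Delta_gt0 R n n2 d.
  have mD : 128 * Delta R d n ^+ 2 * chaos_weight n d <= 1.
    rewrite -[leRHS](@mulfV _ (128 * Delta R d n ^+ 2)); last first.
      by rewrite gt_eqF// mulr_gt0// exprn_gt0.
    have m2 : chaos_weight n d <= (128 * Delta R d n ^+ 2)^-1 by rewrite ge_min lexx orbT.
    by apply: ler_wpM2l m2; rewrite mulr_ge0// sqr_ge0.
  have c10 : 0 <= Num.min 1 (16 * T / C) by rewrite le_min ler01 ltW.
  have c11 : Num.min 1 (16 * T / C) <= 1 by rewrite ge_min lexx.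
  have cT : C * Num.min 1 (16 * T / C) <= 16 * T.
    by rewrite mulrC -ler_pdivlMr// ge_min lexx orbT.
  have CD : C <= 16 * T * Delta R d n.
    by rewrite mulrC -ler_pdivrMr ?mulr_gt0//; lra.
  have KD : 16 * K ^+ 2 <= Delta R d n by lra.
  have D1' : 1 <= Delta R d n by lra.
  split; first by rewrite Phi2_tail; exact: (tail_ratio FP m0 D1' z0 mD c10 c11 cT CD KD zD).
  rewrite Phi2N (_ : [set w | (Ffun W n w <= - z)%R] = [set w | (z <= - Ffun W n w)%R]).
    exact: (tail_ratio NP m0 D1' z0 mD c10 c11 cT CD KD zD).
  by apply/seteqP; split => w /=; rewrite lerNr.
- move=> d dO Omega P W n z d1 bW n2 z0.
  have FP := brownian_chaos n2 bW; have D0 := @Delta_gt0 R n n2 d.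
  apply: (chaos_concentration FP D0 _ z0).
  have m1 : @chaos_weight R n d <= 1 by rewrite ge_min lexx.
  have m2 : chaos_weight n d <= (128 * Delta R d n ^+ 2)^-1 by rewrite ge_min lexx orbT.
  (* The condition [2 D m <= 1] follows from [m <= 1] if [D <= 1/2], and from
     [2 D / (128 D^2) = 1 / (64 D)] otherwise. *)
  have [D2|D2] := leP (Delta R d n) (1 / 2).
    have := ler_wpM2l (ltW D0) m1; lra.
  apply: (@le_trans _ _ (2 * Delta R d n * (128 * Delta R d n ^+ 2)^-1)).
    by rewrite ler_wpM2l// mulr_ge0// ltW.
  rewrite ler_pdivrMr ?mul1r; last by rewrite mulr_gt0// exprn_gt0.
  have := ler_wpM2l (ltW D0) (ltW D2); lra.
Unshelve. all: by end_near. Qed.
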